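(* Let $1<p_0<\infty$, $\vec p=(p_1,\dots,p_n)$ with $1<p_i<\infty$, and $\frac n{p_0}<\sum_{i=1}^n\frac1{p_i}$. Suppose $f_k\in\mathcal{B}^{p_0'}_{\vec p\,'}(\mathbb{R}^n)$ ($k\in\mathbb N$) are nonnegative, $\|f_k\|_{\mathcal{B}^{p_0'}_{\vec p\,'}(\mathbb{R}^n)}\le1$ for all $k$, and $f_k\uparrow f$ almost everywhere. Then $f\in\mathcal{B}^{p_0'}_{\vec p\,'}(\mathbb{R}^n)$ and $$\lim_{k\to\infty}\|f_k\|_{\mathcal{B}^{p_0'}_{\vec p\,'}(\mathbb{R}^n)}=\|f\|_{\mathcal{B}^{p_0'}_{\vec p\,'}(\mathbb{R}^n)}.$$
   Context: $L^{\vec q}(\mathbb{R}^n)$ denotes the mixed-norm Lebesgue space with norm $\|f\|_{L^{\vec q}}=\big(\int_{\mathbb{R}}\cdots(\int_{\mathbb{R}}|f|^{q_1}dx_1)^{q_2/q_1}\cdots dx_n\big)^{1/q_n}$; $\vec p\,'=(p_1',\dots,p_n')$ with $1/p_i+1/p_i'=1$, and $p_0'$ is the conjugate of $p_0$. Cubes have sides parallel to the axes. A measurable function $b$ is a $(p_0',\vec p\,')$-block if there is a cube $Q$ with $\operatorname{supp}b\subset Q$ and $\|b\|_{L^{\vec p\,'}(\mathbb{R}^n)}\le|Q|^{\frac1{p_0}-\frac1n\sum_{i=1}^n\frac1{p_i}}$. The block space $\mathcal{B}^{p_0'}_{\vec p\,'}(\mathbb{R}^n)$ consists of measurable functions $f=\sum_{i=1}^\infty\lambda_ib_i$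 (series converging in $L^1_{\mathrm{loc}}$ and a.e.) with $\{\lambda_i\}\in\ell^1$ and each $b_i$ a $(p_0',\vec p\,')$-block, normed by $\|f\|_{\mathcal{B}^{p_0'}_{\vec p\,'}}=\inf\|\{\lambda_i\}\|_{\ell^1}$ over all such decompositions. *)

(* Defs.v *)
(* Points of R^n are functions 'I_n -> R
   (coordinate i : 'I_n is the paper's x_{i+1}). *)
From HB Require Import structures.
From mathcomp Require Import all_boot all_order all_algebra.
From mathcomp Require Import all_classical all_reals all_analysis.
Set Implicit Arguments. Unset Strict Implicit. Unset Printing Implicit Defensive.
Import Order.TTheory GRing.Theory Num.Theory numFieldNormedType.Exports.
Local Open Scope classical_set_scope.
Local Open Scope ring_scope.

Section Defs.
Context {R : realType} {n : nat}.
Notation pt := ('I_n -> R).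

Definition upd (x : pt) (i : 'I_n) (t : R) : pt :=
  fun j => if j == i then t else x j.

Definition mstep (q : 'I_n -> R) (i : 'I_n) (G : pt -> \bar R) : pt -> \bar R :=
  fun x => ((\int[lebesgue_measure]_t (G (upd x i t) `^ q i)) `^ (q i)^-1)%E.

(* ||f||_{L^q(R^n)} = ( int ... ( int |f|^{q_1} dx_1 )^{q_2/q_1} ... dx_n )^{1/q_n} *)
Definition mixed_norm (q : 'I_n -> R) (f : pt -> R) : \bar R :=
  (foldl (fun G i => mstep q i G) (fun x => (`|f x|)%:E) (enum 'I_n))
    (fun _ => 0).

Definition box (a b : pt) : set pt := [set x | forall i, a i <= x i <= b i].
Definition vol (a b : pt) : R := \prod_i (b i - a i).

Definition nullset (N : set pt) : Prop :=
  forall e : R, 0 < e -> exists a b : nat -> pt,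
    (forall k i, a k i <= b k i) /\ N `<=` \bigcup_k box (a k) (b k) /\
    (\sum_(k <oo) (vol (a k) (b k))%:E < e%:E)%E.

Definition borel_set : set (set pt) :=
  <<s [set B | exists a b, B = box a b] >>.

Definition lmeas (A : set pt) : Prop :=
  exists B, borel_set B /\ nullset ((A `\` B) `|` (B `\` A)).

Definition lmeasurable_fun (f : pt -> R) : Prop :=
  forall c : R, lmeas [set x | f x < c].

Definition ae (P : pt -> Prop) : Prop :=
  exists N, nullset N /\ forall x, ~ N x -> P x.

Definition cube (c : pt) (l : R) : set pt :=
  [set x | forall i, c i <= x i <= c i + l].

Definition conj_exp (r : R) : R := r / (r - 1).

Definition is_block (p0 : R) (p : 'I_n -> R) (b : pt -> R) : Prop :=
  lmeasurable_fun b /\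
  exists (c : pt) (l : R), 0 < l /\
    (forall x, b x != 0 -> cube c l x) /\
    (mixed_norm (fun i => conj_exp (p i)) b <=
       ((l ^+ n) `^ (p0^-1 - n%:R^-1 * \sum_i (p i)^-1))%:E)%E.

Definition block_decomp (p0 : R) (p : 'I_n -> R) (f : pt -> R)
    (lam : nat -> R) (b : nat -> pt -> R) : Prop :=
  (forall i, is_block p0 p (b i)) /\
  (\sum_(i <oo) (`|lam i|)%:E < +oo)%E /\
  ae (fun x => (fun N : nat => \sum_(i < N) lam i * b i x) @ \oo --> f x) /\
  (forall a c : pt,
     (fun N : nat => mixed_norm (fun _ => 1)
        (fun x => (\sum_(i < N) lam i * b i x - f x) * \1_(box a c) x))
       @ \oo --> 0%E).

Definition in_block (p0 : R) (p : 'I_n -> R) (f : pt -> R) : Prop :=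
  lmeasurable_fun f /\ exists lam b, block_decomp p0 p f lam b.

Definition block_norm (p0 : R) (p : 'I_n -> R) (f : pt -> R) : \bar R :=
  ereal_inf [set s | exists lam b, block_decomp p0 p f lam b /\
                                   s = (\sum_(i <oo) (`|lam i|)%:E)%E].

End Defs.

(* Main.v *)
(* Every element of the block space is dominated by a sum of nonnegative blocks, and
   multiplying blocks by a factor with values in [0, 1] yields blocks again.

   Membership of f.  Every cube lies in a cube of comparable size from a countable grid
   (dyadic scales and corners).  Grouping blocks, F k = sum_Q G_Q with G_Q >= 0 supported
   in the grid cube Q and sum_Q |Q|^{-a} ||G_Q||_{p'} <= A uniformly in k, where
   a = 1/p0 - (1/n) sum 1/p_i < 0.  The families (G_Q) with this bound and
   F k <= sum_Q G_Q <= f form convex sets decreasing in k, so near-minimizers of a weighted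
   quadratic energy on them form a Cauchy sequence by the parallelogram identity, and
   converge almost everywhere.  By Fatou's lemma the limit family satisfies the same bound.
   It sums to f: on a fixed box the pieces of very small cubes (by the factor |Q|^{1/p0})
   and of very large cubes (by |Q|^a) have uniformly small L^1 norm, and only finitely many
   other cubes meet the box.

   Convergence of the norms.  Write F k = th_k f with 0 <= th_k <= 1 and th_k -> 1, and take
   f = sum_i lam_i b_i.  Then F k = sum_i lam_i (th_k b_i) gives ||F k|| <= ||f||, while
   f - F k = sum_i lam_i (1 - th_k) b_i tends to 0 in norm, by dominated convergence for
   finitely many blocks and smallness of the tail of sum |lam_i|. *)
Require Import Defs.
From HB Require Import structures.
From mathcomp Require Import all_boot all_order all_algebra.
From mathcomp Require Import all_classical all_reals all_analysis.
From mathcomp Require Import measurable_realfun measurable_fun_approximation zify ring lra.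
Set Implicit Arguments. Unset Strict Implicit. Unset Printing Implicit Defensive.
Import Order.TTheory GRing.Theory Num.Theory numFieldNormedType.Exports.
Local Open Scope classical_set_scope.
Local Open Scope ring_scope.

(** Integrals here are iterated one-variable integrals, null sets come from box covers, and
    measurability means Borel up to a null set, so these notions must first be tied together: the
    iterated integral of a Borel indicator is the box outer measure. After that, functions are set
    to zero on a single Borel null set, which makes them Borel and can only lower their norms.

    The quadratic energy stands in for weak compactness: strict convexity makes members of the
    families themselves converge, and the monotonicity of [F] is what nests the families.

    The constant A = 2 * 3^(-n a) is crude: 2 comes from decompositions within 1 of norms at most 1,
    and 3 from enlarging cubes to grid cubes. Membership asks only for a finite cost; the exact norm
    is recovered by the second half. *)

Section Power.
Context {R : realType}.
Implicit Types (x y : \bar R) (r : R).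
Local Open Scope ereal_scope.

Lemma le_poweR r x y : (0 <= r)%R -> 0 <= x -> x <= y -> x `^ r <= y `^ r.
Proof.
move=> r0 x0 xy; apply: gt0_ler_poweR => //; rewrite in_itv/= ?leey ?andbT//.
exact: le_trans xy.
Qed.

Lemma poweRK r x : r != 0%R -> 0 <= x -> (x `^ r) `^ r^-1 = x.
Proof. by move=> r0 x0; rewrite -poweRrM mulfV// poweRe1. Qed.

Lemma poweRVK r x : r != 0%R -> 0 <= x -> (x `^ r^-1) `^ r = x.
Proof. by move=> r0 x0; rewrite -poweRrM mulVf// poweRe1. Qed.

(** Continuity of the power under suprema, from the inverse power alone: raising the claim to [r^-1]
    turns it into the hypothesis on [x]. *)
Lemma poweR_le_sup (u : nat -> \bar R) x r : (0 < r)%R -> (forall k, 0 <= u k) ->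
  0 <= x -> x <= ereal_sup (range u) -> x `^ r <= ereal_sup (range (fun k => u k `^ r)).
Proof.
move=> r0 u0 x0 xu; set S := ereal_sup (range _).
have S0 : 0 <= S.
  by apply: (le_trans (poweR_ge0 (u 0%N) r)); apply: ereal_sup_ubound; exists 0%N.
suff : x <= S `^ r^-1.
  move=> h; rewrite -[leRHS](poweRVK (r := r)) ?gt_eqF//.
  by apply: le_poweR => //; exact: ltW.
apply: (le_trans xu); apply: ge_ereal_sup => _ [k _ <-].
rewrite -[leLHS](poweRK (r := r)) ?gt_eqF//.
apply: le_poweR; rewrite ?invr_ge0 ?poweR_ge0//; first exact: ltW.
by apply: ereal_sup_ubound; exists k.
Qed.

(** Convergence to zero in an epsilon form where early terms may be infinite; powers and pointwise
    majorants pass through it without any topology on the extended reals. *)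
Definition cv0 (u : nat -> \bar R) :=
  forall e : R, (0 < e)%R -> exists N, forall k, (N <= k)%N -> u k <= e%:E.

Lemma cv0P (u : nat -> \bar R) : (forall k, 0 <= u k) -> u @ \oo --> 0 <-> cv0 u.
Proof.
move=> u0; split.
  move=> /fine_cvgP[[N1 _ H1] /cvgrPdist_le cu] e e0.
  have [N2 _ H2] := cu e e0.
  exists (maxn N1 N2) => k; rewrite geq_max => /andP[k1 k2].
  have := H2 k k2; rewrite /= sub0r normrN => h.
  rewrite -(fineK (H1 k k1)) lee_fin; exact: le_trans (ler_norm _) h.
move=> H; apply/fine_cvgP; split.
  have [N HN] := H 1%R ltr01.
  exists N => // k /= /HN h; rewrite ge0_fin_numE//; exact: le_lt_trans h (ltry _).
apply/cvgrPdist_le => e e0; have [N HN] := H e e0.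
exists N => // k /= /HN h; rewrite sub0r normrN.
have uf : u k \is a fin_num by rewrite ge0_fin_numE//; exact: le_lt_trans h (ltry _).
by rewrite ger0_norm ?fine_ge0// -lee_fin fineK.
Qed.

Lemma cv0_poweR (u : nat -> \bar R) r : (0 < r)%R -> (forall k, 0 <= u k) ->
  cv0 u -> cv0 (fun k => u k `^ r).
Proof.
move=> r0 u0 cu e e0.
have e1 : (0 < e `^ r^-1)%R by exact: powR_gt0.
have [N HN] := cu _ e1; exists N => k /HN h.
rewrite -[leRHS](@poweRVK r) ?gt_eqF ?lee_fin ?(ltW e0)//.
by apply: (le_poweR (ltW r0)).
Qed.
End Power.

(** * One-variable [L^r] norms of extended-real functions *)

Section OneDim.
Context {R : realType}.
Local Open Scope ereal_scope.
Local Notation mu := (@lebesgue_measure R).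
Local Notation Rm := (measurableTypeR R).
Implicit Types (g h : Rm -> \bar R) (r : R).

(* Integrals of nonnegative functions are suprema over the simple functions below them,
   so monotonicity needs no measurability; hence [mixed_norm] is monotone too. *)
Lemma ge0_le_integral_nomeas d (T : measurableType d) (m : {measure set T -> \bar R})
    (g h : T -> \bar R) : (forall t, 0 <= g t) -> (forall t, g t <= h t) ->
  \int[m]_t g t <= \int[m]_t h t.
Proof.
move=> g0 gh; have h0 t : 0 <= h t by exact: le_trans (gh t).
rewrite !ge0_integralTE//; apply: le_ereal_sup => _ [/= s sg <-].
by exists s => // t; exact: le_trans (gh t).
Qed.

Definition pnorm r g := (\int[mu]_t (g t `^ r)) `^ r^-1.

Lemma int_poweR_ge0 r g : 0 <= \int[mu]_t (g t `^ r).
Proof. by apply: integral_ge0 => t _; exact: poweR_ge0. Qed.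

Lemma le_pnorm r g h : (0 < r)%R -> (forall t, 0 <= g t) -> (forall t, g t <= h t) ->
  pnorm r g <= pnorm r h.
Proof.
move=> r0 g0 gh; apply: le_poweR; rewrite ?invr_ge0 ?(ltW r0) ?int_poweR_ge0//.
apply: ge0_le_integral_nomeas => t; first exact: poweR_ge0.
by apply: le_poweR => //; exact: ltW.
Qed.

Lemma measurable_fun_poweR d (T : measurableType d) (g : T -> \bar R) r :
  measurable_fun setT g -> measurable_fun setT (fun t => g t `^ r).
Proof. by move=> mg; exact: (measurableT_comp (measurable_poweR r) mg). Qed.

(** Monotone convergence weakened to an inequality: measurability is asked of the approximants,
    while [g] enters through monotonicity of the integral. *)
Lemma integral_le_sup d (T : measurableType d) (m : {measure set T -> \bar R})
    (G : nat -> T -> \bar R) (g : T -> \bar R) :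
  (forall k, measurable_fun setT (G k)) -> (forall k t, 0 <= G k t) ->
  (forall t, {homo G^~ t : a b / (a <= b)%N >-> a <= b}) ->
  (forall t, 0 <= g t) -> (forall t, g t <= ereal_sup (range (G^~ t))) ->
  \int[m]_t g t <= ereal_sup (range (fun k => \int[m]_t G k t)).
Proof.
move=> mG G0 ndG g0 gG.
apply: (@le_trans _ _ (\int[m]_t (limn (G^~ t)))).
  apply: ge0_le_integral_nomeas => // t; apply: (le_trans (gG t)).
  rewrite le_eqVlt; apply/orP; left; apply/eqP/esym/cvg_lim => //.
  by apply: ereal_nondecreasing_cvgn => a b; exact: ndG.
rewrite monotone_convergence//.
rewrite le_eqVlt; apply/orP; left; apply/eqP/cvg_lim => //.
apply: ereal_nondecreasing_cvgn => a b ab.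
by apply: ge0_le_integral_nomeas => // t; exact: ndG.
Qed.

Lemma pnorm_le_sup r (G : nat -> Rm -> \bar R) g : (0 < r)%R ->
  (forall k, measurable_fun setT (G k)) -> (forall k t, 0 <= G k t) ->
  (forall t, {homo G^~ t : a b / (a <= b)%N >-> a <= b}) ->
  (forall t, 0 <= g t) -> (forall t, g t <= ereal_sup (range (G^~ t))) ->
  pnorm r g <= ereal_sup (range (fun k => pnorm r (G k))).
Proof.
move=> r0 mG G0 ndG g0 gG.
apply: poweR_le_sup; rewrite ?invr_gt0 ?int_poweR_ge0//.
  by move=> k; exact: int_poweR_ge0.
apply: integral_le_sup => //.
- by move=> k; exact: measurable_fun_poweR.
- by move=> k t; exact: poweR_ge0.
- by move=> t a b ab; apply: le_poweR (ndG t _ _ ab) => //; exact: ltW.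
- by move=> t; exact: poweR_ge0.
- by move=> t; exact: poweR_le_sup.
Qed.

Lemma pnormZ r g (c : R) : (0 < r)%R -> (0 <= c)%R -> measurable_fun setT g ->
  (forall t, 0 <= g t) -> pnorm r (fun t => c%:E * g t) = c%:E * pnorm r g.
Proof.
move=> r0 c0 mg g0; rewrite /pnorm.
under eq_integral do rewrite poweRM ?lee_fin//.
rewrite ge0_integralZl_EFin ?powR_ge0//; last 2 first.
- by move=> t _; exact: poweR_ge0.
- exact: measurable_fun_poweR.
rewrite poweRM ?lee_fin ?powR_ge0 ?int_poweR_ge0//; congr (_ * _).
by rewrite -[LHS]/((c%:E `^ r) `^ r^-1) poweRK ?gt_eqF ?lee_fin.
Qed.

(* Truncation reduces Minkowski and Hoelder for extended-real functions to the
   library's versions for real functions. *)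
Definition trunc (k : nat) (y : \bar R) : R := fine (Order.min y k%:R%:E).

Lemma trunc_ge0 k y : 0 <= y -> (0 <= trunc k y)%R.
Proof. by move=> y0; rewrite fine_ge0// le_min y0 lee_fin ler0n. Qed.

Lemma truncE k y : 0 <= y -> (trunc k y)%:E = Order.min y k%:R%:E.
Proof.
move=> y0; rewrite /trunc fineK// ge0_fin_numE.
  by rewrite gt_min ltry orbT.
by rewrite le_min y0 lee_fin ler0n.
Qed.

Lemma trunc_le k y : 0 <= y -> (trunc k y)%:E <= y.
Proof. by move=> y0; rewrite truncE// ge_min lexx. Qed.

Lemma truncD k y z : 0 <= y -> 0 <= z -> (trunc k (y + z) <= trunc k y + trunc k z)%R.
Proof.
move=> y0 z0; rewrite -lee_fin EFinD !truncE ?adde_ge0//.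
rewrite ge_min; case: (leP y k%:R%:E) => hy; case: (leP z k%:R%:E) => hz;
  rewrite ?lexx //; apply/orP; right.
- by rewrite leeDr.
- by rewrite leeDl.
- by rewrite leeDl// lee_fin.
Qed.

Lemma nd_trunc y : 0 <= y -> {homo (fun k => (trunc k y)%:E) : a b / (a <= b)%N >-> a <= b}.
Proof.
move=> y0 a b ab; rewrite !truncE// le_min !ge_min lexx/= lee_fin ler_nat.
by rewrite ab orbT.
Qed.

Lemma trunc_sup y : 0 <= y -> y <= ereal_sup (range (fun k => (trunc k y)%:E)).
Proof.
move=> y0; case: y y0 => [y| |]// y0.
  apply: ereal_sup_ubound; exists (Num.truncn y).+1 => //; rewrite truncE//.
  by apply/min_idPl; rewrite lee_fin ltW// truncnS_gt.
rewrite leye_eq; apply/eqP/eq_infty => t.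
apply: le_ereal_sup_tmp; exists (trunc (Num.truncn t).+1 +oo)%:E; first by exists (Num.truncn t).+1.
by rewrite truncE// minye lee_fin ltW// truncnS_gt.
Qed.

Lemma measurable_trunc d (T : measurableType d) (g : T -> \bar R) k :
  measurable_fun setT g -> measurable_fun setT (fun t => trunc k (g t)).
Proof.
move=> mg; have m1 : measurable_fun setT (fun t => mine (g t) k%:R%:E).
  by apply: measurable_mine => //; exact: measurable_cst.
by apply: (measurableT_comp _ m1).
Qed.

Lemma pnorm_Lnorm r (g : Rm -> R) : (forall t, 0 <= g t)%R ->
  pnorm r (EFin \o g) = Lnorm mu r%:E (EFin \o g).
Proof.
move=> g0; rewrite unlock /pnorm; congr (_ `^ _).
by apply: eq_integral => t _ /=; rewrite ger0_norm.
Qed.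

Lemma pnormD r g h : (1 <= r)%R -> measurable_fun setT g -> measurable_fun setT h ->
  (forall t, 0 <= g t) -> (forall t, 0 <= h t) ->
  pnorm r (fun t => g t + h t) <= pnorm r g + pnorm r h.
Proof.
move=> r1 mg mh g0 h0; have r0 : (0 < r)%R by exact: lt_le_trans r1.
apply: (@le_trans _ _ (ereal_sup (range (fun k => pnorm r (EFin \o (fun t => trunc k (g t + h t))))))).
  apply: pnorm_le_sup => //.
  - by move=> k; apply/measurable_EFinP; apply: measurable_trunc; exact: emeasurable_funD.
  - by move=> k t; rewrite lee_fin trunc_ge0// adde_ge0.
  - by move=> t; apply: nd_trunc; rewrite adde_ge0.
  - by move=> t; rewrite adde_ge0.
  - by move=> t; apply: trunc_sup; rewrite adde_ge0.
apply: ge_ereal_sup => _ [k _ <-].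
pose gk t := trunc k (g t); pose hk t := trunc k (h t).
apply: (@le_trans _ _ (pnorm r (EFin \o (gk \+ hk)%R))).
  apply: le_pnorm => // t; first by rewrite lee_fin trunc_ge0// adde_ge0.
  by rewrite lee_fin truncD.
rewrite pnorm_Lnorm; last by move=> t; rewrite addr_ge0 ?trunc_ge0.
apply: le_trans.
  by apply: (eminkowski (p := r%:E) mu (f := gk) (g := hk)); [exact: measurable_trunc|exact: measurable_trunc|rewrite lee_fin].
rewrite -!pnorm_Lnorm; try by move=> t; exact: trunc_ge0.
by apply: leeD; apply: le_pnorm => // t; rewrite ?lee_fin ?trunc_ge0 ?trunc_le.
Qed.

Lemma pnorm1D g h : measurable_fun setT g -> measurable_fun setT h ->
  (forall t, 0 <= g t) -> (forall t, 0 <= h t) ->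
  pnorm 1 (fun t => g t + h t) = pnorm 1 g + pnorm 1 h.
Proof.
move=> mg mh g0 h0; rewrite /pnorm invr1 !poweRe1 ?int_poweR_ge0//.
rewrite -ge0_integralD//; [|by move=> t _; exact: poweR_ge0|exact: measurable_fun_poweR
  |by move=> t _; exact: poweR_ge0|exact: measurable_fun_poweR].
by apply: eq_integral => t _; rewrite !poweRe1 ?adde_ge0.
Qed.

Lemma pnorm1E g : (forall t, 0 <= g t) -> pnorm 1 g = \int[mu]_t g t.
Proof.
move=> g0; rewrite /pnorm invr1 poweRe1 ?int_poweR_ge0//.
by apply: eq_integral => t _; rewrite poweRe1.
Qed.

(** Convergence is asked only where [g] is finite; a finite [pnorm r g] makes that almost
    everywhere. This form survives iteration, where inner norms may be infinite for some values of
    the outer variables. *)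
Lemma pnorm_dominated r (G : nat -> Rm -> \bar R) g : (0 < r)%R ->
  (forall k, measurable_fun setT (G k)) -> measurable_fun setT g ->
  (forall k t, 0 <= G k t) -> (forall k t, G k t <= g t) ->
  (forall t, g t < +oo -> cv0 (G^~ t)) -> pnorm r g < +oo ->
  cv0 (fun k => pnorm r (G k)).
Proof.
move=> r0 mG mg G0 Gg cG gfin.
have g0 t : 0 <= g t by exact: le_trans (G0 0%N t) (Gg 0%N t).
apply: cv0_poweR; rewrite ?invr_gt0//; first by move=> k; exact: int_poweR_ge0.
have gi : mu.-integrable setT (fun t => g t `^ r).
  apply/integrableP; split; first exact: measurable_fun_poweR.
  rewrite (eq_integral (fun t => g t `^ r)); last first.
    by move=> t _; rewrite gee0_abs// poweR_ge0.
  by apply: lty_poweRy gfin; rewrite invr_neq0// gt_eqF.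
have aefin : {ae mu, forall t, setT t -> g t < +oo}.
  apply: filterS (integrable_ae measurableT gi) => t /= /(_ Logic.I).
  rewrite ge0_fin_numE ?poweR_ge0// => h _; apply: lty_poweRy h; by rewrite gt_eqF.
apply/cv0P; first by move=> k; exact: int_poweR_ge0.
have [] := @dominated_convergence _ _ _ mu setT measurableT
  (fun k t => G k t `^ r) (cst 0) (fun t => g t `^ r) => //.
- by move=> k; exact: measurable_fun_poweR.
- apply: filterS aefin => t /= /(_ Logic.I) ht _.
  apply/cv0P; first by move=> k; exact: poweR_ge0.
  by apply: cv0_poweR => //; exact: cG.
- apply: nearW => t k _; rewrite gee0_abs ?poweR_ge0//.
  by apply: le_poweR => //; exact: ltW.
- by move=> _ _; rewrite integral0.
Qed.

(** Hoelder's inequality against the indicator of [[a, b]], by which [g] can be multiplied for free;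
    the exponent conjugate to [r] has reciprocal [1 - r^-1], whence the constant. *)
Lemma pnorm_hoelder r g (a b : R) : (1 < r)%R -> (a <= b)%R -> measurable_fun setT g ->
  (forall t, 0 <= g t) -> (forall t, g t != 0 -> a <= t <= b)%R ->
  pnorm 1 g <= ((b - a) `^ (1 - r^-1))%:E * pnorm r g.
Proof.
move=> r1 ab mg g0 gs; have r0 : (0 < r)%R by exact: lt_trans r1.
pose s := (1 - r^-1)%R; have s0 : (0 < s)%R.
  by rewrite subr_gt0 invf_lt1.
apply: (@le_trans _ _ (ereal_sup (range (fun k => pnorm 1 (EFin \o (fun t => trunc k (g t))))))).
  apply: pnorm_le_sup => //.
  - by move=> k; apply/measurable_EFinP; exact: measurable_trunc.
  - by move=> k t; rewrite lee_fin trunc_ge0.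
  - by move=> t; exact: nd_trunc.
  - by move=> t; exact: trunc_sup.
apply: ge_ereal_sup => _ [k _ <-].
pose gk t := trunc k (g t); pose I := (\1_(`[a, b]%classic) : Rm -> R).
have gkE : gk = (I \* gk)%R.
  apply/funext => t; rewrite /I /gk /= indicE.
  have [tab|tab] := boolP (t \in _); first by rewrite mul1r.
  rewrite mul0r; have -> : g t = 0.
    apply/eqP/negPn/negP => /gs h; move/negP: tab; apply.
    by rewrite inE/= in_itv/=.
  by rewrite /trunc; have /min_idPl -> : 0 <= k%:R%:E :> \bar R by rewrite lee_fin.
rewrite pnorm_Lnorm; last by move=> t; exact: trunc_ge0.
rewrite [X in Lnorm _ _ (EFin \o X)](_ : _ = gk)// gkE.
have mI : measurable_fun setT I by exact: measurable_indic.
apply: le_trans.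
  apply: (@hoelder _ _ _ mu I gk s^-1 r mI); rewrite ?invr_gt0//.
  - exact: measurable_trunc.
  - by rewrite invrK /s subrK.
apply: lee_pmul.
- exact: Lnorm_ge0.
- exact: Lnorm_ge0.
- rewrite -pnorm_Lnorm ?/pnorm//.
  rewrite invrK (eq_integral (EFin \o I)); last first.
    move=> t _ /=; rewrite /I indicE; case: (_ \in _) => /=.
      by rewrite powR1.
    by rewrite powR0// invr_neq0// gt_eqF.
  have mIab : mu (`[a, b]%classic : set R) = (b - a)%:E.
    rewrite lebesgue_measure_itv/= lte_fin; case: ltP => h //.
    by have -> : a = b; [apply/le_anti; rewrite ab|rewrite subrr].
  have -> : \int[mu]_x (EFin \o I) x = (b - a)%:E.
    rewrite -mIab -[in RHS](setIT (`[a, b]%classic : set R)).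
    exact: integral_indic.
  by rewrite poweR_EFin.
- rewrite -pnorm_Lnorm; last by move=> t; exact: trunc_ge0.
  by apply: le_pnorm => // t; rewrite ?lee_fin ?trunc_ge0 ?trunc_le.
Qed.

End OneDim.

(** * Iterated norms on [R^n] and the Borel structure generated by boxes *)

Section MixedStep.
Context {R : realType} {n : nat}.
Local Notation pt := ('I_n -> R).
Local Notation Rm := (measurableTypeR R).

Definition boxes : set (set pt) := [set B | exists a b, B = box a b].
(* Measurability in this type is convertible to [borel_set]. *)
Definition bpt := g_sigma_algebraType boxes.
HB.instance Definition _ := Measurable.on bpt.

Lemma boxI (a b a' b' : pt) : box a b `&` box a' b' =
  box (fun i => Num.max (a i) (a' i)) (fun i => Num.min (b i) (b' i)).
Proof.
apply/seteqP; split => x /=.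
  by move=> [h h'] i; rewrite ge_max le_min; move: (h i) (h' i) => /andP[-> ->] /andP[-> ->].
by move=> h; split => i; have := h i; rewrite ge_max le_min => /andP[/andP[h1 h2] /andP[h3 h4]];
  rewrite ?h1 ?h2 ?h3 ?h4.
Qed.

Lemma measurable_box (a b : pt) : measurable (box a b : set bpt).
Proof. by apply: sub_sigma_algebra; exists a, b. Qed.

Lemma measurable_coord (i : 'I_n) : measurable_fun setT (fun x : bpt => x i).
Proof.
apply: (measurability (@RGenCInfty.G R)); first exact: RGenCInfty.measurableE.
move=> _ [_ [c ->] <-]; rewrite setTI.
(* Boxes bounded below by [c] in coordinate [i], by [- m] in the others, and above by [m] exhaust
   the half-space. *)
rewrite (_ : _ @^-1` _ = \bigcup_(m in [set: nat])
    (box (fun j => if j == i then c else - m%:R) (fun j => m%:R) : set bpt)).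
  by apply: bigcup_measurable => m _; exact: measurable_box.
apply/seteqP; split => x /=; rewrite in_itv/= andbT.
  move=> cx; pose M := \sum_j `|x j|.
  have xM j : `|x j| <= M.
    by rewrite /M (bigD1 j)//= lerDl sumr_ge0.
  exists (Num.truncn M).+1 => // j.
  have lt : M < (Num.truncn M).+1%:R by exact: truncnS_gt.
  have := le_lt_trans (xM j) lt; rewrite ltr_norml => /andP[h1 h2].
  by rewrite (ltW h2) andbT; case: eqP => [->//|_]; exact: ltW.
by move=> [m _ /(_ i)]; rewrite eqxx => /andP[].
Qed.

Lemma measurable_fun_coords d (S : measurableType d) (phi : S -> bpt) :
  (forall i, measurable_fun setT (fun s => (phi s i : R))) -> measurable_fun setT phi.
Proof.
move=> mphi; have := @measurability _ _ S bpt setT phi boxes erefl; apply.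
move=> _ [_ [a [b ->]] <-]; rewrite setTI.
rewrite (_ : _ @^-1` _ = \bigcap_(i in [set: 'I_n]) ((fun s => phi s i) @^-1` `[a i, b i]%classic)).
  apply: fin_bigcap_measurable => // i _.
  rewrite -[X in measurable X]setTI; apply: mphi => //; exact: measurable_itv.
apply/seteqP; split => s /= h i.
  by move=> _; rewrite /= in_itv/=; exact: h.
by have := h i Logic.I; rewrite /= in_itv.
Qed.

Lemma measurable_upd (i : 'I_n) :
  measurable_fun setT (fun z : bpt * Rm => (upd z.1 i z.2 : bpt)).
Proof.
apply: measurable_fun_coords => j; rewrite /upd; case: (j == i).
  exact: measurable_snd.
by apply: (measurableT_comp (measurable_coord j)); exact: measurable_fst.
Qed.

Lemma measurable_slice (x : pt) (i : 'I_n) :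
  measurable_fun setT (fun t : Rm => (upd x i t : bpt)).
Proof.
apply: measurable_fun_coords => j; rewrite /upd; case: (j == i).
  exact: measurable_id.
exact: measurable_cst.
Qed.

Local Open Scope ereal_scope.
Local Notation emeas := (@measurable_fun _ _ bpt (\bar R) setT).
Implicit Types (q : 'I_n -> R) (G H : bpt -> \bar R) (s : seq 'I_n).

Lemma mstepE q i G x : mstep q i G x = pnorm (q i) (fun t : Rm => G (upd x i t)).
Proof. by []. Qed.

Definition msteps q s G := foldl (fun G i => mstep q i G) G s.
Arguments msteps : simpl never.

Lemma msteps_cons q i s G : msteps q (i :: s) G = msteps q s (mstep q i G).
Proof. by []. Qed.

Lemma mstep_ge0 q i G x : 0 <= mstep q i G x. Proof. exact: poweR_ge0. Qed.

Lemma measurable_sliced G x i : emeas G ->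
  measurable_fun setT (fun t : Rm => G (upd x i t)).
Proof. by move=> mG; apply: (measurableT_comp mG); exact: measurable_slice. Qed.

Lemma measurable_mstep q i G : emeas G -> (forall x, 0 <= G x) ->
  emeas (mstep q i G).
Proof.
move=> mG G0; apply: measurable_fun_poweR.
apply: (@measurable_fun_fubini_tonelli_F _ _ bpt Rm R (@lebesgue_measure R)
  (fun z => G (upd z.1 i z.2) `^ q i)).
  apply: measurable_fun_poweR; apply: (measurableT_comp mG); exact: measurable_upd.
by move=> z; exact: poweR_ge0.
Qed.

Lemma msteps_ge0 q s G : (forall x, 0 <= G x) -> forall x, 0 <= msteps q s G x.
Proof.
elim: s G => [|i s IH] G G0 x //; rewrite msteps_cons; apply: IH => y.
exact: mstep_ge0.
Qed.

Lemma le_msteps q s (G H : pt -> \bar R) : (forall i, 0 < q i)%R ->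
  (forall x, 0 <= G x) -> (forall x, G x <= H x) ->
  forall x, msteps q s G x <= msteps q s H x.
Proof.
move=> q0; elim: s G H => [|i s IH] G H G0 GH x; first exact: GH.
rewrite !msteps_cons; apply: IH => y; first exact: mstep_ge0.
by rewrite !mstepE; apply: le_pnorm.
Qed.

(** One use of [pnorm_le_sup] per coordinate. The one-sided form survives the induction because it
    never asks whether the inner norm of [g] is measurable. *)
Lemma msteps_le_sup q s (G : nat -> bpt -> \bar R) (g : bpt -> \bar R) :
  (forall i, 0 < q i)%R ->
  (forall k, emeas (G k)) -> (forall k x, 0 <= G k x) ->
  (forall x, {homo G^~ x : a b / (a <= b)%N >-> a <= b}) ->
  (forall x, 0 <= g x) -> (forall x, g x <= ereal_sup (range (G^~ x))) ->
  forall x, msteps q s g x <= ereal_sup (range (fun k => msteps q s (G k) x)).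
Proof.
move=> q0; elim: s G g => [|i s IH] G g mG G0 ndG g0 gG x; first exact: gG.
rewrite msteps_cons; apply: (IH (fun k => mstep q i (G k))).
- by move=> k; exact: measurable_mstep.
- by move=> k y; exact: mstep_ge0.
- by move=> y a b ab; rewrite !mstepE; apply: le_pnorm => // t; exact: ndG.
- by move=> y; exact: mstep_ge0.
- move=> y; rewrite mstepE; apply: pnorm_le_sup => //.
  by move=> k; exact: measurable_sliced.
Qed.

Lemma mstepsZ q s (c : R) G : (forall i, 0 < q i)%R -> (0 <= c)%R ->
  emeas G -> (forall x, 0 <= G x) ->
  forall x, msteps q s (fun y => c%:E * G y) x = c%:E * msteps q s G x.
Proof.
move=> q0 c0; elim: s G => [|i s IH] G mG G0 x //.
rewrite !msteps_cons -IH; last 2 first.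
- exact: measurable_mstep.
- by move=> y; exact: mstep_ge0.
congr (msteps q s _ x); apply/funext => y.
by rewrite !mstepE pnormZ//; exact: measurable_sliced.
Qed.

Lemma mstepsD q s G H : (forall i, 1 <= q i)%R ->
  emeas G -> emeas H ->
  (forall x, 0 <= G x) -> (forall x, 0 <= H x) ->
  forall x, msteps q s (fun y => G y + H y) x <= msteps q s G x + msteps q s H x.
Proof.
move=> q1; have q0 i : (0 < q i)%R by exact: lt_le_trans (q1 i).
elim: s G H => [|i s IH] G H mG mH G0 H0 x //.
rewrite !msteps_cons; apply: le_trans (IH _ _ _ _ _ _ _) => //.
- apply: le_msteps => // y; first exact: mstep_ge0.
  by rewrite !mstepE; apply: pnormD => //; exact: measurable_sliced.
- exact: measurable_mstep.
- exact: measurable_mstep.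
- by move=> y; exact: mstep_ge0.
- by move=> y; exact: mstep_ge0.
Qed.

Lemma msteps1D s G H :
  emeas G -> emeas H ->
  (forall x, 0 <= G x) -> (forall x, 0 <= H x) ->
  forall x, msteps (fun=> 1%R) s (fun y => G y + H y) x =
            msteps (fun=> 1%R) s G x + msteps (fun=> 1%R) s H x.
Proof.
elim: s G H => [|i s IH] G H mG mH G0 H0 x //.
rewrite !msteps_cons -IH; last 4 first.
- exact: measurable_mstep.
- exact: measurable_mstep.
- by move=> y; exact: mstep_ge0.
- by move=> y; exact: mstep_ge0.
congr (msteps _ s _ x); apply/funext => y.
by rewrite !mstepE pnorm1D//; exact: measurable_sliced.
Qed.

Lemma msteps0 q s : (forall i, 0 < q i)%R -> msteps q s (fun=> 0) = (fun=> 0).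
Proof.
move=> q0; apply/funext => x; have := @mstepsZ q s 0%R (fun=> 0) q0 (lexx _).
by rewrite mul0e => -> //; rewrite mul0e.
Qed.

(** Each step replaces the majorant by its own inner norm, and finiteness of that norm at a point is
    precisely where [pnorm_dominated] gives convergence; so the hypothesis reproduces itself for the
    next coordinate. *)
Lemma msteps_dominated q s (G : nat -> bpt -> \bar R) (g : bpt -> \bar R) :
  (forall i, 0 < q i)%R ->
  (forall k, emeas (G k)) -> emeas g ->
  (forall k x, 0 <= G k x) -> (forall k x, G k x <= g x) ->
  (forall x, g x < +oo -> cv0 (G^~ x)) ->
  forall x, msteps q s g x < +oo -> cv0 (fun k => msteps q s (G k) x).
Proof.
move=> q0; elim: s G g => [|i s IH] G g mG mg G0 Gg cG x; first exact: cG.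
have g0 y : 0 <= g y by exact: le_trans (Gg 0%N y).
rewrite msteps_cons; apply: (IH (fun k => mstep q i (G k))).
- by move=> k; exact: measurable_mstep.
- exact: measurable_mstep.
- by move=> k y; exact: mstep_ge0.
- by move=> k y; rewrite !mstepE; apply: le_pnorm.
- move=> y; rewrite mstepE; apply: pnorm_dominated => //.
  - by move=> k; exact: measurable_sliced.
  - exact: measurable_sliced.
  - by move=> t; exact: cG.
Qed.

(* Iterating the one-dimensional bound needs only that the remaining variables
   keep [G] supported in [box a b]. *)
Lemma msteps_hoelder q s G (a b : pt) : (forall i, 1 < q i)%R ->
  (forall i, a i <= b i)%R -> emeas G -> (forall x, 0 <= G x) ->
  uniq s -> (forall x, G x != 0 -> forall i, i \in s -> a i <= x i <= b i)%R ->
  forall x, msteps (fun=> 1%R) s G x <=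
    (\prod_(i <- s) (b i - a i) `^ (1 - (q i)^-1))%:E * msteps q s G x.
Proof.
move=> q1 ab; have q0 i : (0 < q i)%R by exact: lt_trans (q1 i).
elim: s G => [|i s IH] G mG G0 us Gs x.
  by rewrite big_nil mul1e.
move: us => /= /andP[si us].
set c := ((b i - a i) `^ (1 - (q i)^-1))%R.
have c0 : (0 <= c)%R by exact: powR_ge0.
have mqG : emeas (mstep q i G) by exact: measurable_mstep.
rewrite !msteps_cons big_cons mulrC EFinM -muleA -/c.
apply: (@le_trans _ _ (msteps (fun=> 1%R) s (fun y => c%:E * mstep q i G y) x)).
  apply: le_msteps => // y; first exact: mstep_ge0.
  rewrite !mstepE; apply: pnorm_hoelder => //; first exact: measurable_sliced.
  by move=> t /Gs /(_ i (mem_head _ _)); rewrite /upd eqxx.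
rewrite mstepsZ//; last by move=> y; exact: mstep_ge0.
rewrite muleCA; apply: lee_pmul => //.
  by apply: msteps_ge0 => y; exact: mstep_ge0.
apply: IH => //; first by move=> y; exact: mstep_ge0.
move=> y; apply: contraNP => /existsNP[j /not_implyP[js nj]].
rewrite mstepE (_ : (fun t => _) = fun=> 0); last first.
  apply/funext => t; apply/eqP/negPn/negP => /Gs /(_ j).
  rewrite inE js orbT /upd => /(_ isT).
  by case: eqP => // ji; move: si; rewrite -ji js.
by rewrite /pnorm; under eq_integral do rewrite poweR0r ?gt_eqF//;
  rewrite integral0 poweR0r// invr_neq0// gt_eqF.
Qed.

End MixedStep.
Arguments msteps : simpl never.

(** * Series of nonnegative extended reals *)

Section Series.
Context {R : realType}.
Local Open Scope ereal_scope.
Implicit Types (u v : nat -> \bar R).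

Lemma nneseries_sup u : (forall k, 0 <= u k) ->
  \sum_(k <oo) u k = ereal_sup (range (fun N => \sum_(k < N) u k)).
Proof.
move=> u0; apply/cvg_lim => //.
under eq_fun do rewrite big_mkord.
apply: ereal_nondecreasing_cvgn => a b ab.
rewrite -!(big_mkord xpredT); exact: lee_sum_nneg_natr.
Qed.

Lemma nneseries_le u (M : \bar R) : (forall k, 0 <= u k) ->
  (forall N, \sum_(k < N) u k <= M) -> \sum_(k <oo) u k <= M.
Proof. by move=> u0 h; rewrite nneseries_sup//; apply: ge_ereal_sup => _ [N _ <-]. Qed.

Lemma psum_le_nneseries u N : (forall k, 0 <= u k) ->
  \sum_(k < N) u k <= \sum_(k <oo) u k.
Proof. by move=> u0; rewrite nneseries_sup//; apply: ereal_sup_ubound; exists N. Qed.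

Lemma term_le_nneseries u N : (forall k, 0 <= u k) -> u N <= \sum_(k <oo) u k.
Proof.
move=> u0; apply: le_trans (psum_le_nneseries N.+1 u0).
by rewrite big_ord_recr/= leeDr// sume_ge0.
Qed.

Lemma nneseries_pair (f : nat -> nat * nat) (a : nat -> nat -> \bar R) :
  set_bij setT setT f -> (forall i j, 0 <= a i j) ->
  \sum_(m <oo) a (f m).1 (f m).2 = \sum_(i <oo) \sum_(j <oo) a i j.
Proof.
move=> bf a0.
transitivity (\esum_(z in [set: nat * nat]) a z.1 z.2).
  rewrite nneseries_esumT//; symmetry.
  exact: (reindex_esum _ _ _ (fun z => a z.1 z.2)).
rewrite nneseries_esumT; last by move=> i; exact: nneseries_ge0.
rewrite (eq_esum (b := fun i => \esum_(j in [set: nat]) a i j)); last first.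
  by move=> i _; rewrite nneseries_esumT.
rewrite esum_esum//; congr esum.
by apply/seteqP; split => -[i j].
Qed.

End Series.

(** * Lebesgue outer measure from covers by closed boxes *)

Section OuterMeasure.
Context {R : realType} {n : nat}.
Local Notation pt := ('I_n.+1 -> R).
Local Notation bpt := (@bpt R n.+1).
Local Open Scope ereal_scope.

Definition box_cover (A : set pt) (ab : (nat -> pt) * (nat -> pt)) :=
  (forall k i, ab.1 k i <= ab.2 k i)%R /\ A `<=` \bigcup_k box (ab.1 k) (ab.2 k).

Definition cover_vol (ab : (nat -> pt) * (nat -> pt)) : \bar R :=
  \sum_(k <oo) (vol (ab.1 k) (ab.2 k))%:E.

Definition lstar (A : set pt) : \bar R :=
  ereal_inf [set cover_vol ab | ab in box_cover A].

Lemma vol_ge0 (a b : pt) : (forall i, a i <= b i)%R -> (0 <= vol a b)%R.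
Proof. by move=> ab; apply: prodr_ge0 => i _; rewrite subr_ge0. Qed.

Lemma cover_vol_ge0 A ab : box_cover A ab -> 0 <= cover_vol ab.
Proof.
by move=> [h _]; apply: nneseries_ge0 => k _ _; rewrite lee_fin vol_ge0.
Qed.

Lemma lstar_ge0 A : 0 <= lstar A.
Proof. by apply: le_ereal_inf_tmp => _ [ab h <-]; exact: cover_vol_ge0 h. Qed.

Lemma lstar_cover A ab : box_cover A ab -> lstar A <= cover_vol ab.
Proof. by move=> h; apply: ereal_inf_lbound; exists ab. Qed.

Lemma lstar_adherent A (e : R) : (0 < e)%R -> lstar A < +oo ->
  exists2 ab, box_cover A ab & cover_vol ab < lstar A + e%:E.
Proof.
move=> e0 Afin; have : lstar A \is a fin_num by rewrite ge0_fin_numE ?lstar_ge0.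
by move=> /(lb_ereal_inf_adherent e0)[_ [ab h <-]]; exists ab.
Qed.

Lemma nullsetP (N : set pt) : nullset N <-> lstar N = 0.
Proof.
split=> [hN|hN].
  apply/eqP; rewrite eq_le lstar_ge0 andbT; apply/lee_addgt0Pr => e e0.
  have [a [b [ab [Nab h]]]] := hN e e0.
  by rewrite add0e; apply: le_trans (ltW h); exact: (lstar_cover (ab := (a, b))).
move=> e e0; have [|[a b] [/= ab Nab] h] := @lstar_adherent N e e0.
  by rewrite hN.
by exists a, b; split => //; split => //; move: h; rewrite hN add0e.
Qed.

(** The cover consists of copies of one point. A point has volume zero because there is at least one
    coordinate, an empty product being 1; hence the dimension [n.+1]. *)
Lemma lstar0 : lstar set0 = 0.
Proof.
apply/eqP; rewrite eq_le lstar_ge0 andbT.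
apply: le_trans (lstar_cover (ab := (fun _ _ => 0%R, fun _ _ => 0%R)) _) _.
  by split.
rewrite /cover_vol eseries0// => k _ _ /=.
by rewrite /vol (bigD1 ord0)//= subrr mul0r.
Qed.

(** Near-optimal covers of the [F k], with errors summing to [e], are merged into one cover through
    a bijection of [nat] with [nat * nat]. *)
Lemma lstar_subadditive A F : subset_sigma_subadditive lstar A F.
Proof.
move=> AF; have [[i ioo]|] := pselect (exists i, lstar (F i) = +oo).
  rewrite (eseries_pinfty _ _ ioo) ?leey// => k _.
  by rewrite -ltNye (lt_le_trans _ (lstar_ge0 _)).
rewrite -forallNE => Foo.
suff add2e (e : {posnum R}) : lstar A <= \sum_(i <oo) lstar (F i) + e%:num%:E.
  by apply/lee_addgt0Pr => _/posnumP[].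
rewrite (le_trans _ (epsilon_trick _ _ _))//; last first.
  by move=> k; exact: lstar_ge0.
have [G PG] : {G : nat -> (nat -> pt) * (nat -> pt) & forall k,
    box_cover (F k) (G k) /\
    cover_vol (G k) <= lstar (F k) + (e%:num / (2 ^ k.+1)%:R)%:E}.
  apply: (@choice _ _ (fun k g => box_cover (F k) g /\
    cover_vol g <= lstar (F k) + (e%:num / (2 ^ k.+1)%:R)%:E)) => k.
  have [||ab h1 /ltW h2] := @lstar_adherent (F k) (e%:num / (2 ^ k.+1)%:R) => //.
    by rewrite ltey; apply/eqP.
  by exists ab.
have /card_esym/ppcard_eqP[f] := card_nat2.
apply: (@le_trans _ _ (cover_vol (fun m => (G (f m).1).1 (f m).2, fun m => (G (f m).1).2 (f m).2))).
  apply: lstar_cover; split => [m i|]; first exact: (PG (f m).1).1.1.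
  move=> x /AF [k _ /((PG k).1.2) [j _ xkj]].
  by exists (f^-1%FUN (k, j)) => //=; rewrite invK ?inE.
rewrite /cover_vol/= (nneseries_pair (f := f)
  (a := fun k j => (vol ((G k).1 j) ((G k).2 j))%:E)); last 2 first.
- exact: bij.
- by move=> k j; rewrite lee_fin vol_ge0//; exact: (PG k).1.1.
apply: lee_nneseries => k *; [exact: cover_vol_ge0 (PG k).1|exact: (PG k).2].
Qed.

HB.instance Definition _ := isSubsetOuterMeasure.Build R pt lstar
  lstar0 lstar_ge0 lstar_subadditive.

Lemma nullset_sub (M N : set pt) : M `<=` N -> nullset N -> nullset M.
Proof.
move=> MN /nullsetP hN; apply/nullsetP/eqP; rewrite eq_le lstar_ge0 andbT -hN.
exact: le_outer_measure.
Qed.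

Lemma nullset_bigcup (N : nat -> set pt) : (forall k, nullset (N k)) ->
  nullset (\bigcup_k N k).
Proof.
move=> hN; apply/nullsetP/eqP; rewrite eq_le lstar_ge0 andbT.
apply: le_trans (outer_measure_sigma_subadditive lstar N) _.
by rewrite eseries0// => k _ _; apply/nullsetP.
Qed.

Lemma nullset0 : nullset (set0 : set pt).
Proof. by apply/nullsetP; exact: lstar0. Qed.

Lemma nullsetU (M N : set pt) : nullset M -> nullset N -> nullset (M `|` N).
Proof.
move=> hM hN; rewrite -bigcup2E; apply: nullset_bigcup => -[|[|k]] //=.
exact: nullset0.
Qed.

(* A closed box is cut by the hyperplane [x i = c] into two (possibly degenerate)
   closed boxes whose volumes add up. *)
Definition clip (i : 'I_n.+1) (c : R) (a b : pt) : pt * pt :=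
  (upd b i (Num.max (a i) (Num.min (b i) c)), upd a i (Num.min (b i) (Num.max (a i) c))).

Lemma clip_vol i c a b : (forall i, a i <= b i)%R ->
  vol a b = (vol a (clip i c a b).1 + vol (clip i c a b).2 b)%R.
Proof.
move=> ab; rewrite /vol [LHS](bigD1 i)//= [X in (_ = X + _)%R](bigD1 i)//=
  [X in (_ = _ + X)%R](bigD1 i)//= /clip/= /upd !eqxx.
rewrite [X in (_ * _ = _ * X + _)%R](eq_bigr (fun j => b j - a j)%R); last first.
  by move=> j /negbTE ->.
rewrite [X in (_ * _ = _ + _ * X)%R](eq_bigr (fun j => b j - a j)%R); last first.
  by move=> j /negbTE ->.
rewrite -mulrDl; congr (_ * _)%R; have := ab i.
by rewrite !minEle !maxEle; case: (leP (b i) c); case: (leP (a i) c) => h1 h2 h3;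
  repeat case: leP => ? //; lra.
Qed.

Lemma clip_le i c a b : (forall i, a i <= b i)%R ->
  (forall j, a j <= (clip i c a b).1 j)%R /\ (forall j, (clip i c a b).2 j <= b j)%R.
Proof.
move=> ab; split => j; rewrite /clip /upd /=; case: eqP => // ->.
  by rewrite le_max lexx.
by rewrite ge_min lexx.
Qed.

Lemma clip_box i c a b x : box a b x ->
  ((x i <= c)%R -> box a (clip i c a b).1 x) /\
  ((c < x i)%R -> box (clip i c a b).2 b x).
Proof.
move=> xab; split => xc j; have := xab j; rewrite /clip /upd /=;
  case: eqP => // -> /andP[h1 h2].
  by rewrite h1 le_max le_min h2 xc orbT.
by rewrite h2 ge_min ge_max h1 (ltW xc) orbT.
Qed.

(** Cutting every box of a cover along the hyperplane gives covers of the two parts of [X] whose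
    volumes add up to that of the original cover. *)
Lemma halfspace_caratheodory i c : lstar.-caratheodory [set x : pt | (x i <= c)%R].
Proof.
apply: le_caratheodory_measurable => X; set H := [set x | _].
apply: le_ereal_inf_tmp => _ [[a b] [/= ab Xab] <-].
pose a' k := (clip i c (a k) (b k)).2; pose b' k := (clip i c (a k) (b k)).1.
have -> : cover_vol (a, b) = cover_vol (a, b') + cover_vol (a', b).
  rewrite /cover_vol -nneseriesD.
  - by apply: eq_eseriesr => k _ /=; rewrite -EFinD -clip_vol.
  - move=> k _ _; rewrite lee_fin vol_ge0//; exact: (clip_le _ _ (ab k)).1.
  - move=> k _ _; rewrite lee_fin vol_ge0//; exact: (clip_le _ _ (ab k)).2.
apply: leeD; apply: lstar_cover; split => [k|].
- exact: (clip_le _ _ (ab k)).1.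
- by move=> x [/Xab [k _ xk] xc]; exists k => //; exact: (clip_box i c xk).1.
- exact: (clip_le _ _ (ab k)).2.
- move=> x [/Xab [k _ xk] /negP]; rewrite -ltNge => xc.
  by exists k => //; exact: (clip_box i c xk).2.
Qed.

Local Notation U := (caratheodory_type lstar).

Lemma ge_halfspace_measurable i c : measurable ([set x : pt | (c <= x i)%R] : set U).
Proof.
rewrite (_ : [set x | _] = \bigcap_(m : nat) ~` [set x | (x i <= c - m.+1%:R^-1)%R]).
  apply: bigcapT_measurable => m; apply: measurableC; exact: halfspace_caratheodory.
apply/seteqP; split => x /= h.
  move=> m _ /=; apply/negP; rewrite -ltNge; apply: lt_le_trans h.
  by rewrite ltrBlDr ltrDl invr_gt0.
apply/ler_addgt0Pr => e e0.
pose m := Num.truncn e^-1; have := h m Logic.I => /negP; rewrite -ltNge ltrBlDr => /ltW.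
move/le_trans; apply; rewrite lerD2l -[leRHS]invrK lef_pV2 ?posrE ?invr_gt0//.
by rewrite ltW// truncnS_gt.
Qed.

Lemma box_caratheodory (a b : pt) : measurable (box a b : set U).
Proof.
rewrite (_ : box a b = \bigcap_(i in [set: 'I_n.+1])
    ([set x | (a i <= x i)%R] `&` [set x | (x i <= b i)%R])).
  apply: fin_bigcap_measurable => // i _; apply: measurableI.
    exact: ge_halfspace_measurable.
  exact: halfspace_caratheodory.
apply/seteqP; split => x /= h i.
  by move=> _ /=; have /andP[] := h i.
by have [h1 h2] := h i Logic.I; rewrite h1 h2.
Qed.

Lemma borel_caratheodory (A : set bpt) : measurable A -> measurable (A : set U).
Proof.
apply: smallest_sub; first exact: sigma_algebra_measurable.
by move=> _ [a [b ->]]; exact: box_caratheodory.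
Qed.

(** A separate name on which the measure structure over Borel sets is declared, [lstar] itself
    already carrying that of an outer measure. *)
Definition lebn (A : set bpt) : \bar R := lstar A.

Let lebn0 : lebn set0 = 0. Proof. exact: lstar0. Qed.
Let lebn_ge0 A : 0 <= lebn A. Proof. exact: lstar_ge0. Qed.
Let lebn_sigma_additive : semi_sigma_additive lebn.
Proof.
move=> F mF tF mU; apply: (caratheodory_measure_sigma_additive (mu := lstar)) => //.
- by move=> k; exact: borel_caratheodory.
- exact: borel_caratheodory.
Qed.

HB.instance Definition _ := isMeasure.Build _ bpt R lebn lebn0 lebn_ge0 lebn_sigma_additive.

End OuterMeasure.

(** * Series and lower limits under iterated norms *)

Section MstepsSeries.
Context {R : realType} {n : nat}.
Local Notation bpt := (@bpt R n).
Local Notation emeas := (@measurable_fun _ _ bpt (\bar R) setT).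
Local Open Scope ereal_scope.
Implicit Types (q : 'I_n -> R) (s : seq 'I_n) (G : nat -> bpt -> \bar R).

Lemma emeas_nneseries G : (forall k, emeas (G k)) -> (forall k x, 0 <= G k x) ->
  emeas (fun x => \sum_(k <oo) G k x).
Proof.
move=> mG G0; apply: (emeasurable_fun_cvg (fun N x => \sum_(k < N) G k x)).
  by move=> N; apply: emeasurable_sum.
move=> x _; have := @is_cvg_nneseries _ (G^~ x) xpredT 0%N (fun k _ _ => G0 k x).
by under eq_fun do rewrite big_mkord.
Qed.

Lemma emeas_psum G N : (forall k, emeas (G k)) -> emeas (fun x => \sum_(k < N) G k x).
Proof. by move=> mG; apply: emeasurable_sum. Qed.

Lemma msteps_psum_le q s G N x : (forall i, 1 <= q i)%R ->
  (forall k, emeas (G k)) -> (forall k x, 0 <= G k x) ->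
  msteps q s (fun y => \sum_(k < N) G k y) x <= \sum_(k < N) msteps q s (G k) x.
Proof.
move=> q1 mG G0; elim: N => [|N IH].
  rewrite big_ord0; under eq_fun do rewrite big_ord0.
  by rewrite msteps0// => i; exact: lt_le_trans (q1 i).
rewrite big_ord_recr/=; under eq_fun do rewrite big_ord_recr/=.
apply: le_trans (mstepsD _ _ _ _ _ _ _) _ => //.
- exact: emeas_psum.
- by move=> y; exact: sume_ge0.
- exact: leeD.
Qed.

Lemma msteps_nneseries_le q s G x : (forall i, 1 <= q i)%R ->
  (forall k, emeas (G k)) -> (forall k x, 0 <= G k x) ->
  msteps q s (fun y => \sum_(k <oo) G k y) x <= \sum_(k <oo) msteps q s (G k) x.
Proof.
move=> q1 mG G0; have q0 i : (0 < q i)%R by exact: lt_le_trans (q1 i).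
apply: (@le_trans _ _ (ereal_sup (range (fun N => msteps q s (fun y => \sum_(k < N) G k y) x)))).
  apply: (msteps_le_sup _ q0 (G := fun N y => \sum_(k < N) G k y)) => //.
  - by move=> N; exact: emeas_psum.
  - by move=> N y; exact: sume_ge0.
  - move=> y a b ab; rewrite -!(big_mkord xpredT (G^~ y)).
    exact: lee_sum_nneg_natr.
  - by move=> y; exact: nneseries_ge0.
  - by move=> y; rewrite nneseries_sup.
apply: ge_ereal_sup => _ [N _ <-]; apply: le_trans (msteps_psum_le _ _ _ _ _ _) _ => //.
by apply: psum_le_nneseries => k; exact: msteps_ge0.
Qed.

Lemma msteps1_psum s G N x :
  (forall k, emeas (G k)) -> (forall k x, 0 <= G k x) ->
  msteps (fun=> 1%R) s (fun y => \sum_(k < N) G k y) x =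
  \sum_(k < N) msteps (fun=> 1%R) s (G k) x.
Proof.
move=> mG G0; elim: N => [|N IH].
  rewrite big_ord0 (_ : (fun y => _) = fun=> 0) ?msteps0//.
  by apply/funext => y; rewrite big_ord0.
rewrite big_ord_recr/= (_ : (fun y => _) = fun y => \sum_(k < N) G k y + G N y).
  2: by apply/funext => y; rewrite big_ord_recr.
rewrite msteps1D ?IH//; first exact: emeas_psum.
by move=> y; exact: sume_ge0.
Qed.

(** With exponent 1 in every coordinate the iterated norm is additive ([integD]), which is what
    allows it to define a measure on indicators. *)
Definition integ (G : bpt -> \bar R) := msteps (fun=> 1%R) (enum 'I_n) G (fun=> 0%R).

Lemma integ_ge0 (G : bpt -> \bar R) : (forall x, 0 <= G x) -> 0 <= integ G.
Proof. by move=> G0; exact: (msteps_ge0 _ _ G0). Qed.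

Lemma le_integ (G H : bpt -> \bar R) : (forall x, 0 <= G x) -> (forall x, G x <= H x) ->
  integ G <= integ H.
Proof. by move=> G0 GH; apply: le_msteps. Qed.

Lemma integD (G H : bpt -> \bar R) : emeas G -> emeas H ->
  (forall x, 0 <= G x) -> (forall x, 0 <= H x) ->
  integ (fun x => G x + H x) = integ G + integ H.
Proof. by move=> *; apply: msteps1D. Qed.

Lemma integZ (c : R) (G : bpt -> \bar R) : (0 <= c)%R -> emeas G ->
  (forall x, 0 <= G x) -> integ (fun x => c%:E * G x) = c%:E * integ G.
Proof. by move=> *; apply: mstepsZ. Qed.

Lemma integ_psum G N : (forall k, emeas (G k)) -> (forall k x, 0 <= G k x) ->
  integ (fun y => \sum_(k < N) G k y) = \sum_(k < N) integ (G k).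
Proof. by move=> *; exact: msteps1_psum. Qed.

Lemma integ_nneseries G : (forall k, emeas (G k)) -> (forall k x, 0 <= G k x) ->
  integ (fun y => \sum_(k <oo) G k y) = \sum_(k <oo) integ (G k).
Proof.
move=> mG G0; apply/eqP; rewrite eq_le; apply/andP; split.
  exact: msteps_nneseries_le.
apply: nneseries_le => [k|N]; first exact: integ_ge0.
rewrite -integ_psum//; apply: le_integ => y; first exact: sume_ge0.
exact: psum_le_nneseries.
Qed.

Lemma emeas_einfs G k : (forall k, emeas (G k)) -> emeas (fun x => einfs (G^~ x) k).
Proof. by move=> mG; exact: measurable_fun_einfs. Qed.

Lemma le_sup_einfs (u : nat -> \bar R) (l : \bar R) : u @ \oo --> l ->
  l <= ereal_sup (range (einfs u)).
Proof.
move=> /cvg_einfs cl; have /cvg_lim <- // := cl.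
by have /cvg_lim -> := @cvg_einfs_sup R u.
Qed.

(** Fatou's lemma for iterated norms: the lower limit is the increasing limit of the infima [einfs],
    and the k-th infimum lies below [G k]. *)
Lemma msteps_fatou q s G (g : bpt -> \bar R) (M : \bar R) x : (forall i, 0 < q i)%R ->
  (forall k, emeas (G k)) -> (forall k x, 0 <= G k x) -> (forall x, 0 <= g x) ->
  (forall y, g y <= ereal_sup (range (einfs (G^~ y)))) ->
  (forall k, msteps q s (G k) x <= M) -> msteps q s g x <= M.
Proof.
move=> q0 mG G0 g0 gG hM.
have e0 k y : 0 <= einfs (G^~ y) k by apply: le_ereal_inf_tmp => _ [j _ <-].
apply: (le_trans (msteps_le_sup (G := fun k y => einfs (G^~ y) k) _ _ _ _ _ _ _ _)) => //.
- by move=> k; exact: emeas_einfs.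
- by move=> y a b ab; exact: nondecreasing_einfs.
apply: ge_ereal_sup => _ [k _ <-]; apply: le_trans (hM k).
apply: le_msteps => // y; apply: ereal_inf_lbound; exists k => //=.
Qed.

End MstepsSeries.

(** * Iterated integrals compared with box covers, and reduction to Borel functions *)

Section BorelMeasure.
Context {R : realType} {n : nat}.
Local Notation pt := ('I_n.+1 -> R).
Local Notation bpt := (@bpt R n.+1).
Local Notation emeas := (@measurable_fun _ _ bpt (\bar R) setT).
Local Open Scope ereal_scope.

Definition ind (A : set bpt) : bpt -> \bar R := fun x => (\1_A x)%:E.

Lemma ind_ge0 A x : 0 <= ind A x. Proof. by rewrite lee_fin. Qed.

Lemma emeas_ind A : measurable A -> emeas (ind A).
Proof. by move=> mA; apply/measurable_EFinP; exact: measurable_indic. Qed.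

Lemma ind1 (A : set bpt) x : A x -> ind A x = 1.
Proof. by move=> Ax; rewrite /ind indicE mem_set. Qed.

Lemma ind0 (A : set bpt) x : ~ A x -> ind A x = 0.
Proof. by move=> Ax; rewrite /ind indicE memNset. Qed.

(** The indicator of a box as a product over a list of coordinates, so that integrating the head of
    the list peels off one factor and leaves the same shape. *)
Definition coord_ind (a b : pt) (l : seq 'I_n.+1) (x : pt) : R :=
  \prod_(i <- l) \1_(`[a i, b i]%classic) (x i).

Lemma measurable_coord_ind a b l :
  measurable_fun setT (fun x : bpt => coord_ind a b l x).
Proof.
apply: measurable_prod => i _; apply: (measurableT_comp _ (measurable_coord i)).
apply: measurable_indic; exact: measurable_itv.
Qed.

Lemma coord_ind_ge0 a b l x : (0 <= coord_ind a b l x)%R.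
Proof. by apply: prodr_ge0 => i _. Qed.

Lemma coord_ind_msteps a b s l x : (forall i, a i <= b i)%R -> uniq (s ++ l) ->
  msteps (fun=> 1%R) s (fun y : bpt => (coord_ind a b (s ++ l) y)%:E) x =
  ((\prod_(i <- s) (b i - a i)) * coord_ind a b l x)%:E.
Proof.
move=> ab; elim: s x => [|i s IH] x; first by rewrite big_nil mul1r.
move=> /= /andP[isl usl]; rewrite msteps_cons.
rewrite (_ : mstep _ _ _ = fun y => (b i - a i)%:E * (coord_ind a b (s ++ l) y)%:E).
  rewrite mstepsZ ?subr_ge0//; last 2 first.
  - by apply/measurable_EFinP; exact: measurable_coord_ind.
  - by move=> y; rewrite lee_fin coord_ind_ge0.
  by rewrite IH// -EFinM big_cons mulrA.
apply/funext => y; rewrite mstepE pnorm1E; last first.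
  by move=> t; rewrite lee_fin coord_ind_ge0.
rewrite (eq_integral (fun t : measurableTypeR R => (coord_ind a b (s ++ l) y)%:E *
    (\1_(`[a i, b i]%classic) t)%:E)); last first.
  move=> t _; rewrite /coord_ind big_cons -EFinM mulrC /upd eqxx; congr (_ * _)%:E.
  apply: eq_big_seq => j jl; case: eqP => // ji; move: isl; rewrite -ji jl//.
rewrite ge0_integralZl_EFin ?coord_ind_ge0//; last first.
  by apply/measurable_EFinP; apply: measurable_indic; exact: measurable_itv.
rewrite muleC; congr (_ * _); rewrite integral_indic; last 2 first.
- exact: measurableT.
- exact: measurable_itv.
rewrite setIT.
apply: (etrans (lebesgue_measure_itv `[a i, b i])); rewrite /= lte_fin; case: ltP => h //.
by have -> : a i = b i; [apply/le_anti; rewrite ab|rewrite subrr].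
Qed.

Lemma integ_box (a b : pt) : (forall i, a i <= b i)%R -> integ (ind (box a b)) = (vol a b)%:E.
Proof.
move=> ab; have := @coord_ind_msteps a b (enum 'I_n.+1) [::] (fun=> 0%R) ab.
rewrite cats0 enum_uniq => /(_ isT); rewrite /coord_ind big_nil mulr1 big_enum/= => <-.
rewrite /integ; congr (msteps _ _ _ _); apply/funext => x; rewrite /ind.
congr EFin; rewrite big_enum/=.
have [xab|xab] := pselect (box a b x).
  rewrite indicE mem_set// big1// => i _; rewrite indicE mem_set//=.
  by rewrite in_itv/=; exact: xab.
rewrite indicE memNset//; move/existsNP: xab => [i xi].
by rewrite (bigD1 i)//= indicE memNset ?mul0r//= in_itv.
Qed.

(** A cover of [A] dominates [ind A] by a sum of box indicators, whose iterated integral is the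
    volume of the cover. *)
Lemma integ_ind_le_lstar (A : set bpt) : measurable A ->
  integ (ind A) <= lstar A.
Proof.
move=> mA; apply: le_ereal_inf_tmp => _ [[a' b'] [/= ab Aab] <-].
rewrite /cover_vol/= (eq_eseriesr (g := fun k => integ (ind (box (a' k) (b' k))))); last first.
  by move=> k _; rewrite integ_box.
rewrite -integ_nneseries; last 2 first.
- by move=> k; apply: emeas_ind; exact: measurable_box.
- by move=> k x; exact: ind_ge0.
apply: le_integ => x; first exact: ind_ge0.
have [Ax|Ax] := pselect (A x); last first.
  by rewrite ind0//; apply: nneseries_ge0 => k _ _; exact: ind_ge0.
have [k _ xk] := Aab x Ax; rewrite ind1// -(ind1 xk).
by apply: (@term_le_nneseries _ (fun k => ind (box (a' k) (b' k)) x)) => j; exact: ind_ge0.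
Qed.

Definition imeas (A : set bpt) : \bar R := integ (ind A).

Let imeas0 : imeas set0 = 0.
Proof.
rewrite /imeas /integ (_ : ind set0 = fun=> 0) ?msteps0//.
by apply/funext => x; rewrite ind0.
Qed.
Let imeas_ge0 A : 0 <= imeas A. Proof. by apply: integ_ge0 => x; exact: ind_ge0. Qed.
Let imeas_sigma_additive : semi_sigma_additive imeas.
Proof.
move=> F mF tF mU; rewrite /imeas.
rewrite (_ : ind (\bigcup_k F k) = fun x => \sum_(k <oo) ind (F k) x); last first.
  by apply/funext => x; rewrite /ind indic_bigcup.
rewrite integ_nneseries; last 2 first.
- by move=> k; exact: emeas_ind.
- by move=> k x; exact: ind_ge0.
by apply: is_cvg_nneseries => k _ _; exact: imeas_ge0.
Qed.

HB.instance Definition _ := isMeasure.Build _ bpt R imeas imeas0 imeas_ge0 imeas_sigma_additive.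

(** Uniqueness of measures: both sides are measures on Borel sets, boxes are stable under
    intersection, and the boxes [g k] of finite measure exhaust the space. On a box,
    [integ_ind_le_lstar] gives one inequality and the box as its own cover gives the other. This
    ties [nullset] to [integ]. *)
Lemma imeas_lstar (A : set bpt) : measurable A -> imeas A = lstar A.
Proof.
move=> mA; rewrite -/(lebn A).
pose g (k : nat) : set bpt := box (fun=> - k%:R)%R (fun=> k%:R)%R.
have box_eq (B : set bpt) : boxes B -> imeas B = lebn B /\ imeas B < +oo.
  move=> [a [b ->]]; have [[x xab]|h] := pselect (exists x, box a b x); last first.
    have -> : box a b = set0 by apply/seteqP; split => // x xab; apply: h; exists x.
    by rewrite !measure0.
  have ab i : (a i <= b i)%R by have /andP[] := xab i; exact: le_trans.
  have iE : imeas (box a b) = (vol a b)%:E by rewrite /imeas integ_box.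
  split; last by rewrite iE ltry.
  apply/eqP; rewrite eq_le; apply/andP; split.
    by apply: integ_ind_le_lstar => //; exact: measurable_box.
  (* The cover is the box itself followed by copies of a point, which add no volume. *)
  rewrite iE; apply: le_trans (lstar_cover (ab := (fun k => if k is 0%N then a else fun=> 0%R,
     fun k => if k is 0%N then b else fun=> 0%R)) _) _.
    split => [[|k] i|x' ?] //=; by exists 0%N.
  rewrite /cover_vol/= nneseries_recl//; last first.
    by move=> [|k] _ /=; rewrite lee_fin vol_ge0.
  rewrite [X in _ + X](_ : _ = 0) ?adde0//.
  rewrite eseries_cond eseries0// => -[|k] //= _ _.
  by rewrite /vol big_ord_recl subrr mul0r.
refine (@measure_unique _ R bpt boxes g erefl _ _ _ imeas lebn _ _ A mA).
- move=> _ _ [a [b ->]] [a' [b' ->]]; rewrite boxI; eexists; eexists; reflexivity.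
- by move=> k; eexists; eexists; reflexivity.
- apply/seteqP; split => // x _; pose M := (\sum_j `|x j|)%R.
  exists (Num.truncn M).+1 => // j.
  have xM : (`|x j| <= M)%R by rewrite /M (bigD1 j)//= lerDl sumr_ge0.
  have := le_lt_trans xM (truncnS_gt M).
  by rewrite ltr_norml => /andP[/ltW -> /ltW ->].
- by move=> B /box_eq[].
- by move=> k; apply: (box_eq _ _).2; eexists; eexists; reflexivity.
Qed.

Lemma nullset_integ (B : set bpt) : measurable B -> nullset B <-> integ (ind B) = 0.
Proof. by move=> mB; rewrite -[integ _]/(imeas B) imeas_lstar//; exact: nullsetP. Qed.

(** The hull is the intersection of covers of volume below [k.+1%:R^-1], each a countable union of
    boxes. *)
Lemma nullset_borel_hull (N : set pt) : nullset N ->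
  exists B : set bpt, [/\ measurable B, N `<=` B & nullset B].
Proof.
move=> hN.
have H (k : nat) : exists ab : (nat -> pt) * (nat -> pt),
    box_cover N ab /\ cover_vol ab < (k.+1%:R^-1)%:E.
  have k0 : (0 < k.+1%:R^-1 :> R)%R by rewrite invr_gt0.
  by have [a [b [h1 [h2 h3]]]] := hN _ k0; exists (a, b).
have [G PG] := @choice _ _ _ H.
pose W k : set bpt := \bigcup_j box ((G k).1 j) ((G k).2 j).
have mW k : measurable (W k) by apply: bigcupT_measurable => j; exact: measurable_box.
exists (\bigcap_k W k); split; first exact: bigcapT_measurable.
  by move=> x /= Nx k _; exact: (PG k).1.2.
move=> e e0; pose k := Num.truncn e^-1.
exists (G k).1, (G k).2; split; first exact: (PG k).1.1; split.
  by move=> x /(_ k Logic.I).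
apply: (lt_trans (PG k).2); rewrite lte_fin -[ltRHS]invrK ltf_pV2 ?posrE ?invr_gt0//.
exact: truncnS_gt.
Qed.

Lemma nullset_eqy (G : bpt -> \bar R) : emeas G -> (forall x, 0 <= G x) ->
  integ G < +oo -> nullset [set x | G x = +oo].
Proof.
move=> mG G0 Gfin; set B := [set x | _].
have mB : measurable (B : set bpt).
  by have := emeasurable_set1 (+oo : \bar R) => /(mG measurableT); rewrite setTI.
apply/nullset_integ => //; apply/eqP; rewrite eq_le integ_ge0 ?andbT; last exact: ind_ge0.
have mI := emeas_ind mB.
have G_fin : integ G \is a fin_num by rewrite ge0_fin_numE// integ_ge0.
apply/lee_addgt0Pr => e e0; rewrite add0e.
(* Markov's inequality: since [G] is infinite on [B], every multiple of [ind B] lies below [G]. This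
   multiple makes [c * e] equal to [integ G + 1]. *)
pose c := ((fine (integ G) + 1) / e)%R.
have fG : (0 <= fine (integ G))%R by rewrite fine_ge0// integ_ge0.
have c0 : (0 < c)%R by rewrite divr_gt0// ltr_wpDl.
rewrite -(@lee_pmul2l _ c%:E)// -integZ ?(ltW c0)//; last exact: ind_ge0.
apply: (@le_trans _ _ (integ G)).
  apply: le_integ => x; first by rewrite mule_ge0 ?ind_ge0// lee_fin ltW.
  have [Bx|Bx] := pselect (B x); last by rewrite ind0// mule0.
  by rewrite Bx leey.
rewrite -[leLHS]fineK// -EFinM lee_fin /c divfK ?gt_eqF//.
by rewrite lerDl.
Qed.

(** The series is infinite on [B] and zero elsewhere: a majorant of anything that happens on a null
    set, at no cost. *)
Lemma integ_csty (B : set bpt) : measurable B -> nullset B ->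
  integ (fun x => \sum_(k <oo) ind B x) = 0.
Proof.
move=> mB hB; rewrite integ_nneseries; last 2 first.
- by move=> _; exact: emeas_ind.
- by move=> _; exact: ind_ge0.
by rewrite eseries0// => k _ _; apply/nullset_integ.
Qed.

Lemma nneseries_ind_y (B : set bpt) x : B x -> \sum_(k <oo) ind B x = +oo.
Proof.
move=> Bx; apply/eq_infty => t; apply: le_trans (psum_le_nneseries (Num.truncn t).+1 _); last first.
  by move=> _; exact: ind_ge0.
under eq_bigr do rewrite ind1//.
rewrite sumEFin big_const iter_addr addr0 card_ord lee_fin.
exact/ltW/truncnS_gt.
Qed.

(** Adding [G] to itself infinitely often makes it infinite wherever it is nonzero and keeps the
    integral zero, so [nullset_eqy] applies. *)
Lemma nullset_neq0 (G : bpt -> \bar R) : emeas G -> (forall x, 0 <= G x) ->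
  integ G = 0 -> nullset [set x | G x != 0].
Proof.
move=> mG G0 Gint.
apply: (@nullset_sub _ _ _ [set x | \sum_(k <oo) G x = +oo]).
  move=> x /= Gx; apply/eq_infty => t.
  have : 0 < G x by rewrite lt0e Gx G0.
  case Gxe : (G x) => [r| |] //; last first.
    move=> _; apply: le_trans (leey _) _; rewrite -Gxe.
    by apply: (@term_le_nneseries _ (fun=> G x) 0) => _.
  rewrite lte_fin => r0.
  apply: le_trans (psum_le_nneseries (Num.truncn (t / r)).+1 _); last by move=> _; rewrite -Gxe.
  rewrite sumEFin big_const iter_addr addr0 card_ord lee_fin -mulr_natr -ler_pdivrMl// mulrC.
  exact/ltW/truncnS_gt.
apply: nullset_eqy.
- exact: emeas_nneseries.
- by move=> x; exact: nneseries_ge0.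
- by rewrite integ_nneseries// eseries0.
Qed.

(** [g] may be arbitrary on [N]; adding to [H] the costless function that is infinite on a Borel
    hull of [N] makes the bound hold everywhere, and monotonicity applies. *)
Lemma mixed_norm1_le (g : pt -> R) (H : bpt -> \bar R) (N : set pt) :
  emeas H -> (forall x, 0 <= H x) -> nullset N ->
  (forall x, ~ N x -> (`|g x|)%:E <= H x) -> mixed_norm (fun=> 1%R) g <= integ H.
Proof.
move=> mH H0 /nullset_borel_hull[B [mB NB hB]] gH.
rewrite -[leRHS]adde0 -(integ_csty mB hB) -integD//; last 2 first.
- by apply: emeas_nneseries => k; [exact: emeas_ind|exact: ind_ge0].
- by move=> x; apply: nneseries_ge0 => k _ _; exact: ind_ge0.
apply: le_msteps => // x.
have S0 : 0 <= \sum_(k <oo) ind B x by apply: nneseries_ge0 => k _ _; exact: ind_ge0.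
have [Bx|Bx] := pselect (B x).
  by rewrite nneseries_ind_y// addey ?leey// gt_eqF// (lt_le_trans _ (H0 x)).
by apply: (le_trans (gH x _)); [move=> /NB|rewrite leeDl].
Qed.

(** Replacing [f] by zero on [B] turns a Lebesgue measurable function into a Borel one for a
    suitable null [B]. As absolute values only decrease, blocks stay blocks. *)
Definition off (B : set bpt) (f : pt -> R) : bpt -> R := fun x => (\1_(~` B) x * f x)%R.

Lemma off_out B f x : ~ B x -> off B f x = f x.
Proof. by move=> Bx; rewrite /off indicE mem_set// mul1r. Qed.

Lemma off_in (B : set bpt) f x : B x -> off B f x = 0%R.
Proof. by move=> Bx; rewrite /off indicE memNset ?mul0r//=; apply/contrapT. Qed.

Lemma measurable_off_sub (A B : set bpt) f : A `<=` B -> measurable B ->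
  measurable_fun setT (off A f) -> measurable_fun setT (off B f).
Proof.
move=> AB mB mA; rewrite (_ : off B f = (\1_(~` B) \* off A f)%R).
  by apply: measurable_funM => //; apply: measurable_indic; exact: measurableC.
apply/funext => x /=; have [Bx|Bx] := pselect (B x).
  by rewrite off_in// indicE memNset ?mul0r//=; apply/contrapT.
rewrite off_out// off_out; last by move=> /AB.
by rewrite indicE mem_set// mul1r.
Qed.

(** Rational levels determine the function and are countable, so the sets where a sublevel set
    differs from its Borel version [W r] fit into one Borel null set. *)
Lemma lmeasurable_off (f : pt -> R) : lmeasurable_fun f ->
  exists B : set bpt, [/\ measurable B, nullset B & measurable_fun setT (off B f)].
Proof.
move=> mf; have [W PW] := @choice _ _ _ (fun r : rat => mf (ratr r)).
pose L (r : rat) : set pt := [set x | (f x < ratr r)%R].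
pose D (r : rat) : set pt := (L r `\` W r) `|` (W r `\` L r).
have hN : nullset (\bigcup_k (if unpickle k is Some r then D r else set0)).
  apply: nullset_bigcup => k; case: unpickle => [r|]; last exact: nullset0.
  exact: (PW r).2.
have [B [mB NB hB]] := nullset_borel_hull hN; exists B; split => //.
apply: (measurability (@RGenInftyO.G R)); first exact: RGenInftyO.measurableE.
move=> _ [_ [c ->] <-]; rewrite setTI.
have Wf r x : ~ B x -> W r x <-> (f x < ratr r)%R.
  have Dx : D r x -> B x.
    by move=> h; apply: NB; exists (pickle r); [exact: I|rewrite pickleK].
  move=> Bx; split.
    by move=> Wx; apply: contrapT => h; apply: Bx; apply: Dx; right; split.
  by move=> fx; apply: contrapT => h; apply: Bx; apply: Dx; left; split.
(* Outside [B] the value lies below [c] iff it lies below some rational less than [c]; on [B] the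
   value is 0, so [B] is added exactly when [0 < c]. *)
rewrite (_ : _ @^-1` _ = ((\bigcup_k (if unpickle k is Some r then
     (if (ratr r < c)%R then W r else set0) else set0)) `&` ~` B)
     `|` (if (0 < c)%R then B else set0)).
  apply: measurableU; last by case: ifP.
  apply: measurableI; last exact: measurableC.
  apply: bigcupT_measurable => k; case: unpickle => [r|]; last exact: measurable0.
  by case: ifP => _; [exact: (PW r).1|exact: measurable0].
apply/seteqP; split => x /=; rewrite in_itv/=.
  have [Bx|Bx] := pselect (B x); first by rewrite off_in// => ->; right.
  rewrite off_out// => fxc; left; split => //.
  have [r /andP[fr rc]] : exists r : rat, (f x < ratr r < c)%R.
    by have [r] := rat_in_itvoo fxc; rewrite in_itv/=; exists r.
  by exists (pickle r); [exact: I|rewrite pickleK rc; apply/Wf].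
move=> [[[k _]]|].
  case: unpickle => [r|] //; case: ifP => // rc Wx Bx.
  by rewrite off_out//; apply: lt_trans rc; apply/Wf.
by case: ifP => // c0 Bx; rewrite off_in.
Qed.

Lemma off_lmeasurable (f : pt -> R) (g : bpt -> R) (N : set pt) :
  measurable_fun setT g -> nullset N -> (forall x, ~ N x -> f x = g x) ->
  lmeasurable_fun f.
Proof.
move=> mg hN fg c; exists [set x | (g x < c)%R]; split.
  have := mg measurableT _ (measurable_itv `]-oo, c[); rewrite setTI.
  by rewrite (_ : _ @^-1` _ = [set x | (g x < c)%R]).
apply: nullset_sub hN => x /= h; apply: contrapT => Nx.
by move: h; rewrite fg// => -[[]|[]].
Qed.

End BorelMeasure.

Section Exponents.
Context {R : realType}.

Lemma conj_exp_gt1 (r : R) : 1 < r -> 1 < conj_exp r.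
Proof.
move=> r1; rewrite /conj_exp ltr_pdivlMr ?subr_gt0// mul1r.
by rewrite ltrBlDr ltrDl.
Qed.

Lemma conj_exp_compl (r : R) : 1 < r -> 1 - (conj_exp r)^-1 = r^-1.
Proof.
move=> r1; rewrite /conj_exp; field.
by rewrite subr_eq0 !gt_eqF// (lt_trans _ r1).
Qed.

Lemma powR_sum (I : Type) (s : seq I) (e : I -> R) (x : R) : 0 < x ->
  \prod_(i <- s) x `^ e i = x `^ (\sum_(i <- s) e i).
Proof.
move=> x0; elim: s => [|i s IH]; first by rewrite !big_nil powRr0.
by rewrite !big_cons IH powRD// (gt_eqF x0) implybT.
Qed.

End Exponents.

(** * Interleaved series and tails *)

Section Interleave.
Context {T : Type}.
Definition interleave (u v : nat -> T) (k : nat) : T :=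
  if odd k then v k./2 else u k./2.
End Interleave.

Section InterleaveSums.
Context {R : realType}.

Lemma interleave_sum (V : nmodType) (u v : nat -> V) N :
  \sum_(k < N) interleave u v k = \sum_(k < uphalf N) u k + \sum_(k < N./2) v k.
Proof.
elim: N => [|N IH]; first by rewrite !big_ord0 addr0.
rewrite big_ord_recr/= IH /interleave uphalf_half; case: (odd N) => /=.
  by rewrite !add1n !big_ord_recr/= !addrA.
by rewrite !add0n !big_ord_recr/= addrAC.
Qed.

Lemma cvg_half : (fun k => k./2) @ \oo --> \oo.
Proof.
apply/cvgnyPge => A; exists (A.*2) => // k /= Ak.
by rewrite -(doubleK A) half_leq.
Qed.

Lemma cvg_uphalf : uphalf @ \oo --> \oo.
Proof.
apply/cvgnyPge => A; exists (A.*2) => // k /= Ak.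
by rewrite -(doubleK A); apply: leq_trans (half_leq Ak) _; rewrite uphalf_half leq_addl.
Qed.

Lemma interleave_nneseries (u v : nat -> \bar R) :
  (forall k, 0 <= u k)%E -> (forall k, 0 <= v k)%E ->
  (\sum_(k <oo) interleave u v k <= \sum_(k <oo) u k + \sum_(k <oo) v k)%E.
Proof.
move=> u0 v0; apply: nneseries_le => [k|N].
  by rewrite /interleave; case: ifP.
by rewrite interleave_sum; apply: leeD; exact: psum_le_nneseries.
Qed.

Lemma series_tail_le (u : nat -> R) (l : R) N :
  (fun N : nat => \sum_(i < N) u i) @ \oo --> l ->
  ((`|\sum_(i < N) u i - l|)%:E <= \sum_(k <oo) (`|u (k + N)%N|)%:E)%E.
Proof.
move=> cu; set T := (X in (_ <= X)%E).
have T0 : (0 <= T)%E by apply: nneseries_ge0 => k _ _; rewrite lee_fin.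
case TE : T T0 => [t| |] // t0; last by rewrite leey.
rewrite lee_fin.
have cN : (fun M : nat => `|\sum_(i < N) u i - \sum_(i < (M + N)%N) u i|) @ \oo -->
    `|\sum_(i < N) u i - l|.
  apply: cvg_norm; apply: cvgB; first exact: cvg_cst.
  by rewrite (cvg_shiftn N (fun M : nat => \sum_(i < M) u i)).
rewrite -(cvg_lim _ cN)//; apply: limr_le; first by apply/cvg_ex; eexists; exact: cN.
apply: nearW => M; rewrite -lee_fin -TE.
apply: (@le_trans _ _ (\sum_(k < M) (`|u (k + N)%N|)%:E)%E); last first.
  by apply: (@psum_le_nneseries _ (fun k => (`|u (k + N)%N|)%:E)) => k; rewrite lee_fin.
rewrite sumEFin lee_fin addnC big_split_ord/= opprD addrA subrr add0r normrN.
apply: le_trans (ler_norm_sum _ _ _) _.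
by apply: ler_sum => k _; rewrite addnC.
Qed.

Lemma nneseries_tail_cv0 (lam : nat -> R) : (\sum_(k <oo) (`|lam k|)%:E < +oo)%E ->
  cv0 (fun M => \sum_(M <= k <oo) (`|lam k|)%:E)%E.
Proof.
move=> hl; apply/cv0P; first by move=> M; apply: nneseries_ge0 => j _ _; rewrite lee_fin.
by apply: nneseries_tail_cvg => // k _; rewrite lee_fin.
Qed.

End InterleaveSums.

(** * Blocks, their local [L^1] bounds, and Borel decompositions *)

Section Blocks.
Context {R : realType} {n : nat}.
Local Notation pt := ('I_n.+1 -> R).
Local Notation bpt := (@bpt R n.+1).
Local Notation emeas := (@measurable_fun _ _ bpt (\bar R) setT).
Local Notation bmeas := (@measurable_fun _ _ bpt R setT).
Context (p0 : R) (p : 'I_n.+1 -> R).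
Context (p0_gt1 : 1 < p0) (p_gt1 : forall i, 1 < p i).
Context (p0p : n.+1%:R / p0 < \sum_i (p i)^-1).

Let q i := conj_exp (p i).
Let q_gt1 i : 1 < q i. Proof. exact: conj_exp_gt1. Qed.
Let q_gt0 i : 0 < q i. Proof. exact: lt_trans (q_gt1 i). Qed.
Let S := \sum_i (p i)^-1.
Let S_gt0 : 0 < S.
Proof.
by apply: le_lt_trans p0p; rewrite divr_ge0// ltW// (lt_trans _ p0_gt1).
Qed.

(** The mixed norm allowed to a block on a cube of side [l]; by [p0p] it is a negative power of
    [l]. *)
Definition cubew (l : R) := (l ^+ n.+1) `^ (p0^-1 - n.+1%:R^-1 * \sum_i (p i)^-1).

Lemma cubew_gt0 l : 0 < l -> 0 < cubew l.
Proof. by move=> l0; rewrite powR_gt0// exprn_gt0. Qed.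

Lemma cubewE l : 0 < l -> cubew l = l `^ (n.+1%:R / p0 - S).
Proof.
move=> l0; rewrite /cubew -powR_mulrn ?(ltW l0)// -powRrM; congr (_ `^ _).
by rewrite mulrBr mulrA mulfV// mul1r.
Qed.

(** Bound for the [L^1] norm on [kbox m] of a block on a cube of side [l]: the intersection has
    sides at most [l] and [2m], Hoelder's inequality contributes the power [(p i)^-1] of the i-th
    side, and [cubew l] bounds the norm. *)
Definition loc_const (m : nat) (l : R) := (Num.min l (m.*2)%:R) `^ S * cubew l.

Lemma loc_const_le_small m l : (0 < m)%N -> 0 < l -> loc_const m l <= l `^ (n.+1%:R / p0).
Proof.
move=> m0 l0; rewrite /loc_const cubewE//.
apply: (@le_trans _ _ (l `^ S * l `^ (n.+1%:R / p0 - S))).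
  rewrite ler_wpM2r ?powR_ge0// ge0_ler_powR ?(ltW S_gt0)//.
  - by rewrite nnegrE le_min ltW//=.
  - by rewrite nnegrE ltW.
  - by rewrite ge_min lexx.
by rewrite -powRD ?(gt_eqF l0) ?implybT// addrC subrK.
Qed.

(** Here the exponent of [l] is negative by [p0p], while in [loc_const_le_small] it is positive:
    very large and very small cubes both carry little mass on a fixed box. *)
Lemma loc_const_le_large m l : (0 < m)%N -> 0 < l ->
  loc_const m l <= (m.*2)%:R `^ S * l `^ (n.+1%:R / p0 - S).
Proof.
move=> m0 l0; rewrite /loc_const cubewE//.
rewrite ler_wpM2r ?powR_ge0// ge0_ler_powR ?(ltW S_gt0)//.
- by rewrite nnegrE le_min ltW//=.
- by rewrite nnegrE ler0n.
- by rewrite ge_min lexx orbT.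
Qed.

Lemma loc_const_bounded m : (0 < m)%N -> exists C, forall l, 0 < l -> loc_const m l <= C.
Proof.
move=> m0; exists (Num.max 1 ((m.*2)%:R `^ S)) => l l0.
rewrite le_max; case: (leP l 1) => l1; apply/orP; [left|right].
  apply: le_trans (loc_const_le_small m0 l0) _.
  apply: (@le_trans _ _ (1 `^ (n.+1%:R / p0))); last by rewrite powR1.
  apply: ge0_ler_powR => //; rewrite ?nnegrE ?(ltW l0)//.
  by rewrite divr_ge0// ltW// (lt_trans _ p0_gt1).
apply: le_trans (loc_const_le_large m0 l0) _.
rewrite -[leRHS]mulr1 ler_wpM2l ?powR_ge0//.
apply: (@le_trans _ _ (l `^ 0)); last by rewrite powRr0.
by apply: ler_powR; [exact: ltW|rewrite subr_le0 ltW].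
Qed.

Definition kbox (m : nat) : set bpt := box (fun=> - m%:R) (fun=> m%:R).

Definition nrm (G : bpt -> \bar R) : \bar R := msteps q (enum 'I_n.+1) G (fun=> 0).

Lemma mixed_normE (f : pt -> R) : mixed_norm q f = nrm (fun x => (`|f x|)%:E).
Proof. by []. Qed.

Lemma nrm_ge0 G : (forall x, 0 <= G x)%E -> (0 <= nrm G)%E.
Proof. by move=> G0; exact: (msteps_ge0 _ _ G0). Qed.

Lemma le_nrm G H : (forall x, 0 <= G x)%E -> (forall x, G x <= H x)%E -> (nrm G <= nrm H)%E.
Proof. by move=> *; exact: le_msteps. Qed.

Lemma nrmZ (c : R) G : 0 <= c -> emeas G -> (forall x, 0 <= G x)%E ->
  nrm (fun x => c%:E * G x)%E = (c%:E * nrm G)%E.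
Proof. by move=> *; exact: mstepsZ. Qed.

Lemma emeas_abs (g : bpt -> R) : bmeas g -> emeas (fun x => (`|g x|)%:E).
Proof. by move=> mg; apply/measurable_EFinP; exact: measurableT_comp. Qed.

Lemma loc_bound (g : bpt -> \bar R) (c : pt) (l : R) (m : nat) : (0 < m)%N -> 0 < l ->
  emeas g -> (forall x, 0 <= g x)%E -> (forall x, g x != 0 -> cube c l x)%E ->
  (integ (fun x => g x * ind (kbox m) x) <=
   (loc_const m l)%:E * ((cubew l)^-1%:E * nrm g))%E.
Proof.
move=> m0 l0 mg g0 gs; set K : set bpt := kbox m.
have mK : measurable (K : set bpt) by exact: measurable_box.
set h := fun x => _.
have h0 x : (0 <= h x)%E by rewrite mule_ge0// ind_ge0.
have hs x : (h x != 0)%E -> cube c l x /\ K x.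
  move=> hx; split.
    by apply: gs; apply: contraNN hx => /eqP gx; rewrite /h gx mul0e.
  by apply: contrapT => Kx; move: hx; rewrite /h ind0// mule0 eqxx.
have mh : emeas h by apply: emeasurable_funM => //; exact: emeas_ind.
have cl := cubew_gt0 l0.
have ng0 : (0 <= nrm g)%E by exact: nrm_ge0.
have RHS0 : (0 <= (loc_const m l)%:E * ((cubew l)^-1%:E * nrm g))%E.
  by rewrite !mule_ge0// lee_fin ?invr_ge0 ?(ltW cl)// mulr_ge0 ?powR_ge0.
(* A point where [h] is nonzero shows that the intersection box is nonempty, which provides the
   ordering [a i <= b i] required by [msteps_hoelder]. *)
have [[x0 x0h]|nh] := pselect (exists x, h x != 0)%E; last first.
  rewrite /integ (_ : h = fun=> 0%E) ?msteps0//.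
  by apply/funext => x; apply/eqP/negPn/negP => hx; apply: nh; exists x.
pose a i := Num.max (c i) (- m%:R) : R; pose b i := Num.min (c i + l) m%:R : R.
have sub x : (h x != 0)%E -> forall i, a i <= x i <= b i.
  move=> /hs[cx Kx] i; rewrite /a /b ge_max le_min.
  by have /andP[-> ->] := cx i; have /andP[-> ->] := Kx i.
have ab i : a i <= b i by have /andP[] := sub _ x0h i; exact: le_trans.
apply: (@le_trans _ _ ((\prod_(i <- enum 'I_n.+1) (b i - a i) `^ (1 - (q i)^-1))%:E * nrm h))%E.
  by apply: msteps_hoelder => //; [exact: enum_uniq|move=> x /sub xi i _; exact: xi].
rewrite muleA; apply: lee_pmul.
- by rewrite lee_fin; apply: prodr_ge0 => i _; exact: powR_ge0.
- exact: nrm_ge0.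
- rewrite -EFinM lee_fin /loc_const mulfK ?gt_eqF// /S -powR_sum; last first.
    by rewrite lt_min l0 ltr0n double_gt0.
  rewrite [leLHS]big_enum/=; apply: ler_prod => i _.
  rewrite powR_ge0/= /q conj_exp_compl//; apply: ge0_ler_powR.
  + by rewrite invr_ge0 ltW// (lt_trans _ (p_gt1 i)).
  + by rewrite nnegrE subr_ge0.
  + by rewrite nnegrE le_min ltW//=.
  + rewrite /a /b le_min; apply/andP; split.
      have h1 : Num.min (c i + l) m%:R <= c i + l by rewrite ge_min lexx.
      have h2 : c i <= Num.max (c i) (- m%:R) by rewrite le_max lexx.
      by lra.
    have h1 : Num.min (c i + l) m%:R <= m%:R by rewrite ge_min lexx orbT.
    have h2 : - m%:R <= Num.max (c i) (- m%:R) by rewrite le_max lexx orbT.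
    by rewrite -addnn natrD; lra.
- apply: le_nrm => // x; rewrite /h -[leRHS]mule1; apply: lee_wpmul2l => //.
  by rewrite /ind lee_fin indicE; case: (_ \in _).
Qed.

(** Borel rather than Lebesgue measurable, as the lemmas on iterated integrals demand. *)
Definition wblock (b : bpt -> R) := bmeas b /\ is_block p0 p b.

Lemma bmeas_lmeas (b : bpt -> R) : bmeas b -> lmeasurable_fun b.
Proof. by move=> mb; exact: (@off_lmeasurable _ _ b b set0 mb nullset0). Qed.

Lemma is_block_le (b b' : pt -> R) : lmeasurable_fun b' -> is_block p0 p b ->
  (forall x, `|b' x| <= `|b x|) -> is_block p0 p b'.
Proof.
move=> mb' [mb [c [l [l0 [bs bn]]]]] b'b; split => //; exists c, l; split => //; split.
  move=> x b'x; apply: bs; apply: contraNN b'x => /eqP bx.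
  by have := b'b x; rewrite bx normr0 normr_le0.
apply: le_trans bn; rewrite !mixed_normE; apply: le_nrm => x; rewrite lee_fin//.
Qed.

Lemma off_block (B : set bpt) (b : pt -> R) : bmeas (off B b) -> is_block p0 p b ->
  wblock (off B b).
Proof.
move=> mb hb; split => //; apply: is_block_le hb _; first exact: bmeas_lmeas.
by move=> x; rewrite /off indicE; case: (_ \in _); rewrite ?mul1r// mul0r normr0.
Qed.

Lemma block_loc (b : bpt -> R) m C : (0 < m)%N -> (forall l, 0 < l -> loc_const m l <= C) ->
  wblock b ->
  (integ (fun x => (`|b x|)%:E * ind (kbox m) x) <= C%:E)%E.
Proof.
move=> m0 hC [mb [_ [c [l [l0 [bs bn]]]]]].
apply: le_trans (loc_bound m0 l0 (emeas_abs mb) _ _) _ => //.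
- by move=> x bx; apply: bs; apply: contraNN bx => /eqP ->; rewrite normr0.
- have cl := cubew_gt0 l0.
  apply: (@le_trans _ _ ((loc_const m l)%:E * ((cubew l)^-1%:E * (cubew l)%:E)))%E.
    apply: lee_wpmul2l; first by rewrite lee_fin mulr_ge0 ?powR_ge0.
    by apply: lee_wpmul2l => //; rewrite lee_fin invr_ge0 ltW.
  by rewrite -!EFinM mulVf ?gt_eqF// mulr1 lee_fin hC.
Qed.

Lemma off_choose (b : nat -> pt -> R) (N : set pt) : (forall k, lmeasurable_fun (b k)) ->
  nullset N ->
  exists B : set bpt, [/\ measurable B, nullset B, N `<=` B & forall k, bmeas (off B (b k))].
Proof.
move=> mb hN; have [A PA] := @choice _ _ _ (fun k => lmeasurable_off (mb k)).
have hA : nullset (N `|` \bigcup_k A k).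
  by apply: nullsetU => //; apply: nullset_bigcup => k; have [] := PA k.
have [B [mB AB hB]] := nullset_borel_hull hA; exists B; split => //.
  by move=> x Nx; apply: AB; left.
move=> k; have [mA _ mk] := PA k; apply: measurable_off_sub mk => // x Ax.
by apply: AB; right; exists k.
Qed.

(** A decomposition into Borel blocks that records only almost everywhere convergence;
    [wdecomp_block_decomp] restores the [L^1_loc] part. *)
Definition wdecomp (f : pt -> R) (lam : nat -> R) (b : nat -> pt -> R) :=
  [/\ forall i, wblock (b i), (\sum_(i <oo) (`|lam i|)%:E < +oo)%E &
    ae (fun x => (fun N : nat => \sum_(i < N) lam i * b i x) @ \oo --> f x)].

Lemma ae_sub (P Q : pt -> Prop) : (forall x, P x -> Q x) -> ae P -> ae Q.
Proof. by move=> PQ [N [hN NP]]; exists N; split => // x /NP /PQ. Qed.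

Lemma ae_and (P Q : pt -> Prop) : ae P -> ae Q -> ae (fun x => P x /\ Q x).
Proof.
move=> [N [hN NP]] [M [hM MQ]]; exists (N `|` M); split; first exact: nullsetU.
by move=> x h; split; [apply: NP|apply: MQ] => hx; apply: h; [left|right].
Qed.

Lemma ae_off (B : set bpt) (P : pt -> Prop) : nullset B -> (forall x, ~ B x -> P x) -> ae P.
Proof. by exists B. Qed.

Lemma block_decomp_wdecomp f lam b : block_decomp p0 p f lam b -> exists b', wdecomp f lam b'.
Proof.
move=> [hb [hl [[N [hN Nc]] _]]].
have [B [mB hB NB mb]] := @off_choose b N (fun k => (hb k).1) hN.
exists (fun k => off B (b k)); split => //; first by move=> i; exact: off_block.
exists B; split => // x Bx; rewrite (_ : (fun N => _) = fun N : nat => \sum_(i < N) lam i * b i x).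
  by apply: Nc => /NB.
by apply/funext => M; apply: eq_bigr => i _; rewrite off_out.
Qed.

(* Convergence in L^1_loc comes for free: on a bounded box all blocks have uniformly
   bounded L^1 norm. *)
Lemma wdecomp_block_decomp f lam b : lmeasurable_fun f -> wdecomp f lam b ->
  block_decomp p0 p f lam b.
Proof.
move=> mf [hb hl [N [hN Nc]]]; split; first by move=> i; exact: (hb i).2.
split => //; split; first by exists N.
move=> a c.
apply/cv0P; first by move=> k; apply: msteps_ge0 => x; rewrite lee_fin.
have [m m0 acK] : exists2 m : nat, (0 < m)%N & box a c `<=` kbox m.
  pose M := \sum_j `|a j| + \sum_j `|c j|; exists (Num.truncn M).+1 => // x xac i.
  have MA : `|a i| <= M by rewrite /M (bigD1 i)//= -addrA lerDl addr_ge0 ?sumr_ge0.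
  have MC : `|c i| <= M by rewrite /M [X in _ + X](bigD1 i)//= addrCA lerDl addr_ge0 ?sumr_ge0.
  have := truncnS_gt M; have := xac i; move: MA MC; rewrite !ler_norml.
  set T := _.+1%:R; move: (x i) (a i) (c i) => u v w.
  by move=> /andP[? ?] /andP[? ?] /andP[? ?] ?; apply/andP; split; lra.
set K : set bpt := kbox m in acK.
have mK : measurable (K : set bpt) by exact: measurable_box.
have [C HC] := loc_const_bounded m0.
have C0 : 0 <= C by apply: le_trans (HC 1 ltr01); rewrite mulr_ge0 ?powR_ge0.
pose u i (x : bpt) : \bar R := ((`|lam i|)%:E * ((`|b i x|)%:E * ind K x))%E.
have u0 i x : (0 <= u i x)%E by rewrite /u !mule_ge0 ?lee_fin//.
have mbi i : emeas (fun x => (`|b i x|)%:E * ind K x)%E.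
  by apply: emeasurable_funM; [apply: emeas_abs; exact: (hb i).1|exact: emeas_ind].
have mu i : emeas (u i) by exact: measurable_funeM.
have bound M : (mixed_norm (fun=> 1%R) (fun x => ((\sum_(i < M) lam i * b i x - f x) * \1_(box a c) x)%R)
    <= C%:E * \sum_(M <= k <oo) (`|lam k|)%:E)%E.
  apply: (@le_trans _ _ (integ (fun x => \sum_(k <oo) u (k + M)%N x)%E)).
    apply: (mixed_norm1_le (N := N)) => //.
    - by apply: emeas_nneseries.
    - by move=> x; apply: nneseries_ge0.
    - move=> x Nx; have [xac|xac] := pselect (box a c x); last first.
        rewrite indicE memNset// mulr0 normr0; exact: nneseries_ge0.
      rewrite indicE mem_set// mulr1.
      apply: (le_trans (@series_tail_le _ (fun i => lam i * b i x) (f x) M (Nc x Nx))).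
      apply: lee_nneseries => k *; first by rewrite lee_fin.
      by rewrite /u ind1 ?mule1 ?normrM ?EFinM//; exact: acK.
  rewrite integ_nneseries// -nneseriesZl; last by move=> *; rewrite lee_fin.
  rewrite -(@nneseries_addn _ (fun k => C%:E * (`|lam k|)%:E)%E M); last first.
    by move=> k; rewrite mule_ge0 ?lee_fin.
  apply: lee_nneseries => k *; first exact: integ_ge0.
  rewrite /u integZ//; last by move=> x; rewrite mule_ge0 ?lee_fin.
  rewrite muleC; apply: lee_wpmul2r; first by rewrite lee_fin.
  exact: block_loc.
move=> e e0; have e1 : 0 < e / (C + 1) by rewrite divr_gt0// ltr_wpDl.
have [N0 HN0] := nneseries_tail_cv0 hl e1.
exists N0 => k /HN0 hk; apply: le_trans (bound k) _.
apply: (@le_trans _ _ (C%:E * (e / (C + 1))%:E)%E); first by apply: lee_wpmul2l; rewrite ?lee_fin.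
rewrite -EFinM lee_fin mulrCA ler_piMr ?(ltW e0)// ler_pdivrMr ?ltr_wpDl//.
by rewrite mul1r lerDl.
Qed.

Lemma block_norm_ge0 f : (0 <= block_norm p0 p f)%E.
Proof.
apply: le_ereal_inf_tmp => _ [lam [b [_ ->]]]; apply: nneseries_ge0 => k _ _.
by rewrite lee_fin.
Qed.

Lemma block_norm_le f lam b : lmeasurable_fun f -> wdecomp f lam b ->
  (block_norm p0 p f <= \sum_(i <oo) (`|lam i|)%:E)%E.
Proof.
move=> mf hd; apply: ereal_inf_lbound; exists lam, b; split => //.
exact: wdecomp_block_decomp.
Qed.

Lemma in_block_wdecomp f : in_block p0 p f -> forall e, 0 < e ->
  exists lam b, wdecomp f lam b /\
    (\sum_(i <oo) (`|lam i|)%:E < block_norm p0 p f + e%:E)%E.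
Proof.
move=> [_ [lam0 [b0 hd0]]] e e0.
have nfin : block_norm p0 p f \is a fin_num.
  rewrite ge0_fin_numE ?block_norm_ge0//; apply: le_lt_trans hd0.2.1.
  by apply: ereal_inf_lbound; exists lam0, b0.
have [_ [lam [b [hd ->]]] hlt] := lb_ereal_inf_adherent e0 nfin.
by have [b' hb'] := block_decomp_wdecomp hd; exists lam, b'.
Qed.

Lemma wdecompD f g lam b mu c : wdecomp f lam b -> wdecomp g mu c ->
  wdecomp (fun x => f x + g x) (interleave lam mu) (interleave b c).
Proof.
move=> [hb hl hf] [hc hm hg]; split.
- by move=> i; rewrite /interleave; case: ifP.
- apply: (@le_lt_trans _ _ (\sum_(i <oo) (`|lam i|)%:E + \sum_(i <oo) (`|mu i|)%:E)%E).
    rewrite (eq_eseriesr (g := interleave (fun i => (`|lam i|)%:E) (fun i => (`|mu i|)%:E))).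
      by apply: interleave_nneseries => k; rewrite lee_fin.
    by move=> i _; rewrite /interleave; case: ifP.
  by rewrite lte_add_pinfty.
- apply: ae_sub (ae_and hf hg) => x [fx gx].
  (* Among the first [N] interleaved terms, [uphalf N] come from the first series and [N./2] from
     the second, and both counts tend to infinity. *)
  rewrite (_ : (fun N => _) = fun N => \sum_(i < uphalf N) lam i * b i x + \sum_(i < N./2) mu i * c i x).
    apply: cvgD.
      exact: (cvg_comp _ _ cvg_uphalf fx).
    exact: (cvg_comp _ _ cvg_half gx).
  apply/funext => N; rewrite -(interleave_sum (fun i => lam i * b i x) (fun i => mu i * c i x)).
  by apply: eq_bigr => i _; rewrite /interleave; case: ifP.
Qed.

Lemma block_norm_triangle f g h lam b : lmeasurable_fun h -> in_block p0 p f ->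
  wdecomp g lam b -> ae (fun x => h x = f x + g x) ->
  (block_norm p0 p h <= block_norm p0 p f + \sum_(i <oo) (`|lam i|)%:E)%E.
Proof.
move=> mh hf hg hE; apply/lee_addgt0Pr => e e0.
have [mu [c [hmu hlt]]] := in_block_wdecomp hf e0.
have [h1 h2 h3] := wdecompD hmu hg.
apply: (@le_trans _ _ (\sum_(i <oo) (`|interleave mu lam i|)%:E)%E).
  apply: (@block_norm_le _ (interleave mu lam) (interleave c b)) => //; split => //.
  by apply: ae_sub (ae_and hE h3) => x [->].
apply: (@le_trans _ _ (\sum_(i <oo) (`|mu i|)%:E + \sum_(i <oo) (`|lam i|)%:E)%E).
  rewrite (eq_eseriesr (g := interleave (fun i => (`|mu i|)%:E) (fun i => (`|lam i|)%:E))).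
    by apply: interleave_nneseries => k; rewrite lee_fin.
  by move=> i _; rewrite /interleave; case: ifP.
by rewrite addeAC; apply: leeD => //; exact: ltW.
Qed.

End Blocks.

(** * Convergence of the block norms *)

Section NormConvergence.
Context {R : realType} {n : nat}.
Local Notation pt := ('I_n.+1 -> R).
Local Notation bpt := (@bpt R n.+1).
Local Notation bmeas := (@measurable_fun _ _ bpt R setT).
Context (p0 : R) (p : 'I_n.+1 -> R).
Context (p0_gt1 : 1 < p0) (p_gt1 : forall i, 1 < p i).
Context (p0p : n.+1%:R / p0 < \sum_i (p i)^-1).

Let q i := conj_exp (p i).
Let q_gt1 i : 1 < q i. Proof. exact: conj_exp_gt1. Qed.
Let q_gt0 i : 0 < q i. Proof. exact: lt_trans (q_gt1 i). Qed.

Definition ratio (g f : bpt -> R) : bpt -> R :=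
  fun x => g x * f x `^ (-1) + \1_[set x | f x = 0] x.

Lemma bmeas_ratio g f : bmeas g -> bmeas f -> bmeas (ratio g f).
Proof.
move=> mg mf; apply: measurable_funD.
  apply: measurable_funM => //.
  exact: (measurableT_comp (measurable_powR (-1)) mf).
apply: measurable_indic; have := mf measurableT _ (measurable_set1 (0 : R)).
by rewrite setTI.
Qed.

Lemma ratioE g f x : 0 < f x -> ratio g f x = g x / f x.
Proof.
move=> fx; rewrite /ratio powRN powRr1 ?(ltW fx)// indicE memNset ?addr0//.
by move=> /= f0; rewrite f0 ltxx in fx.
Qed.

Lemma ratio0 g f x : f x = 0 -> ratio g f x = 1.
Proof.
by move=> fx; rewrite /ratio fx powR0 ?oppr_eq0// mulr0 add0r indicE mem_set.
Qed.

Lemma ratio_itv g f x : 0 <= g x -> g x <= f x -> 0 <= ratio g f x <= 1.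
Proof.
move=> g0 gf; have := le_trans g0 gf; rewrite le_eqVlt => /predU1P[f0|f0].
  by rewrite ratio0// ler01 lexx.
by rewrite ratioE// divr_ge0 ?(ltW f0)//= ler_pdivrMr// mul1r.
Qed.

Lemma ratioK g f x : 0 <= g x -> g x <= f x -> ratio g f x * f x = g x.
Proof.
move=> g0 gf; have := le_trans g0 gf; rewrite le_eqVlt => /predU1P[f0|f0].
  by rewrite -f0 mulr0; apply/le_anti; rewrite g0 f0 gf.
by rewrite ratioE// divfK// gt_eqF.
Qed.

Lemma ratio_cvg (g : nat -> bpt -> R) (f : bpt -> R) x : 0 <= f x -> (fun k => g k x) @ \oo --> f x ->
  (fun k => ratio (g k) f x) @ \oo --> (1 : R).
Proof.
rewrite le_eqVlt => /predU1P[f0|f0] cg.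
  rewrite (_ : (fun k => _) = fun=> 1); first exact: cvg_cst.
  by apply/funext => k; rewrite ratio0.
rewrite (_ : (fun k => _) = fun k => g k x / f x).
  rewrite -[X in _ --> X](@divff _ (f x)) ?gt_eqF//.
  by apply: cvgM => //; exact: cvg_cst.
by apply/funext => k; rewrite ratioE.
Qed.

Lemma wblockM (b h : bpt -> R) : bmeas h -> (forall x, 0 <= h x <= 1) ->
  wblock p0 p b -> wblock p0 p (fun x => b x * h x).
Proof.
move=> mh h01 [mb hb].
have mbh : bmeas (fun x => b x * h x) by exact: measurable_funM.
split => //; apply: is_block_le hb _ => //; first exact: bmeas_lmeas.
move=> x; have /andP[h0 h1] := h01 x.
by rewrite normrM (ger0_norm h0) ler_piMr.
Qed.

Lemma wblock_scaled (b : bpt -> R) (c : pt) (l s : R) : 0 < l -> 0 < s -> bmeas b ->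
  (forall x, b x != 0 -> cube c l x) ->
  (nrm p (fun x => (`|b x|)%:E) <= (s * cubew p0 p l)%:E)%E ->
  wblock p0 p (fun x => s^-1 * b x).
Proof.
move=> l0 s0 mb bs bn.
have msb : bmeas (fun x => s^-1 * b x) by apply: measurable_funM => //; exact: measurable_cst.
split => //; split; first exact: bmeas_lmeas.
exists c, l; split => //; split.
  by move=> x; rewrite mulf_eq0 negb_or => /andP[_ /bs].
rewrite [leLHS](_ : _ = nrm p (fun x => (s^-1)%:E * (`|b x|)%:E)%E); last first.
  rewrite mixed_normE; congr nrm; apply/funext => x.
  by rewrite normrM EFinM gtr0_norm// invr_gt0.
rewrite nrmZ ?invr_ge0 ?(ltW s0)//; last exact: emeas_abs.
apply: (@le_trans _ _ ((s^-1)%:E * (s * cubew p0 p l)%:E)%E).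
  by apply: lee_wpmul2l => //; rewrite lee_fin invr_ge0 ltW.
by rewrite -EFinM mulrA mulVf ?gt_eqF// mul1r.
Qed.

(** For use with [e] small and [N] large, when both terms on the right are small. *)
Lemma nneseries_scale_head (a : nat -> R) (N : nat) (e : R) : 0 <= e ->
  (\sum_(i <oo) (`|if (i < N)%N then e * a i else a i|)%:E <=
   e%:E * \sum_(i <oo) (`|a i|)%:E + \sum_(N <= i <oo) (`|a i|)%:E)%E.
Proof.
move=> e0; rewrite -nneseriesZl; last by move=> *; rewrite lee_fin.
rewrite (@nneseries_split _ _ 0 N); last by move=> *; rewrite lee_fin.
rewrite add0n; apply: leeD.
  apply: (@le_trans _ _ (\sum_(k < N) (e%:E * (`|a k|)%:E))%E).
    rewrite big_mkord; apply: lee_sum => k _.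
    by rewrite ltn_ord normrM EFinM ger0_norm.
  by apply: (@psum_le_nneseries _ (fun k => e%:E * (`|a k|)%:E)%E) => k; rewrite mule_ge0.
rewrite -(@nneseries_addn _ (fun i => (`|if (i < N)%N then e * a i else a i|)%:E))//.
rewrite -(@nneseries_addn _ (fun i => (`|a i|)%:E))//.
apply: lee_nneseries => k *; first by rewrite lee_fin.
by rewrite ltnNge leq_addl.
Qed.

Lemma block_norm_cvg (F : nat -> pt -> R) (f : pt -> R) : in_block p0 p f ->
  (forall k, in_block p0 p (F k)) -> (forall k x, 0 <= F k x) ->
  ae (fun x => nondecreasing_seq (fun k => F k x) /\ (fun k : nat => F k x) @ \oo --> f x) ->
  (fun k : nat => block_norm p0 p (F k)) @ \oo --> block_norm p0 p f.
Proof.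
move=> hf hF F0 [N0 [hN0 HN0]].
have [lam0 [b0 [hd0 _]]] := in_block_wdecomp p_gt1 hf ltr01.
have [B [mB hB NB mBF]] := @off_choose _ _ (fun k => if k is k'.+1 then F k' else f) N0
   (fun k => match k with k'.+1 => (hF k').1 | 0%N => hf.1 end) hN0.
have mF k : bmeas (off B (F k)) by exact: (mBF k.+1).
have mf : bmeas (off B f) by exact: (mBF 0%N).
pose F' k := off B (F k); pose f' := off B f.
have F'0 k x : 0 <= F' k x by rewrite /F' /off mulr_ge0.
have nF' x : nondecreasing_seq (fun k => F' k x).
  move=> i j ij; have [Bx|Bx] := pselect (B x); first by rewrite /F' !off_in.
  by rewrite /F' !off_out//; apply: (HN0 x _).1 => // /NB.
have cF' x : (fun k => F' k x) @ \oo --> f' x.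
  have [Bx|Bx] := pselect (B x).
    rewrite /f' off_in// (_ : (fun k => _) = fun=> 0); first exact: cvg_cst.
    by apply/funext => k; rewrite /F' off_in.
  rewrite /f' off_out// (_ : (fun k => _) = fun k => F k x).
    by apply: (HN0 x _).2 => // /NB.
  by apply/funext => k; rewrite /F' off_out.
have F'f' k x : F' k x <= f' x.
  have := cF' x => c; rewrite -(cvg_lim _ c)//; apply: nondecreasing_cvgn_le => //.
  by apply/cvg_ex; eexists; exact: c.
have f'0 x : 0 <= f' x by exact: le_trans (F'f' 0%N x).
pose th k := ratio (F' k) f'.
have mth k : bmeas (th k) by exact: bmeas_ratio (mF k) mf.
have th01 k x : 0 <= th k x <= 1 by exact: ratio_itv.
have thK k x : th k x * f' x = F' k x by exact: ratioK.
have cth x : (fun k => th k x) @ \oo --> (1 : R) by exact: ratio_cvg.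
have upper k : (block_norm p0 p (F k) <= block_norm p0 p f)%E.
  apply/lee_addgt0Pr => e e0.
  have [lam [b [[hb hl hc] hlt]]] := in_block_wdecomp p_gt1 hf e0.
  apply: le_trans (ltW hlt).
  apply: (@block_norm_le _ _ p0 p p0_gt1 p_gt1 p0p (F k) lam (fun i x => b i x * th k x)).
    exact: (hF k).1.
  split => //; first by move=> i; exact: wblockM.
  apply: ae_sub (ae_and hc (ae_off (P := fun x => ~ B x) hB (fun x h => h))) => x [cx Bx].
  rewrite (_ : (fun N => _) = fun N => (\sum_(i < N) lam i * b i x) * th k x); last first.
    by apply/funext => N; rewrite mulr_suml; apply: eq_bigr => i _; rewrite mulrA.
  have -> : F k x = f x * th k x.
    by rewrite -[F k x](@off_out _ _ B) // -/(F' k x) -thK mulrC /f' off_out.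
  by apply: cvgM => //; exact: cvg_cst.
have lower e : 0 < e -> exists K, forall k, (K <= k)%N ->
    (block_norm p0 p f <= block_norm p0 p (F k) + e%:E)%E.
  move=> e0.
  have [lam [b [[hb hl hc] _]]] := in_block_wdecomp p_gt1 hf ltr01.
  set L := (\sum_(i <oo) (`|lam i|)%:E)%E in hl.
  have L0 : (0 <= L)%E by apply: nneseries_ge0 => i _ _; rewrite lee_fin.
  have Lf : L \is a fin_num by rewrite ge0_fin_numE.
  (* Half of [e] is for the head, whose cost is at most [eps * L], and half for the tail beyond [N].
     The added 1 keeps the denominator positive. *)
  pose eps := e / 2 / (fine L + 1).
  have fL : 0 <= fine L by exact: fine_ge0.
  have eps0 : 0 < eps by rewrite !divr_gt0// ltr_wpDl.
  have e2 : 0 < e / 2 by rewrite divr_gt0.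
  have [N HN] := nneseries_tail_cv0 hl e2.
  (* For large [k] the norm of [b i * (1 - th k)] is at most [eps] times the allowance of the cube
     of [b i]. Divided by [eps] it is still a block, and the factor [eps] moves to the
     coefficient. *)
  have head i : exists K, forall k, (K <= k)%N ->
      wblock p0 p (fun x => eps^-1 * (b i x * (1 - th k x))).
    have [mbi [_ [c [l [l0 [bs bn]]]]]] := hb i.
    have mG k : bmeas (fun x => b i x * (1 - th k x)).
      by apply: measurable_funM => //; apply: measurable_funB => //; exact: measurable_cst.
    have : cv0 (fun k => nrm p (fun x => (`|b i x * (1 - th k x)|)%:E)).
      apply: (msteps_dominated (g := fun x => (`|b i x|)%:E)) => //.
      - by move=> k; exact: emeas_abs.
      - exact: emeas_abs.
      - move=> k x; rewrite lee_fin normrM ler_piMr//; have /andP[h1 h2] := th01 k x.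
        by rewrite ger0_norm ?subr_ge0// lerBlDr lerDl.
      - move=> x _; apply/cv0P; first by move=> k; rewrite lee_fin.
        rewrite -[X in _ --> X](_ : (`|b i x * (1 - 1)|)%:E = 0%E); last first.
          by rewrite subrr mulr0 normr0.
        apply: cvg_EFin; first exact: nearW.
        apply: cvg_norm; apply: cvgM; first exact: cvg_cst.
        by apply: cvgB; [exact: cvg_cst|exact: cth].
      - exact: le_lt_trans bn (ltry _).
    have s0 : 0 < eps * cubew p0 p l by rewrite mulr_gt0// cubew_gt0.
    case/(_ _ s0) => K HK.
    exists K => k /HK hk; apply: (wblock_scaled (c := c) l0 eps0) => //.
    by move=> x; rewrite mulf_eq0 negb_or => /andP[/bs].
  have [Kf PK] := @choice _ _ _ head.
  exists (\max_(i < N) Kf i) => k Kk.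
  pose mu i := if (i < N)%N then eps * lam i else lam i.
  pose d i x := if (i < N)%N then eps^-1 * (b i x * (1 - th k x)) else b i x * (1 - th k x).
  have hd : wdecomp p0 p (fun x => off B f x - off B (F k) x) mu d.
    split.
    - move=> i; rewrite /d; case: ltnP => iN.
        apply: PK; apply: leq_trans Kk; exact: (leq_bigmax (Ordinal iN)).
      apply: wblockM => //; first by apply: measurable_funB => //; exact: measurable_cst.
      by move=> x; have /andP[h1 h2] := th01 k x; apply/andP; split; lra.
    - apply: le_lt_trans (nneseries_scale_head lam N (ltW eps0)) _.
      rewrite lte_add_pinfty//; first by rewrite lte_mul_pinfty// ?lee_fin ?ltW.
      by apply: le_lt_trans (HN N (leqnn N)) (ltry _).
    - apply: ae_sub (ae_and hc (ae_off (P := fun x => ~ B x) hB (fun x h => h))) => x [cx Bx].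
      rewrite (_ : (fun N => _) = fun N => (\sum_(i < N) lam i * b i x) * (1 - th k x)).
        have -> : off B f x - off B (F k) x = f x * (1 - th k x).
          by rewrite -/(F' k x) -thK /f' off_out// mulrBr mulr1 mulrC.
        by apply: cvgM => //; exact: cvg_cst.
      apply/funext => M; rewrite mulr_suml; apply: eq_bigr => i _; rewrite /mu /d.
      case: ifP => _; last by rewrite mulrA.
      by rewrite mulrACA mulfV ?gt_eqF// mul1r mulrA.
  apply: le_trans (block_norm_triangle p0_gt1 p_gt1 p0p hf.1 (hF k) hd _) _.
    by apply: (ae_off hB) => x Bx; rewrite !off_out// addrC subrK.
  apply: leeD => //; apply: le_trans (nneseries_scale_head lam N (ltW eps0)) _.
  have hL : eps * fine L <= e / 2.
    rewrite /eps -mulrA ler_piMr ?(ltW e2)// mulrC ler_pdivrMr ?ltr_wpDl//.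
    by rewrite mul1r lerDl.
  have -> : e%:E = ((e / 2)%:E + (e / 2)%:E)%E by rewrite -EFinD -splitr.
  apply: leeD; last exact: HN.
  by rewrite -/L -[X in (_ * X <= _)%E](fineK Lf) -EFinM lee_fin.
have nf : block_norm p0 p f \is a fin_num.
  have [_ hl0 _] := hd0; rewrite ge0_fin_numE ?block_norm_ge0//.
  exact: le_lt_trans (block_norm_le p0_gt1 p_gt1 p0p hf.1 hd0) hl0.
have nF k : block_norm p0 p (F k) \is a fin_num.
  rewrite ge0_fin_numE ?block_norm_ge0//; apply: le_lt_trans (upper k) _.
  by rewrite -ge0_fin_numE ?block_norm_ge0.
rewrite -(fineK nf); apply/fine_cvgP; split; first by apply: nearW => k; exact: nF.
apply/cvgrPdist_le => e e0; have [K HK] := lower e e0.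
exists K => // k /= /HK h; have := upper k.
move: h; rewrite -(fineK nf) -(fineK (nF k)) -EFinD !lee_fin => h1 h2.
by rewrite ger0_norm ?subr_ge0// lerBlDl.
Qed.

End NormConvergence.

(** * Near-minimizers on nested convex sets, and greedy truncation *)

Section NearMinimizers.
Context {R : realType} {X : Type}.

(** The infima [d k] of [phi] on [C k] increase to some [D <= M]. Choosing [a j] close to the
    infimum on a set far enough along, two successive values of [phi] are at most [D + eps j / 2],
    while their midpoint has value at least [D - eps j / 2]. *)
Lemma near_minimizers (C : nat -> set X) (phi : X -> R) (mid : X -> X -> X)
    (dif : X -> X -> R) (M : R) (eps : nat -> R) :
  (forall k, C k.+1 `<=` C k) -> (forall k, C k !=set0) ->
  (forall k x y, C k x -> C k y -> C k (mid x y)) ->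
  (forall x, C 0%N x -> 0 <= phi x <= M) ->
  (forall x y, C 0%N x -> C 0%N y -> dif x y <= (phi x + phi y) / 2 - phi (mid x y)) ->
  (forall j, 0 < eps j) -> (forall j, eps j.+1 <= eps j) ->
  exists a : nat -> X, (forall j, C j (a j)) /\ forall j, dif (a j) (a j.+1) <= eps j.
Proof.
move=> CS C0 Cmid phiM phidif eps0 epsS.
have Cle i j : (i <= j)%N -> C j `<=` C i.
  move=> ij; rewrite -(subnKC ij); elim: (j - i)%N => [|m IH]; first by rewrite addn0.
  by rewrite addnS; apply: subset_trans (CS _) IH.
have CC0 j : C j `<=` C 0%N by exact: Cle.
pose E k := phi @` C k; pose d k := inf (E k).
have Einf k : has_inf (E k).
  split; first by have [x Cx] := C0 k; exists (phi x); exists x.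
  by exists 0 => _ [x Cx <-]; have /andP[] := phiM x (CC0 k _ Cx).
have d_le k x : C k x -> d k <= phi x.
  by move=> Cx; apply: ge_inf; [exact: (Einf k).2|exists x].
have d_nd i j : (i <= j)%N -> d i <= d j.
  move=> ij; apply: lb_le_inf; first exact: (Einf j).1.
  by move=> _ [x Cx <-]; apply: d_le; exact: Cle Cx.
have dsup : has_sup (range d).
  split; first by exists (d 0%N); exists 0%N.
  exists M => _ [k _ <-]; have [x Cx] := C0 k.
  by apply: le_trans (d_le k x Cx) _; have /andP[] := phiM x (CC0 k _ Cx).
set D := sup (range d).
have d_D k : d k <= D by apply: ub_le_sup; [exact: dsup.2|exists k].
have e0 j : 0 < eps j / 2 by rewrite divr_gt0.
have step j : exists mx : nat * X, [/\ (j <= mx.1)%N, D - d mx.1 <= eps j / 2,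
    C mx.1 mx.2 & phi mx.2 <= d mx.1 + eps j / 2].
  have [_ [m _ <-] hm] := sup_adherent (e0 j) dsup.
  have [_ [x Cx <-] hx] := inf_adherent (e0 j) (Einf (maxn j m)).
  exists (maxn j m, x); split => //=; first exact: leq_maxl; last exact: ltW.
  have := d_nd _ _ (leq_maxr j m); rewrite -/D in hm *; lra.
have [a Pa] := @choice _ _ _ step.
exists (fun j => (a j).2); split => j.
  by have [h1 _ h2 _] := Pa j; exact: Cle h2.
have [j1 j2 j3 j4] := Pa j; have [k1 k2 k3 k4] := Pa j.+1.
apply: le_trans (phidif _ _ (CC0 _ _ j3) (CC0 _ _ k3)) _.
(* The midpoint lies in the larger of the two sets, the one of smaller index. Either index may be
   the smaller, and [eps] decreases, so [eps j] serves both cases. *)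
have hm : D - eps j / 2 <= phi (mid (a j).2 (a j.+1).2).
  have := epsS j; case: (leqP (a j).1 (a j.+1).1) => h e.
    have := d_le _ _ (Cmid _ _ _ j3 (Cle _ _ h _ k3)); lra.
  have := d_le _ _ (Cmid _ _ _ (Cle _ _ (ltnW h) _ j3) k3); lra.
have := epsS j; have := d_D (a j).1; have := d_D (a j.+1).1; lra.
Qed.

Lemma cvg_of_geometric (u : nat -> R) (K : R) :
  (forall j, `|u j.+1 - u j| <= K / 2 ^+ j) -> cvgn u.
Proof.
move=> uK; have K0 : 0 <= K by have := uK 0%N; rewrite expr0 divr1; exact: le_trans.
suff : cvgn (series (telescope u)).
  rewrite telescopeK => cu.
  have cu' : cvgn (fun k => (u k - u 0%N) + u 0%N).
    by apply: is_cvgD => //; exact: is_cvg_cst.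
  by move: cu'; under eq_fun do rewrite subrK.
apply: normed_cvg.
apply: (@series_le_cvg _ _ (geometric K 2^-1)) => //.
- by move=> k; rewrite /=.
- by move=> k; rewrite /= mulr_ge0// exprn_ge0.
- by move=> k; rewrite /= /telescope/= exprVn; exact: uK.
- by apply: is_cvg_geometric_series; rewrite ger0_norm// invf_lt1// ltr1n.
Qed.

(* Truncating nonnegative terms greedily so that they add up to [y]. *)
Definition greedy (a : nat -> R) (y : R) (i : nat) : R :=
  Num.min (a i) (Num.max 0 (y - \sum_(j < i) a j)).

Lemma greedy_sum (a : nat -> R) y N : (forall i, 0 <= a i) -> 0 <= y ->
  \sum_(i < N) greedy a y i = Num.min y (\sum_(i < N) a i).
Proof.
move=> a0 y0; elim: N => [|N IH].
  by rewrite !big_ord0; apply/esym/min_idPr.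
rewrite !big_ord_recr/= IH /greedy; set A := \sum_(i < N) _.
have := a0 N; move: (a N) => b b0.
case: (leP y A) => yA.
  have -> : Num.max 0 (y - A) = 0 by apply/max_idPl; rewrite subr_le0.
  have -> : Num.min b 0 = 0 by apply/min_idPr.
  by rewrite addr0; apply/esym/min_idPl; rewrite ler_wpDr.
have -> : Num.max 0 (y - A) = y - A by apply/max_idPr; rewrite subr_ge0 ltW.
case: (leP b (y - A)) => h.
  by apply/esym/min_idPr; rewrite -lerBrDl.
by rewrite addrC subrK; apply/esym/min_idPl; rewrite -lerBlDl ltW.
Qed.

Lemma greedy_ge0 (a : nat -> R) y i : (forall i, 0 <= a i) -> 0 <= greedy a y i.
Proof. by move=> a0; rewrite /greedy le_min a0 le_max lexx. Qed.

Lemma greedy_le (a : nat -> R) y i : greedy a y i <= a i.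
Proof. by rewrite /greedy ge_min lexx. Qed.

Lemma greedy_nneseries (a : nat -> R) y : (forall i, 0 <= a i) -> 0 <= y ->
  (y%:E <= \sum_(i <oo) (a i)%:E)%E -> (\sum_(i <oo) (greedy a y i)%:E = y%:E)%E.
Proof.
move=> a0 y0 ya; apply/eqP; rewrite eq_le; apply/andP; split.
  apply: nneseries_le => [k|N]; first by rewrite lee_fin greedy_ge0.
  by rewrite sumEFin greedy_sum// lee_fin ge_min lexx.
apply/lee_addgt0Pr => e e0.
have /ereal_sup_gt[_ [N _ <-]] : ((y - e)%:E < ereal_sup (range (fun N => \sum_(i < N) (a i)%:E)))%E.
  rewrite -(@nneseries_sup R (fun i => (a i)%:E)); last by move=> k; rewrite lee_fin.
  by apply: lt_le_trans ya; rewrite lte_fin ltrBlDr ltrDl.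
rewrite sumEFin lte_fin => hN.
rewrite -leeBlDr// -EFinB.
apply: le_trans (psum_le_nneseries (u := fun i => (greedy a y i)%:E) N _); last first.
  by move=> k; rewrite lee_fin greedy_ge0.
by rewrite sumEFin greedy_sum// lee_fin le_min (ltW hN) gerBl ltW.
Qed.

Lemma nneseries_single (v : \bar R) (i : nat) : (0 <= v)%E ->
  (\sum_(k <oo) (if i == k then v else 0) = v)%E.
Proof.
move=> v0; rewrite (@nneseriesD1 _ _ i)//; last by move=> k _; case: eqP.
rewrite eqxx eseries0 ?adde0// => k _ /=; rewrite eq_sym => /negbTE -> //.
Qed.

End NearMinimizers.

(** * A countable family of cubes, finite at bounded scale and place *)

Section Grid.
Context {R : realType} {n : nat}.
Local Notation pt := ('I_n.+1 -> R).

Let pow2 (j : int) : R := 2 `^ j%:~R.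

Let pow2_gt0 j : 0 < pow2 j. Proof. exact: powR_gt0. Qed.

Let pow2E (j : int) : j%:~R * ln 2 = ln (pow2 j).
Proof. by rewrite /pow2 ln_powR. Qed.

Let ln2_gt0 : 0 < ln (2 : R). Proof. by apply: ln_gt0; rewrite ltr1n. Qed.

Let scale (l : R) : 0 < l -> exists j, pow2 j <= l < 2 * pow2 j.
Proof.
move=> l0; pose t := ln l / ln 2; pose j := Num.floor t.
have lE : l = 2 `^ t.
  by rewrite /powR gt_eqF ?ltr0n// /t divfK ?gt_eqF// lnK.
have /andP[j1 j2] := floor_itv t.
exists j; rewrite lE /pow2; apply/andP; split.
  by apply: ler_powR => //; rewrite ler1n.
rewrite -[X in X * _](@powRr1 R 2)// -powRD; last by rewrite pnatr_eq0 implybT.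
rewrite /powR gt_eqF ?ltr0n// ltr_expR ltr_pM2r// addrC.
by move: j2; rewrite intrD.
Qed.

Let idxT := (int * {ffun 'I_n.+1 -> int})%type.
Let corner (z : idxT) : pt := fun i => (z.2 i)%:~R * pow2 z.1.
Let side (z : idxT) : R := 3 * pow2 z.1.

(** Corners in the lattice of mesh [2^j], sides [3 * 2^j]. If [2^j <= l' < 2 * 2^j], rounding the
    corner down moves it by less than [2^j], so the given cube ends before [3 * 2^j]; this side is
    at most [3 * l']. *)
Lemma grid_exists : exists (c : nat -> pt) (l : nat -> R),
  [/\ forall k, 0 < l k,
      forall c' l', 0 < l' -> exists k, cube c' l' `<=` cube (c k) (l k) /\ l k <= 3 * l' &
      forall (m : nat) (d : R), 0 < d -> exists M, forall k, (M <= k)%N ->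
        [\/ l k < d, d^-1 < l k | cube (c k) (l k) `&` kbox m = set0]].
Proof.
(* Numbers that encode no grid cube get a dummy cube whose side [k.+1] tends to infinity, so they
   end up in the alternative [d^-1 < l k]. *)
exists (fun k => if @pickle_inv idxT k is Some z then corner z else fun=> 0).
exists (fun k => if @pickle_inv idxT k is Some z then side z else k.+1%:R); split.
- by move=> k; case: pickle_inv => [z|] //; rewrite /side mulr_gt0.
- move=> c' l' l0; have [j /andP[j1 j2]] := scale l0.
  pose z : idxT := (j, [ffun i => Num.floor (c' i / pow2 j)]).
  exists (pickle z); rewrite pickleK_inv; split; last by rewrite /side ler_pM2l.
  move=> x xc i; have := xc i; rewrite /corner /side /= ffunE.
  have /andP[f1 f2] := floor_itv (c' i / pow2 j).
  move: f1; rewrite ler_pdivlMr// => f1.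
  move: f2; rewrite intrD ltr_pdivrMr// mulrDl mul1r => f2.
  move=> /andP[x1 x2]; apply/andP; split; lra.
- move=> m d d0.
  (* For sides between [d] and [d^-1], the scale [j] lies between [- J'] and [J]. If the cube also
     meets [kbox m], its corner is at most [m + d^-1] in absolute value, so the lattice coordinates
     are at most [H]. All these integers lie within [B] of zero and are encoded by the finite type
     [W], whose codes have a maximum. *)
  pose A := d^-1 / 3; pose J := ln A / ln 2; pose J' := - (ln (d / 3) / ln 2).
  pose H := (m%:R + d^-1) * (3 / d).
  pose B := (Num.truncn (`|J| + `|J'| + `|H|)).+1.
  have A0 : 0 < A by rewrite divr_gt0 ?invr_gt0.
  have BJ (r : R) : `|r| <= `|J| + `|J'| + `|H| -> `|r| <= B%:R.
    by move/le_trans; apply; exact/ltW/truncnS_gt.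
  pose W := ('I_(B + B).+1 * {ffun 'I_n.+1 -> 'I_(B + B).+1})%type.
  pose dec (o : 'I_(B + B).+1) : int := o%:Z - B%:Z.
  pose decW (w : W) : idxT := (dec w.1, [ffun i => dec (w.2 i)]).
  exists (maxn (\max_(w : W) (pickle (decW w)).+1) (Num.truncn d^-1).+1) => k.
  rewrite geq_max => /andP[k1 k2].
  case zE : (@pickle_inv idxT k) => [z|]; last first.
    apply: Or32; apply: lt_le_trans (truncnS_gt _) _.
    by rewrite ler_nat ltnW.
  case: (ltP (side z) d) => [?|sd]; first exact: Or31.
  case: (ltP d^-1 (side z)) => [?|sD]; first exact: Or32.
  apply: Or33; apply/seteqP; split => // x [xc xK].
  have decP (t : int) : (`|t%:~R| <= B%:R :> R) -> exists o, dec o = t.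
    rewrite -intr_norm -[B%:R]/(B%:Z%:~R) ler_int => tB.
    have h : (`|(t + B%:Z)%R|%N < (B + B).+1)%N by lia.
    by exists (Ordinal h); rewrite /dec /=; lia.
  have [w1 hw1] : exists o, dec o = z.1.
    apply: decP.
    have l1 : z.1%:~R <= J.
      rewrite /J ler_pdivlMr// pow2E ler_ln ?posrE// /A ler_pdivlMr// mulrC.
      by move: sD; rewrite /side.
    have l2 : - J' <= z.1%:~R.
      rewrite /J' opprK ler_pdivrMr// pow2E ler_ln ?posrE// ?divr_gt0//.
      by rewrite ler_pdivrMr// mulrC.
    rewrite ler_norml; have := ler_norm J; have := ler_norm (- J'); rewrite normrN.
    have := BJ (`|J| + `|J'|); rewrite ger0_norm ?addr_ge0// lerDl normr_ge0 => /(_ isT).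
    have := ler_norm J'; have := ler_norm (- J); rewrite normrN.
    have := normr_ge0 J; have := normr_ge0 J'.
    move: (z.1%:~R : R) l1 l2 => u *; apply/andP; split; lra.
  have [w2 hw2] : exists w2 : {ffun 'I_n.+1 -> 'I_(B + B).+1}, forall i, dec (w2 i) = z.2 i.
    have hi i : exists o, dec o = z.2 i.
      apply: decP.
      have ci : `|(z.2 i)%:~R * pow2 z.1| <= m%:R + d^-1.
        have /andP[x1 x2] := xc i; have /andP[x3 x4] := xK i.
        move: x1 x2; rewrite -/(corner z i) => x1 x2; rewrite -/(corner z i).
        have d1 : 0 < d^-1 by rewrite invr_gt0.
        rewrite ler_norml; apply/andP; split; lra.
      have pz : d / 3 <= pow2 z.1 by rewrite ler_pdivrMr// mulrC.
      have d3 : 0 < d / 3 by rewrite divr_gt0.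
      have h : `|(z.2 i)%:~R| <= H :> R.
        rewrite /H -ler_pdivrMr ?divr_gt0// invf_div.
        move: ci; rewrite normrM (gtr0_norm (pow2_gt0 _)); apply: le_trans.
        by rewrite ler_wpM2l.
      apply: le_trans h _; apply: le_trans (ler_norm _) _; apply: BJ.
      by rewrite lerDr addr_ge0.
    have [w Pw] := @choice _ _ _ hi.
    by exists [ffun i => w i] => i; rewrite ffunE.
  have zw : z = decW (w1, w2).
    rewrite /decW /= hw1; case: z {zE sd sD xc hw1} hw2 => z1 z2 /= hw2; congr (_, _).
    by apply/ffunP => i; rewrite ffunE hw2.
  have kz : pickle z = k by have := @pickle_invK idxT k; rewrite zE.
  have := leq_trans (leq_bigmax (F := fun w => (pickle (decW w)).+1) (w1, w2)) k1.
  by rewrite -zw kz ltnn.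
Qed.

End Grid.

Lemma measurable_fineT d (T : measurableType d) (R : realType) (G : T -> \bar R) :
  measurable_fun setT G -> measurable_fun setT (fun x => fine (G x)).
Proof. by move=> mG; apply: (measurableT_comp _ mG). Qed.

(** * A positive weight of integral at most 1 *)

Section Weight.
Context {R : realType} {n : nat}.
Local Notation pt := ('I_n.+1 -> R).
Local Notation bpt := (@bpt R n.+1).
Local Notation emeas := (@measurable_fun _ _ bpt (\bar R) setT).
Local Open Scope ereal_scope.

Lemma kbox_cover (x : bpt) : exists2 m, (0 < m)%N & kbox m x.
Proof.
pose M := (\sum_j `|x j|)%R; exists (Num.truncn M).+1 => // j.
have xM : (`|x j| <= M)%R by rewrite /M (bigD1 j)//= lerDl sumr_ge0.
have := le_lt_trans xM (truncnS_gt M).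
by rewrite ltr_norml => /andP[/ltW -> /ltW ->].
Qed.

Lemma measurable_kbox m : measurable (kbox m : set bpt).
Proof. exact: measurable_box. Qed.

Let V (m : nat) : R := vol (fun _ : 'I_n.+1 => - m%:R)%R (fun=> m%:R)%R.

Let V_ge0 m : (0 <= V m)%R.
Proof. by apply: vol_ge0 => i; rewrite ge0_cp ?oppr_le0. Qed.

(** Makes the m-th term of [weight] integrate to at most [2^-(m+1)]; the added 1 handles
    [V 0 = 0]. *)
Definition wcoef (m : nat) : R := (1 / (2 ^ m.+1)%:R / (1 + V m))%R.

Lemma wcoef_gt0 m : (0 < wcoef m)%R.
Proof. by rewrite /wcoef !divr_gt0// ?ltr0n ?expn_gt0// ltr_wpDr. Qed.

Definition weight (x : bpt) : \bar R := \sum_(m <oo) (wcoef m)%:E * ind (kbox m) x.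

Let term_ge0 m (x : bpt) : 0 <= (wcoef m)%:E * ind (kbox m) x.
Proof. by rewrite mule_ge0 ?ind_ge0// lee_fin ltW// wcoef_gt0. Qed.

Let term_meas m : emeas (fun x => (wcoef m)%:E * ind (kbox m) x).
Proof. by apply: measurable_funeM; apply: emeas_ind; exact: measurable_kbox. Qed.

Lemma weight_ge0 x : 0 <= weight x.
Proof. by apply: nneseries_ge0 => m _ _. Qed.

Lemma emeas_weight : emeas weight.
Proof. by apply: emeas_nneseries. Qed.

Lemma weight_bound x : exists2 e : R, (0 < e)%R & e%:E <= weight x.
Proof.
have [m _ xm] := kbox_cover x; exists (wcoef m); first exact: wcoef_gt0.
rewrite -[leLHS]mule1 -(ind1 xm).
exact: (@term_le_nneseries _ (fun m => (wcoef m)%:E * ind (kbox m) x)).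
Qed.

Lemma integ_weight : integ weight <= 1.
Proof.
rewrite /weight integ_nneseries//.
apply: le_trans (epsilon_trick0 xpredT ler01).
apply: lee_nneseries => m *; first by apply: integ_ge0.
rewrite integZ; last 3 first.
- exact/ltW/wcoef_gt0.
- by apply: emeas_ind; exact: measurable_kbox.
- exact: ind_ge0.
rewrite integ_box; last by move=> i; rewrite ge0_cp ?oppr_le0.
rewrite -EFinM lee_fin /wcoef -/(V m) mulrAC ler_pdivrMr ?ltr_wpDr//.
by apply: ler_wpM2l; rewrite ?divr_ge0// lerDr.
Qed.

End Weight.

(** * Energy, almost everywhere convergence of the families, and their limit *)

Section Compactness.
Context {R : realType} {n : nat}.
Local Notation pt := ('I_n.+1 -> R).
Local Notation bpt := (@bpt R n.+1).
Local Notation emeas := (@measurable_fun _ _ bpt (\bar R) setT).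
Local Notation bmeas := (@measurable_fun _ _ bpt R setT).
Context (p0 : R) (p : 'I_n.+1 -> R).
Context (p0_gt1 : 1 < p0) (p_gt1 : forall i, 1 < p i).
Context (p0p : n.+1%:R / p0 < \sum_i (p i)^-1).
Context (c : nat -> pt) (l : nat -> R) (l_gt0 : forall k, 0 < l k).
Context (grid_fin : forall (m : nat) (d : R), 0 < d -> exists M, forall k, (M <= k)%N ->
        [\/ l k < d, d^-1 < l k | cube (c k) (l k) `&` kbox m = set0]).

Let q i := conj_exp (p i).
Let q_gt1 i : 1 < q i. Proof. exact: conj_exp_gt1. Qed.
Let q_gt0 i : 0 < q i. Proof. exact: lt_trans (q_gt1 i). Qed.
Let q_ge1 i : 1 <= q i. Proof. exact: ltW. Qed.
Local Notation nrm := (nrm p).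
Local Notation cubew := (cubew p0 p).

Lemma loc_const_tail m e : (0 < m)%N -> 0 < e -> exists M, forall k, (M <= k)%N ->
  loc_const p0 p m (l k) <= e \/ cube (c k) (l k) `&` kbox m = set0.
Proof.
move=> m0 e0; pose a := n.+1%:R / p0; pose S := \sum_i (p i)^-1.
have a0 : 0 < a by rewrite divr_gt0// (lt_trans _ p0_gt1).
have g0 : 0 < S - a by rewrite subr_gt0.
pose K : R := (m.*2)%:R `^ S; have K0 : 0 < K by rewrite powR_gt0// ltr0n double_gt0.
(* The sides at which the two bounds equal [e]: [d1] solves [l^a = e] and [D2] solves
   [K * l^(a - S) = e]. *)
pose d1 := e `^ a^-1; pose D2 := (K / e) `^ (S - a)^-1.
have d10 : 0 < d1 by exact: powR_gt0.
have D20 : 0 < D2 by rewrite powR_gt0// divr_gt0.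
have dd : 0 < Num.min d1 D2^-1 by rewrite lt_min d10 invr_gt0.
have [M HM] := grid_fin m dd.
exists M => k /HM [h|h|h]; [left|left|by right].
  apply: le_trans (loc_const_le_small p0_gt1 p0p m0 (l_gt0 k)) _.
  apply: (@le_trans _ _ (d1 `^ a)).
    apply: ge0_ler_powR; rewrite ?nnegrE ?(ltW a0) ?(ltW (l_gt0 k)) ?(ltW d10)//.
    by apply: ltW; apply: lt_le_trans h _; rewrite ge_min lexx.
  by rewrite /d1 -powRrM mulVf ?gt_eqF// powRr1// ltW.
have hD : D2 <= l k.
  apply: ltW; apply: le_lt_trans h; rewrite -[leLHS]invrK lef_pV2 ?posrE ?invr_gt0//.
  by rewrite ge_min lexx orbT.
apply: le_trans (loc_const_le_large p0_gt1 p0p m0 (l_gt0 k)) _; rewrite -/S -/a -/K.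
have -> : a - S = - (S - a) by rewrite opprB.
rewrite powRN ler_pdivrMr ?powR_gt0// -ler_pdivrMl// mulrC.
apply: (@le_trans _ _ (D2 `^ (S - a))).
  by rewrite /D2 -powRrM mulVf ?gt_eqF// powRr1// divr_ge0// ltW.
by apply: ge0_ler_powR; rewrite ?nnegrE ?(ltW g0) ?(ltW (l_gt0 k)) ?(ltW D20).
Qed.

Context (A : R) (F : nat -> bpt -> R) (f : bpt -> R).
Context (mF : forall k, bmeas (F k)) (mf : bmeas f).
Context (F_ge0 : forall k x, 0 <= F k x) (F_nd : forall x, nondecreasing_seq (F^~ x)).
Context (F_cvg : forall x, (fun k => F k x) @ \oo --> f x).

(** The cost of [G] as a block decomposition: each nonzero piece of finite norm is a block on its
    cube times its norm divided by [cubew]. *)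
Definition bsum (G : nat -> bpt -> R) : \bar R :=
  (\sum_(k <oo) ((cubew (l k))^-1%:E * nrm (fun x => (G k x)%:E)))%E.

(* Decompositions of functions between [F k] and [f] into pieces supported by the cubes
   of the grid, with block-space cost at most [A]: a convex set, decreasing in [k]. *)
Definition fam (k : nat) (G : nat -> bpt -> R) : Prop :=
  [/\ forall i, bmeas (G i), forall i x, 0 <= G i x,
      forall i x, G i x != 0 -> cube (c i) (l i) x,
      (bsum G <= A%:E)%E &
      forall x, ((F k x)%:E <= \sum_(i <oo) (G i x)%:E)%E /\
                (\sum_(i <oo) (G i x)%:E <= (f x)%:E)%E].

Context (fam_neq0 : forall k, fam k !=set0).

Let Ff k x : F k x <= f x.
Proof.
have cv := @F_cvg x; rewrite -(cvg_lim _ cv)//; apply: nondecreasing_cvgn_le => //.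
by apply/cvg_ex; eexists; exact: cv.
Qed.

Let f_ge0 x : 0 <= f x. Proof. exact: le_trans (Ff 0%N x). Qed.

(** The factor [1 / (1 + f^2)], written as a power for measurability. It brings the sum of squares,
    at most [f^2] in a family, below 1, so that the energy is at most [weight] ([fam_energy]). *)
Definition damp (x : bpt) : R := (1 + f x ^+ 2) `^ (-1).

Lemma dampE x : damp x = (1 + f x ^+ 2)^-1.
Proof. by rewrite /damp powRN powRr1// addr_ge0// sqr_ge0. Qed.

Lemma damp_gt0 x : 0 < damp x.
Proof. by rewrite dampE invr_gt0 ltr_pwDl// sqr_ge0. Qed.

Lemma bmeas_damp : bmeas damp.
Proof.
apply: (measurableT_comp (measurable_powR (-1))); apply: measurable_funD => //.
exact: measurable_funX.
Qed.

Definition energy (G : nat -> bpt -> R) (x : bpt) : \bar R :=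
  (weight x * \sum_(i <oo) (damp x * G i x ^+ 2)%:E)%E.

Let sq_ge0 (G : nat -> bpt -> R) i x : (0 <= (damp x * G i x ^+ 2)%:E)%E.
Proof. by rewrite lee_fin mulr_ge0 ?sqr_ge0// ltW// damp_gt0. Qed.

Lemma energy_ge0 G x : (0 <= energy G x)%E.
Proof. by rewrite mule_ge0 ?weight_ge0//; apply: nneseries_ge0. Qed.

Lemma emeas_energy G : (forall i, bmeas (G i)) -> emeas (energy G).
Proof.
move=> mG; apply: emeasurable_funM; first exact: emeas_weight.
apply: emeas_nneseries => // i; apply/measurable_EFinP.
by apply: measurable_funM; [exact: bmeas_damp|exact: measurable_funX].
Qed.

Lemma fam_le k G i x : fam k G -> G i x <= f x.
Proof.
move=> [_ G0 _ _ /(_ x)[_ h]]; rewrite -lee_fin; apply: le_trans h.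
by apply: (@term_le_nneseries _ (fun i => (G i x)%:E)) => j; rewrite lee_fin.
Qed.

Lemma fam_energy k G x : fam k G -> (energy G x <= weight x)%E.
Proof.
move=> hG; have [_ G0 _ _ /(_ x)[_ h]] := hG.
rewrite -[leRHS]mule1; apply: lee_wpmul2l; first exact: weight_ge0.
apply: (@le_trans _ _ ((damp x * f x)%:E * \sum_(i <oo) (G i x)%:E)%E).
  rewrite -nneseriesZl; last by move=> *; rewrite lee_fin.
  apply: lee_nneseries => i *; first exact: sq_ge0.
  rewrite -EFinM lee_fin -mulrA ler_wpM2l ?(ltW (damp_gt0 x))//.
  by rewrite expr2 ler_wpM2r// (fam_le i x hG).
apply: (@le_trans _ _ ((damp x * f x)%:E * (f x)%:E)%E).
  by apply: lee_wpmul2l => //; rewrite lee_fin mulr_ge0// ltW// damp_gt0.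
rewrite -EFinM lee_fin -mulrA -expr2 dampE mulrC ler_pdivrMr ?mul1r ?lerDr//.
by rewrite ltr_pwDl// sqr_ge0.
Qed.

Definition midpt (G H : nat -> bpt -> R) := fun i x => 2^-1 * (G i x + H i x).
Definition halfdiff (G H : nat -> bpt -> R) := fun i x => 2^-1 * (G i x - H i x).

Lemma parallelogram G H x :
  (energy (halfdiff G H) x + energy (midpt G H) x = 2^-1%:E * (energy G x + energy H x))%E.
Proof.
rewrite /energy -!ge0_muleDr; try by apply: nneseries_ge0.
rewrite muleCA; congr (_ * _)%E; rewrite -!nneseriesD; try by move=> *; exact: sq_ge0.
rewrite -nneseriesZl; last by move=> *; rewrite adde_ge0.
by apply: eq_eseriesr => i _; rewrite -!EFinD -EFinM /halfdiff /midpt; congr EFin; field.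
Qed.

Definition phi (G : nat -> bpt -> R) : R := fine (integ (energy G)).

Lemma integ_energy_lty k G : fam k G -> (integ (energy G) < +oo)%E.
Proof.
move=> hG; apply: le_lt_trans (ltry 1); apply: le_trans (@integ_weight R n).
by apply: le_integ => x; [exact: energy_ge0|exact: fam_energy hG].
Qed.

Lemma phiE k G : fam k G -> (phi G)%:E = integ (energy G).
Proof.
move=> hG; rewrite /phi fineK// ge0_fin_numE; last by apply: integ_ge0 => x; exact: energy_ge0.
exact: integ_energy_lty hG.
Qed.

Let bmeas_lin k G H (s t : R) : fam k G -> fam k H ->
  forall i, bmeas (fun x => s * (G i x + t * H i x)).
Proof.
move=> [mG _ _ _ _] [mH _ _ _ _] i; apply: measurable_funM; first exact: measurable_cst.
by apply: measurable_funD => //; apply: measurable_funM => //; exact: measurable_cst.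
Qed.

Let bmeas_mid k G H : fam k G -> fam k H -> forall i, bmeas (midpt G H i).
Proof.
move=> hG hH i; rewrite (_ : midpt G H i = fun x => 2^-1 * (G i x + 1 * H i x)).
  exact: bmeas_lin hG hH i.
by apply/funext => x; rewrite mul1r.
Qed.

Let bmeas_diff k G H : fam k G -> fam k H -> forall i, bmeas (halfdiff G H i).
Proof.
move=> hG hH i; rewrite (_ : halfdiff G H i = fun x => 2^-1 * (G i x + (-1) * H i x)).
  exact: bmeas_lin hG hH i.
by apply/funext => x; rewrite mulN1r.
Qed.

Lemma fam_mid k G H : fam k G -> fam k H -> fam k (midpt G H).
Proof.
move=> hG hH; have [mG G0 Gs Gn Gf] := hG; have [mH H0 Hs Hn Hf] := hH; split.
- exact: bmeas_mid hG hH.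
- by move=> i x; rewrite mulr_ge0// addr_ge0.
- move=> i x; rewrite /midpt mulf_eq0 negb_or => /andP[_ h].
  have [G0'|/Gs//] := eqVneq (G i x) 0.
  by apply: Hs; apply: contraNN h => /eqP ->; rewrite G0' addr0.
- apply: (@le_trans _ _ (2^-1%:E * (bsum G + bsum H))%E); last first.
    apply: (@le_trans _ _ (2^-1%:E * (A%:E + A%:E))%E).
      by apply: lee_wpmul2l; [rewrite lee_fin|exact: leeD].
    by rewrite -EFinD -EFinM lee_fin; lra.
  have t0 (K : nat -> bpt -> R) : (forall i x, 0 <= K i x) -> forall i,
      (0 <= (cubew (l i))^-1%:E * nrm (fun x => (K i x)%:E))%E.
    move=> K0 i; apply: mule_ge0; first by rewrite lee_fin invr_ge0 ltW// cubew_gt0.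
    by apply: nrm_ge0 => x; rewrite lee_fin.
  rewrite /bsum -nneseriesD; try by move=> *; exact: t0.
  rewrite -nneseriesZl; last by move=> *; rewrite adde_ge0// t0.
  apply: lee_nneseries => i *; first by apply: t0 => j x; rewrite mulr_ge0// addr_ge0.
  rewrite -muleDr ?ge0_adde_def ?inE ?nrm_ge0//; try by move=> x; rewrite lee_fin.
  rewrite muleCA; apply: lee_wpmul2l; first by rewrite lee_fin invr_ge0 ltW// cubew_gt0.
  rewrite (_ : (fun x => _) = fun x => (2^-1%:E * ((G i x)%:E + (H i x)%:E))%E).
  2: by apply/funext => x; rewrite -EFinD -EFinM.
  rewrite nrmZ//; last 2 first.
  + by apply: emeasurable_funD; apply/measurable_EFinP.
  + by move=> x; rewrite adde_ge0// lee_fin.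
  apply: lee_wpmul2l; first by rewrite lee_fin.
  apply: mstepsD => //; try (by apply/measurable_EFinP); by move=> x; rewrite lee_fin.
- move=> x; have [g1 g2] := Gf x; have [h1 h2] := Hf x.
  have -> : (\sum_(i <oo) (midpt G H i x)%:E = 2^-1%:E * (\sum_(i <oo) (G i x)%:E + \sum_(i <oo) (H i x)%:E))%E.
    rewrite -nneseriesD; try by move=> *; rewrite lee_fin.
    rewrite -nneseriesZl; last by move=> *; rewrite adde_ge0 ?lee_fin.
    by apply: eq_eseriesr => i _; rewrite -EFinD -EFinM.
  have half (y : R) : y%:E = (2^-1%:E * (y%:E + y%:E))%E.
    by rewrite -EFinD -EFinM; congr EFin; field.
  by rewrite (half (F k x)) (half (f x)); split; apply: lee_wpmul2l;
    rewrite ?lee_fin//; apply: leeD.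
Qed.

Lemma integ_halfdiff k G H : fam k G -> fam k H ->
  (integ (energy (halfdiff G H)) = (2^-1 * (phi G + phi H) - phi (midpt G H))%:E)%E.
Proof.
move=> hG hH; have hM := fam_mid hG hH.
have [mG _ _ _ _] := hG; have [mH _ _ _ _] := hH.
have mD := bmeas_diff hG hH; have mM := bmeas_mid hG hH.
have e : (integ (energy (halfdiff G H)) + (phi (midpt G H))%:E =
    (2^-1 * (phi G + phi H))%:E)%E.
  rewrite EFinM EFinD (phiE hM) (phiE hG) (phiE hH) -integD; try exact: emeas_energy;
    try exact: energy_ge0.
  rewrite -integD; try exact: emeas_energy; try exact: energy_ge0.
  rewrite -integZ//; last 2 first.
  - by apply: emeasurable_funD; exact: emeas_energy.
  - by move=> x; rewrite adde_ge0 ?energy_ge0.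
  by congr integ; apply/funext => x; exact: parallelogram.
by rewrite EFinB -e addeK.
Qed.

Lemma fam_nested k : fam k.+1 `<=` fam k.
Proof.
move=> G [h1 h2 h3 h4 h5]; split => // x; have [g1 g2] := h5 x; split => //.
by apply: le_trans g1; rewrite lee_fin; exact: (@F_nd x).
Qed.

(** After multiplication by [4^j] the energies of successive half-differences still have integrals
    with sum at most 1; the square root of [4^j] then yields the geometric rate [2^-j]. *)
Let eps (j : nat) : R := (4 ^+ j)^-1 * (1 / (2 ^ j.+1)%:R).

Lemma cauchy_family : exists a : nat -> nat -> bpt -> R, (forall j, fam j (a j)) /\
  forall j, (integ (energy (halfdiff (a j) (a j.+1))) <= (eps j)%:E)%E.
Proof.
have [|||||||a [ha1 ha2]] := @near_minimizers R _ fam phi midpt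
   (fun G H => fine (integ (energy (halfdiff G H)))) 1 eps.
- exact: fam_nested.
- exact: fam_neq0.
- exact: fam_mid.
- move=> G hG; rewrite -!lee_fin (phiE hG) integ_ge0/=; last exact: energy_ge0.
  apply: le_trans (@integ_weight R n).
  by apply: le_integ => x; [exact: energy_ge0|exact: fam_energy hG].
- by move=> G H hG hH; rewrite (integ_halfdiff hG hH)/= mulrC.
- by move=> j; rewrite /eps mulr_gt0// ?invr_gt0 ?exprn_gt0// divr_gt0// ltr0n expn_gt0.
- move=> j; rewrite /eps; apply: ler_pM.
  + by rewrite invr_ge0 exprn_ge0.
  + by rewrite divr_ge0.
  + by rewrite lef_pV2 ?posrE ?exprn_gt0//; apply: ler_weXn2l; rewrite ?ler1n.
  + by rewrite !div1r lef_pV2 ?posrE ?ltr0n ?expn_gt0// ler_nat leq_exp2l.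
exists a; split => // j.
have hj := ha1 j; have hj1 : fam j (a j.+1) by exact: fam_nested.
by rewrite (integ_halfdiff hj hj1) lee_fin; have := ha2 j; rewrite (integ_halfdiff hj hj1).
Qed.

(** The series [Z] of the energies times [4^j] has finite integral, hence is finite off a null set.
    There each half-difference is bounded by a multiple of [2^-j], with a constant depending on the
    point. *)
Lemma cauchy_family_cvg (a : nat -> nat -> bpt -> R) : (forall j, fam j (a j)) ->
  (forall j, (integ (energy (halfdiff (a j) (a j.+1))) <= (eps j)%:E)%E) ->
  exists B : set bpt, [/\ measurable B, nullset B &
    forall i x, ~ B x -> cvgn (fun j => a j i x)].
Proof.
move=> ha he.
have hS j : fam j (a j.+1) by exact: fam_nested.
pose E j x := ((4 ^+ j)%:E * energy (halfdiff (a j) (a j.+1)) x)%E.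
have E0 j x : (0 <= E j x)%E by rewrite mule_ge0 ?energy_ge0// lee_fin exprn_ge0.
have mE0 j : emeas (energy (halfdiff (a j) (a j.+1))).
  by apply: emeas_energy; exact: bmeas_diff (ha j) (hS j).
have mE j : emeas (E j) by exact: measurable_funeM.
pose Z x := (\sum_(j <oo) E j x)%E.
have mZ : emeas Z by exact: emeas_nneseries.
have Zfin : (integ Z < +oo)%E.
  apply: le_lt_trans (ltry 1); rewrite /Z integ_nneseries//.
  apply: le_trans (epsilon_trick0 xpredT ler01).
  apply: lee_nneseries => j *; first exact: integ_ge0.
  rewrite integZ ?exprn_ge0//; last exact: energy_ge0.
  apply: (@le_trans _ _ ((4 ^+ j)%:E * (eps j)%:E)%E).
    by apply: lee_wpmul2l => //; rewrite lee_fin exprn_ge0.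
  by rewrite -EFinM lee_fin /eps mulVKf// expf_neq0.
exists [set x | Z x = +oo%E]; split.
- by have := mZ measurableT _ (emeasurable_set1 +oo%E); rewrite setTI.
- by apply: nullset_eqy => // x; apply: nneseries_ge0.
move=> i x /= Zx; have [e e0 ew] := weight_bound x.
have Zf : Z x \is a fin_num.
  by rewrite ge0_fin_numE ?ltey; [apply/eqP|apply: nneseries_ge0].
pose z := fine (Z x); have z0 : 0 <= z by apply: fine_ge0; apply: nneseries_ge0.
have bound j : 4 ^+ j * (e * (damp x * halfdiff (a j) (a j.+1) i x ^+ 2)) <= z.
  rewrite -lee_fin /z fineK//.
  apply: le_trans (term_le_nneseries (u := fun j => E j x) j _) => //.
  rewrite EFinM; apply: lee_wpmul2l; first by rewrite lee_fin exprn_ge0.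
  rewrite EFinM; apply: lee_pmul => //; first by rewrite lee_fin ltW.
  by apply: (@term_le_nneseries _ (fun i => (damp x * halfdiff (a j) (a j.+1) i x ^+ 2)%:E)).
(* The 4 undoes the square of the factor [2^-1] in [halfdiff]; [e] is the lower bound of [weight] at
   [x]. *)
pose s := e * damp x / 4; have s0 : 0 < s by rewrite divr_gt0// mulr_gt0// damp_gt0.
apply: (@cvg_of_geometric _ _ (Num.sqrt (z / s))) => j.
have j0 : 0 < 2 ^+ j :> R by rewrite exprn_gt0.
rewrite ler_pdivlMr// -[leLHS]ger0_norm ?mulr_ge0//.
rewrite -sqrtr_sqr ler_wsqrtr// ler_pdivlMr//; apply: le_trans (bound j).
rewrite exprMn real_normK ?num_real// -exprM mulnC exprM -[4]/(2 * 2)%:R natrM -expr2.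
rewrite /halfdiff /s le_eqVlt; apply/orP; left; apply/eqP; by field.
Qed.

Lemma bmeas_off (B : set bpt) (u : bpt -> R) : measurable B -> bmeas u -> bmeas (off B u).
Proof.
by move=> mB mu; apply: measurable_funM => //; apply: measurable_indic; exact: measurableC.
Qed.

Lemma off_itv (B : set bpt) (u : pt -> R) x : 0 <= u x -> 0 <= off B u x <= u x.
Proof.
by move=> ux; rewrite /off indicE; case: (_ \in _); rewrite ?mul1r ?mul0r ux lexx.
Qed.

Lemma cvg_psum (h : nat -> nat -> R) (g : nat -> R) M :
  (forall i, (fun j => h j i) @ \oo --> g i) ->
  (fun j => \sum_(i < M) h j i) @ \oo --> \sum_(i < M) g i.
Proof.
move=> hg; elim: M => [|M IH].
  rewrite big_ord0 (_ : (fun j => _) = fun=> 0); first exact: cvg_cst.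
  by apply/funext => j; rewrite big_ord0.
rewrite big_ord_recr/= (_ : (fun j => _) = fun j => \sum_(i < M) h j i + h j M).
  by apply: cvgD.
by apply/funext => j; rewrite big_ord_recr.
Qed.

Lemma nneseries_addn_le (u : nat -> \bar R) M : (forall k, 0 <= u k)%E ->
  (\sum_(k <oo) u (k + M)%N <= \sum_(k <oo) u k)%E.
Proof.
move=> u0; rewrite nneseries_addn// [leRHS](@nneseries_split _ _ 0 M)//.
by rewrite add0n leeDr// sume_ge0.
Qed.

Let w_ge0 i : (0 <= (cubew (l i))^-1%:E)%E.
Proof. by rewrite lee_fin invr_ge0 ltW// cubew_gt0. Qed.

(** The infima [ei i k] over later indices increase in [k], have supremum at least [g i] and lie
    below [h k i]. For finitely many [i] the limit in [k] commutes with the sum, and the number [M]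
    of terms is arbitrary. *)
Lemma bsum_fatou (h : nat -> nat -> bpt -> R) (g : nat -> bpt -> R) :
  (forall j i, bmeas (h j i)) -> (forall j i x, 0 <= h j i x) -> (forall i x, 0 <= g i x) ->
  (forall i x, (fun j => h j i x) @ \oo --> g i x) ->
  (forall j, bsum (h j) <= A%:E)%E -> (bsum g <= A%:E)%E.
Proof.
move=> mh h0 g0 hg hA.
have ng0 (u : bpt -> \bar R) : (forall x, 0 <= u x)%E -> (0 <= nrm u)%E by exact: nrm_ge0.
apply: nneseries_le => [i|M].
  by apply: mule_ge0 => //; apply: ng0 => x; rewrite lee_fin.
pose ei i k x := einfs (fun j => (h j i x)%:E) k.
have ei0 i k x : (0 <= ei i k x)%E by apply: le_ereal_inf_tmp => _ [j _ <-]; rewrite lee_fin.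
have eih i k x : (ei i k x <= (h k i x)%:E)%E by apply: ereal_inf_lbound; exists k => /=.
have mei i k : emeas (ei i k) by apply: measurable_fun_einfs => j; apply/measurable_EFinP.
pose t i k := nrm (ei i k).
have tnd i : nondecreasing_seq (t i).
  move=> k k' kk; apply: le_nrm => // x; exact: nondecreasing_einfs.
have tc i : t i @ \oo --> ereal_sup (range (t i)) by exact: ereal_nondecreasing_cvgn.
apply: (@le_trans _ _ (\sum_(i < M) ((cubew (l i))^-1%:E * ereal_sup (range (t i)))))%E.
  apply: lee_sum => i _; apply: lee_wpmul2l => //.
  apply: msteps_le_sup => //; last 2 first.
  - by move=> x; rewrite lee_fin.
  - by move=> x; apply: le_sup_einfs; apply: cvg_EFin; [exact: nearW|exact: hg].
  by move=> x k k' kk; exact: nondecreasing_einfs.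
have cs : (fun k => \sum_(i < M) ((cubew (l i))^-1%:E * t i k))%E @ \oo -->
    (\sum_(i < M) ((cubew (l i))^-1%:E * ereal_sup (range (t i))))%E.
  apply: cvg_nnesum => i _; last by apply: cvgeZl => //; exact: tc.
  by apply: nearW => k; apply: mule_ge0 => //; apply: ng0.
rewrite -(cvg_lim _ cs)//; apply: lime_le; first by apply/cvg_ex; eexists; exact: cs.
apply: nearW => k; apply: le_trans (hA k).
apply: le_trans (psum_le_nneseries (u := fun i => ((cubew (l i))^-1%:E * nrm (fun x => (h k i x)%:E))%E) M _).
  by apply: lee_sum => i _; apply: lee_wpmul2l => //; apply: le_nrm.
by move=> i; apply: mule_ge0 => //; apply: ng0 => x; rewrite lee_fin.
Qed.

(* Cubes of very small or very large side contribute little to the L^1 norm on a fixed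
   box, and only finitely many of the others meet it, so no mass is lost in the limit. *)
Lemma tail_integ k G m e M : fam k G -> (0 < m)%N -> 0 < e ->
  (forall i, (M <= i)%N ->
     loc_const p0 p m (l i) <= e \/ cube (c i) (l i) `&` kbox m = set0) ->
  (integ (fun x => \sum_(i <oo) (G (i + M)%N x)%:E * ind (kbox m) x) <= (e * A)%:E)%E.
Proof.
move=> [mG G0 Gs Gn _] m0 e0 HM.
have ng0 i : (0 <= nrm (fun x => (G i x)%:E))%E by apply: nrm_ge0 => x; rewrite lee_fin.
have mK : measurable (kbox m : set bpt) by exact: measurable_kbox.
have mG' i : emeas (fun x => (G i x)%:E) by apply/measurable_EFinP.
rewrite integ_nneseries; last 2 first.
- by move=> i; apply: emeasurable_funM => //; exact: emeas_ind.
- by move=> i x; rewrite mule_ge0 ?ind_ge0// lee_fin.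
rewrite EFinM; apply: (@le_trans _ _ (e%:E * bsum G)%E); last first.
  by apply: lee_wpmul2l => //; rewrite lee_fin ltW.
rewrite /bsum -nneseriesZl; last by move=> *; exact: mule_ge0.
have u0 i : (0 <= e%:E * ((cubew (l i))^-1%:E * nrm (fun x => (G i x)%:E)))%E.
  by rewrite !mule_ge0// lee_fin ltW.
apply: le_trans (nneseries_addn_le M u0).
apply: lee_nneseries => i *.
  by apply: integ_ge0 => x; rewrite mule_ge0 ?ind_ge0// lee_fin.
have [|h|h] := HM (i + M)%N; first exact: leq_addl.
  apply: le_trans (loc_bound p0 p_gt1 m0 (l_gt0 (i + M)%N) (mG' _) _ _) _.
  - by move=> x; rewrite lee_fin.
  - by move=> x Gx; apply: Gs; apply: contraNN Gx => /eqP ->.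
  - by apply: lee_wpmul2r; [exact: mule_ge0|rewrite lee_fin].
rewrite (_ : (fun x => _) = fun=> 0%E); first by rewrite /integ msteps0.
apply/funext => x; have [Kx|Kx] := pselect (kbox m x); last by rewrite ind0// mule0.
have [->|/Gs cx] := eqVneq (G (i + M)%N x) 0; first by rewrite mul0e.
by exfalso; suff : set0 x by []; rewrite -h.
Qed.

(** That the limits sum to at most [f] follows from finite sums; equality is the point. On [kbox m]
    the defect is at most the lower limit of the tails of [a j] beyond a fixed [M], since [F j] lies
    below the full sum and the first [M] pieces converge. [msteps_fatou] and [tail_integ] then make
    its integral arbitrarily small. *)
Lemma limit_family : exists (B : set bpt) (g : nat -> bpt -> R),
  [/\ nullset B, forall i, bmeas (g i),
      (forall i x, 0 <= g i x) /\ (forall i x, g i x != 0 -> cube (c i) (l i) x),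
      (bsum g <= A%:E)%E &
      forall x, ~ B x -> (\sum_(i <oo) (g i x)%:E = (f x)%:E)%E].
Proof.
have [a [ha he]] := cauchy_family.
have [B0 [mB0 hB0 cB0]] := cauchy_family_cvg ha he.
have ma j i : bmeas (a j i) by have [] := ha j.
have a0 j i x : 0 <= a j i x by have [] := ha j.
pose h j i := off B0 (a j i); pose g i x := limn (fun j => h j i x).
have h01 j i x : 0 <= h j i x <= a j i x by exact: off_itv.
have h0 j i x : 0 <= h j i x by have /andP[] := h01 j i x.
have mh j i : bmeas (h j i) by exact: bmeas_off.
have hc i x : (fun j => h j i x) @ \oo --> g i x.
  apply/cvg_ex; have [Bx|Bx] := pselect (B0 x).
    exists 0; rewrite (_ : (fun j => _) = fun=> 0); first exact: cvg_cst.
    by apply/funext => j; rewrite /h off_in.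
  rewrite (_ : (fun j => _) = fun j => a j i x); first by apply/cvg_ex; exact: cB0.
  by apply/funext => j; rewrite /h off_out.
have g0 i x : 0 <= g i x.
  by apply: limr_ge; [apply/cvg_ex; eexists; exact: (hc i x)|apply: nearW].
have mg i : bmeas (g i) by apply: (measurable_fun_cvg (mh^~ i)) => x _; exact: hc.
have gs i x : g i x != 0 -> cube (c i) (l i) x.
  apply: contraNP => nx; apply/eqP; have cv := hc i x; rewrite -(cvg_lim _ cv)//.
  rewrite (_ : (fun j => _) = fun=> 0) ?lim_cst//; apply/funext => j.
  apply/eqP/negPn/negP => hx; apply: nx; have [_ _ as_ _ _] := ha j; apply: as_.
  by apply: contraNN hx => /eqP e; have := h01 j i x; rewrite e => /le_anti <-.
have hA j : (bsum (h j) <= A%:E)%E.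
  have [_ _ _ aA _] := ha j; apply: le_trans aA; apply: lee_nneseries => i *.
    by apply: mule_ge0 => //; apply: nrm_ge0 => x; rewrite lee_fin.
  apply: lee_wpmul2l => //; apply: le_nrm => // x; rewrite lee_fin//.
  by have /andP[] := h01 j i x.
have gA : (bsum g <= A%:E)%E by exact: (bsum_fatou mh h0 g0 hc hA).
have gf x : (\sum_(i <oo) (g i x)%:E <= (f x)%:E)%E.
  apply: nneseries_le => [i|M]; first by rewrite lee_fin.
  have cv := @cvg_psum (fun j i => h j i x) (g^~ x) M (fun i => hc i x).
  rewrite sumEFin lee_fin -(cvg_lim _ cv)//; apply: limr_le.
    by apply/cvg_ex; eexists; exact: cv.
  apply: nearW => j; have [_ _ _ _ /(_ x)[_ af]] := ha j; rewrite -lee_fin.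
  apply: le_trans af; apply: le_trans (psum_le_nneseries (u := fun i => (a j i x)%:E) M _).
    by rewrite -sumEFin; apply: lee_sum => i _; rewrite lee_fin; have /andP[] := h01 j i x.
  by move=> i; rewrite lee_fin.
have gfin x : (\sum_(i <oo) (g i x)%:E)%E \is a fin_num.
  rewrite ge0_fin_numE; first exact: le_lt_trans (gf x) (ltry _).
  by apply: nneseries_ge0 => i _ _; rewrite lee_fin.
pose sg x := fine (\sum_(i <oo) (g i x)%:E)%E.
have msg : bmeas sg.
  apply: measurable_fineT.
  by apply: emeas_nneseries => [i|i x]; [apply/measurable_EFinP|rewrite lee_fin].
have sgf x : sg x <= f x by rewrite -lee_fin /sg fineK.
pose d x := off B0 (fun x => f x - sg x) x.
have d0 x : 0 <= d x.
  have h1 : 0 <= f x - sg x by rewrite subr_ge0.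
  by have /andP[] := @off_itv B0 (fun x => f x - sg x) x h1.
have md : bmeas d by apply: bmeas_off => //; exact: measurable_funB.
pose dm m x := ((d x)%:E * ind (kbox m) x)%E.
have mdm m : emeas (dm m).
  by apply: emeasurable_funM; [apply/measurable_EFinP|apply: emeas_ind; exact: measurable_kbox].
have dm0 m x : (0 <= dm m x)%E by rewrite mule_ge0 ?ind_ge0// lee_fin.
have key m : (0 < m)%N -> integ (dm m) = 0%E.
  move=> m0; apply/eqP; rewrite eq_le integ_ge0// andbT; apply/lee_addgt0Pr => e e0.
  rewrite add0e; have e1 : 0 < e / (`|A| + 1) by rewrite divr_gt0// ltr_wpDl.
  have [M HM] := loc_const_tail m0 e1.
  apply: (@le_trans _ _ (e / (`|A| + 1) * A)%:E); last first.
    rewrite lee_fin mulrAC ler_pdivrMr ?ltr_wpDl// ler_wpM2l ?(ltW e0)//.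
    by apply: le_trans (ler_norm A) _; rewrite lerDl.
  pose rest j x := (\sum_(i <oo) (a j (i + M)%N x)%:E * ind (kbox m) x)%E.
  have t0 j i x : (0 <= (a j (i + M)%N x)%:E * ind (kbox m) x)%E.
    by rewrite mule_ge0 ?ind_ge0// lee_fin.
  have r0 j x : (0 <= rest j x)%E by apply: nneseries_ge0.
  apply: (msteps_fatou (G := rest)) => //.
  - move=> j; apply: emeas_nneseries => // i; apply: emeasurable_funM.
      by apply/measurable_EFinP.
    by apply: emeas_ind; exact: measurable_kbox.
  - move=> x; have S0 : (0 <= ereal_sup (range (einfs (rest^~ x))))%E.
      apply: (@le_trans _ _ (einfs (rest^~ x) 0%N)).
        by apply: le_ereal_inf_tmp => _ [j _ <-].
      by apply: ereal_sup_ubound; exists 0%N.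
    have [Bx|Bx] := pselect (B0 x); first by rewrite /dm /d off_in// mul0e.
    have [Kx|Kx] := pselect (kbox m x); last by rewrite /dm ind0// mule0.
    rewrite /dm ind1// mule1 /d off_out//.
    (* What the first [M] pieces leave of [F j x]: at most the tail [rest j x], and its limit is at
       least the defect. *)
    pose v j := F j x - \sum_(i < M) h j i x.
    have cv : v @ \oo --> f x - \sum_(i < M) g i x.
      apply: cvgB; first exact: (@F_cvg x).
      exact: (@cvg_psum (fun j i => h j i x) (g^~ x) M (fun i => hc i x)).
    apply: (@le_trans _ _ (f x - \sum_(i < M) g i x)%:E).
      rewrite lee_fin lerD2l lerN2 -lee_fin /sg fineK// -sumEFin.
      by apply: (@psum_le_nneseries _ (fun i => (g i x)%:E)) => i; rewrite lee_fin.
    apply: (@le_trans _ _ (ereal_sup (range (einfs (EFin \o v))))).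
      by apply: le_sup_einfs; apply: cvg_EFin; [exact: nearW|exact: cv].
    apply: ge_ereal_sup => _ [k _ <-].
    apply: (@le_trans _ _ (einfs (rest^~ x) k)); last by apply: ereal_sup_ubound; exists k.
    apply: le_ereal_inf_tmp => _ [j kj <-].
    apply: (@le_trans _ _ (v j)%:E); first by apply: ereal_inf_lbound; exists j.
    have [_ _ _ _ /(_ x)[Fa _]] := ha j.
    rewrite /rest; under eq_eseriesr do rewrite ind1// mule1.
    rewrite /v EFinB leeBlDl// (nneseries_addn (f := fun i => (a j i x)%:E)); last by move=> i; rewrite lee_fin.
    apply: (le_trans Fa); rewrite (@nneseries_split _ _ 0 M); last by move=> *; rewrite lee_fin.
    rewrite add0n big_mkord sumEFin; apply: leeD => //.
    by rewrite lee_fin; apply: ler_sum => i _; rewrite /h off_out.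
  - by move=> j; exact: tail_integ (ha j) m0 e1 HM.
(* [key] speaks of positive radii, hence the shift to [m.+1]; [kbox_cover] gives each point a
   positive radius. *)
exists (B0 `|` \bigcup_m [set x | dm m.+1 x != 0%E]), g; split => //.
  apply: nullsetU => //; apply: nullset_bigcup => m; apply: nullset_neq0 => //.
  exact: key.
move=> x Bx; have [m m0 Kx] := kbox_cover x.
have Bx0 : ~ B0 x by move=> h1; apply: Bx; left.
have : dm m x = 0%E.
  apply/eqP/negPn/negP => h1; apply: Bx; right; exists m.-1 => //=.
  by rewrite prednK.
rewrite /dm ind1// mule1 /d off_out// => -[/eqP]; rewrite subr_eq0 => /eqP ->.
by rewrite /sg fineK.
Qed.

Lemma limit_wdecomp : exists lam b, wdecomp p0 p f lam b.
Proof.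
have [B [g [hB mg [g0 gs] gA gf]]] := limit_family.
pose t i := ((cubew (l i))^-1%:E * nrm (fun x => (g i x)%:E))%E.
have t0 i : (0 <= t i)%E by apply: mule_ge0 => //; apply: nrm_ge0 => x; rewrite lee_fin.
have tfin i : t i \is a fin_num.
  rewrite ge0_fin_numE//; apply: le_lt_trans (ltry A); apply: le_trans gA.
  exact: term_le_nneseries.
(* The extra [2^-(i+1)] makes [lam i] positive, so that pieces of norm zero can be divided by it,
   and costs 1 in total. *)
pose lam i := fine (t i) + 1 / (2 ^ i.+1)%:R.
have e0 i : 0 < 1 / (2 ^ i.+1)%:R :> R by rewrite divr_gt0// ltr0n expn_gt0.
have ft0 i : 0 <= fine (t i) by exact: fine_ge0.
have lam0 i : 0 < lam i by rewrite ltr_wpDl.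
exists lam, (fun i x => (lam i)^-1 * g i x); split.
- move=> i; apply: (wblock_scaled p_gt1 (c := c i) (l_gt0 i) (lam0 i) (mg i)); first exact: gs.
  rewrite (_ : (fun x => _) = fun x => (g i x)%:E); last first.
    by apply/funext => x; rewrite ger0_norm.
  have cl := cubew_gt0 p0 p (l_gt0 i).
  have -> : nrm (fun x => (g i x)%:E) = ((cubew (l i))%:E * t i)%E.
    by rewrite /t muleA -EFinM mulfV ?mul1e// gt_eqF.
  rewrite -(fineK (tfin i)) -EFinM lee_fin mulrC ler_wpM2r ?(ltW cl)//.
  by rewrite /lam lerDl ltW.
- apply: (@le_lt_trans _ _ (A%:E + 1%:E)%E); last by rewrite -EFinD ltry.
  apply: (@le_trans _ _ (\sum_(i <oo) t i + 1%:E)%E); last exact: leeD.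
  apply: le_trans (epsilon_trick xpredT t0 ler01).
  apply: lee_nneseries => i *; first by rewrite lee_fin.
  by rewrite (gtr0_norm (lam0 i)) /lam EFinD fineK.
- exists B; split => // x /gf gx.
  rewrite (_ : (fun N => _) = fun N => \sum_(i < N) g i x); last first.
    by apply/funext => N; apply: eq_bigr => i _; rewrite mulrA mulfV ?mul1r// gt_eqF.
  have : (fun N => \sum_(0 <= i < N) (g i x)%:E)%E @ \oo --> (f x)%:E.
    by rewrite -gx; apply: is_cvg_nneseries => i _ _; rewrite lee_fin.
  move=> /fine_cvgP[_]; apply: cvg_trans; apply: near_eq_cvg; apply: nearW => N /=.
  by rewrite big_mkord sumEFin.
Qed.

End Compactness.

(** * Regrouping a block decomposition along the grid *)

Section GridDecomposition.
Context {R : realType} {n : nat}.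
Local Notation pt := ('I_n.+1 -> R).
Local Notation bpt := (@bpt R n.+1).
Local Notation emeas := (@measurable_fun _ _ bpt (\bar R) setT).
Local Notation bmeas := (@measurable_fun _ _ bpt R setT).
Context (p0 : R) (p : 'I_n.+1 -> R).
Context (p0_gt1 : 1 < p0) (p_gt1 : forall i, 1 < p i).
Context (p0p : n.+1%:R / p0 < \sum_i (p i)^-1).
Local Notation nrm := (nrm p).
Local Notation cubew := (cubew p0 p).
Let expo := \sum_i (p i)^-1 - n.+1%:R / p0.
Let expo_gt0 : 0 < expo. Proof. by rewrite subr_gt0. Qed.

Lemma cubew_enlarge (l l' : R) : 0 < l -> 0 < l' -> l <= 3 * l' ->
  cubew l' <= 3 `^ expo * cubew l.
Proof.
move=> l0 l'0 ll'; rewrite !cubewE//.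
have -> : n.+1%:R / p0 - \sum_i (p i)^-1 = - expo by rewrite opprB.
rewrite !powRN ler_pdivlMr ?powR_gt0// mulrC ler_pdivrMr ?powR_gt0//.
rewrite -powRM ?ler0n ?(ltW l'0)//.
by apply: ge0_ler_powR; rewrite ?nnegrE ?(ltW expo_gt0) ?(ltW l0) ?mulr_ge0 ?ler0n ?(ltW l'0).
Qed.

Context (c : nat -> pt) (l : nat -> R) (l_gt0 : forall k, 0 < l k).
Context (grid_cover : forall (c' : pt) (l' : R), 0 < l' ->
  exists k, cube c' l' `<=` cube (c k) (l k) /\ l k <= 3 * l').

(** Greedy truncation of the terms [|lam i * b i|] sums exactly to [y] while keeping each piece
    below its term, so supports and norms stay under control. The pieces are then collected
    according to the grid cube [idx i] that contains the cube of [b i]. *)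
Lemma grid_decomposition (y : bpt -> R) (lam : nat -> R) (b : nat -> bpt -> R) :
  bmeas y -> (forall x, 0 <= y x) -> (forall i, wblock p0 p (b i)) ->
  (\sum_(i <oo) (`|lam i|)%:E <= 2%:E)%E ->
  (forall x, (y x)%:E <= \sum_(i <oo) (`|lam i * b i x|)%:E)%E ->
  exists G : nat -> bpt -> R,
    [/\ forall i, bmeas (G i), forall i x, 0 <= G i x,
      forall i x, G i x != 0 -> cube (c i) (l i) x,
      (bsum p0 p l G <= (3 `^ expo * 2)%:E)%E &
      forall x, (\sum_(i <oo) (G i x)%:E = (y x)%:E)%E].
Proof.
move=> my y0 hb hlam yle.
pose K := 3 `^ expo; have K0 : 0 < K by rewrite powR_gt0.
have q_gt1 i : 1 < conj_exp (p i) by exact: conj_exp_gt1.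
have [idx Pidx] : {idx : nat -> nat & forall i,
    (forall x, b i x != 0 -> cube (c (idx i)) (l (idx i)) x) /\
    (nrm (fun x => (`|b i x|)%:E) <= (K * cubew (l (idx i)))%:E)%E}.
  apply: (@choice _ _ (fun i k => (forall x, b i x != 0 -> cube (c k) (l k) x) /\
    (nrm (fun x => (`|b i x|)%:E) <= (K * cubew (l k))%:E)%E)) => i.
  have [_ [_ [c' [l' [l'0 [bs bn]]]]]] := hb i.
  have [k [ck lk]] := grid_cover c' l'0; exists k; split; first by move=> x /bs /ck.
  by apply: (le_trans bn); rewrite lee_fin; exact: cubew_enlarge.
have mb i : bmeas (b i) by exact: (hb i).1.
pose a i x := `|lam i * b i x|; pose gr i x := greedy (a^~ x) (y x) i.
have ma i : bmeas (a i).
  by apply: measurableT_comp => //; apply: measurable_funM => //; exact: measurable_cst.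
have mgr i : bmeas (gr i).
  apply: measurable_minr => //; apply: measurable_maxr; first exact: measurable_cst.
  by apply: measurable_funB => //; exact: measurable_sum.
have a0 i x : 0 <= a i x by exact: normr_ge0.
have gr0 i x : 0 <= gr i x by exact: greedy_ge0.
pose u k i x := if idx i == k then gr i x else 0.
have u0 k i x : 0 <= u k i x by rewrite /u; case: ifP.
have mu k i : bmeas (u k i).
  by rewrite /u; case: (idx i == k); [exact: mgr|exact: measurable_cst].
have ue0 k i x : (0 <= (u k i x)%:E)%E by rewrite lee_fin.
have mue k i : emeas (fun x => (u k i x)%:E) by apply/measurable_EFinP.
have sgr x : (\sum_(i <oo) (gr i x)%:E = (y x)%:E)%E by exact: greedy_nneseries.
have su k x : (\sum_(i <oo) (u k i x)%:E <= (y x)%:E)%E.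
  rewrite -sgr; apply: lee_nneseries => i *; first exact: ue0.
  by rewrite lee_fin /u; case: ifP.
have fu k x : (\sum_(i <oo) (u k i x)%:E)%E \is a fin_num.
  rewrite ge0_fin_numE; first exact: le_lt_trans (su k x) (ltry _).
  by apply: nneseries_ge0 => i _ _; exact: ue0.
pose G k x := fine (\sum_(i <oo) (u k i x)%:E)%E.
have GE k x : ((G k x)%:E = \sum_(i <oo) (u k i x)%:E)%E by rewrite /G fineK.
exists G; split.
- by move=> k; apply: measurable_fineT; exact: emeas_nneseries.
- by move=> k x; rewrite fine_ge0//; apply: nneseries_ge0 => i _ _; exact: ue0.
- move=> k x; apply: contraNP => nx; apply/eqP; rewrite /G eseries0// => i _ _.
  rewrite /u; case: eqP => // ik; congr EFin; apply/le_anti; rewrite gr0 andbT.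
  have -> : (0 : R) = a i x; last exact: greedy_le.
  rewrite /a; have [->|/((Pidx i).1)] := eqVneq (b i x) 0; first by rewrite mulr0 normr0.
  by rewrite ik => /nx.
- rewrite /bsum.
  apply: (@le_trans _ _ (\sum_(k <oo) \sum_(i <oo) (if idx i == k then (K * `|lam i|)%:E else 0))%E).
    apply: lee_nneseries => k *.
      apply: mule_ge0; first by rewrite lee_fin invr_ge0 ltW// cubew_gt0.
      apply: nrm_ge0 => x; rewrite GE; apply: nneseries_ge0 => i _ _; exact: ue0.
    have cl := cubew_gt0 p0 p (l_gt0 k).
    have -> : (fun x => (G k x)%:E) = (fun x => (\sum_(i <oo) (u k i x)%:E)%E).
      by apply/funext => x; exact: GE.
    apply: (@le_trans _ _ ((cubew (l k))^-1%:E * \sum_(i <oo) nrm (fun x => (u k i x)%:E))%E).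
      apply: lee_wpmul2l; first by rewrite lee_fin invr_ge0 ltW.
      by apply: msteps_nneseries_le => // i; exact: ltW.
    rewrite -nneseriesZl; last by move=> i _; apply: nrm_ge0.
    apply: lee_nneseries => i *.
      by apply: mule_ge0; [rewrite lee_fin invr_ge0 ltW|apply: nrm_ge0].
    rewrite /u; case: eqP => [ik|_]; last first.
      rewrite [X in (_ * X)%E](_ : _ = 0%E) ?mule0//; rewrite /nrm msteps0//.
      by move=> j; exact: lt_trans (q_gt1 j).
    apply: (@le_trans _ _ ((cubew (l k))^-1%:E * ((`|lam i|)%:E * (K * cubew (l k))%:E))%E).
      apply: lee_wpmul2l; first by rewrite lee_fin invr_ge0 ltW.
      apply: (@le_trans _ _ (nrm (fun x => (`|lam i|)%:E * (`|b i x|)%:E)%E)).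
        apply: le_nrm => // x; first by rewrite lee_fin.
        rewrite -EFinM lee_fin -normrM.
        exact: greedy_le.
      rewrite nrmZ//; last exact: emeas_abs.
      by apply: lee_wpmul2l => //; rewrite -ik; exact: (Pidx i).2.
    rewrite -!EFinM lee_fin le_eqVlt; apply/orP; left; apply/eqP.
    by rewrite mulrCA (mulrC K) mulKf ?gt_eqF// mulrC.
  (* Each [i] belongs to the single class [idx i], so exchanging the sums leaves [K] times the sum
     of the [|lam i|]. *)
  rewrite nneseries_interchange; last first.
    by move=> k i; case: ifP => // _; rewrite lee_fin mulr_ge0// ltW.
  rewrite (eq_eseriesr (g := fun i => (K%:E * (`|lam i|)%:E)%E)); last first.
    by move=> i _; rewrite nneseries_single ?EFinM// lee_fin mulr_ge0// ltW.
  rewrite nneseriesZl; last by move=> *; rewrite lee_fin.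
  by rewrite EFinM; apply: lee_wpmul2l => //; rewrite lee_fin ltW.
- move=> x; rewrite -sgr.
  rewrite (eq_eseriesr (g := fun k => (\sum_(i <oo) (u k i x)%:E)%E)); last by move=> k _; exact: GE.
  rewrite nneseries_interchange; last by move=> k i; exact: ue0.
  apply: eq_eseriesr => i _.
  rewrite -[RHS](@nneseries_single R (gr i x)%:E (idx i)); last by rewrite lee_fin.
  by apply: eq_eseriesr => k _; rewrite /u; case: ifP.
Qed.

End GridDecomposition.

(** * Membership of the limit *)

Section FatouProperty.
Context {R : realType} {n : nat}.
Local Notation pt := ('I_n.+1 -> R).
Local Notation bpt := (@bpt R n.+1).
Local Notation bmeas := (@measurable_fun _ _ bpt R setT).
Context (p0 : R) (p : 'I_n.+1 -> R).
Context (p0_gt1 : 1 < p0) (p_gt1 : forall i, 1 < p i).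
Context (p0p : n.+1%:R / p0 < \sum_i (p i)^-1).

Lemma in_block_limit (F : nat -> pt -> R) (f : pt -> R) :
  (forall k, in_block p0 p (F k)) -> (forall k x, 0 <= F k x) ->
  (forall k, (block_norm p0 p (F k) <= 1)%E) ->
  ae (fun x => nondecreasing_seq (fun k => F k x) /\ (fun k : nat => F k x) @ \oo --> f x) ->
  in_block p0 p f.
Proof.
move=> hF F0 F1 [N0 [hN0 HN0]].
(* Norm at most 1 and slack 1 give coefficients of total size at most 2, uniformly in [k]. *)
have H k : exists lb : (nat -> R) * (nat -> pt -> R), wdecomp p0 p (F k) lb.1 lb.2 /\
    (\sum_(i <oo) (`|lb.1 i|)%:E <= 2%:E)%E.
  have [lam [b [h1 /ltW h2]]] := in_block_wdecomp p_gt1 (hF k) ltr01.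
  exists (lam, b); split => //; apply: le_trans h2 _.
  have -> : 2%:E = (1 + 1)%E :> \bar R by rewrite -EFinD.
  exact: leeD.
have [lb Plb] := @choice _ _ _ H.
have [N PN] := @choice _ _ _ (fun k => let: And3 _ _ h := (Plb k).1 in h).
(* One null set for the failure of monotone convergence and for the failure of any of the countably
   many decompositions to sum to [F k]. *)
have hN : nullset (N0 `|` \bigcup_k N k).
  by apply: nullsetU => //; apply: nullset_bigcup => k; exact: (PN k).1.
have [B [mB hB NB mF]] := off_choose (fun k => (hF k).1) hN.
pose F' k := off B (F k); pose f' := off B f.
have F'0 k x : 0 <= F' k x by have /andP[] := @off_itv _ _ B (F k) x (F0 k x).
have nF' x : nondecreasing_seq (F'^~ x).
  move=> i j ij; have [Bx|Bx] := pselect (B x); first by rewrite /F' !off_in.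
  by rewrite /F' !off_out//; apply: (HN0 x _).1 => // h; apply: Bx; apply: NB; left.
have cF' x : (fun k => F' k x) @ \oo --> f' x.
  have [Bx|Bx] := pselect (B x).
    rewrite /f' off_in// (_ : (fun k => _) = fun=> 0); first exact: cvg_cst.
    by apply/funext => k; rewrite /F' off_in.
  rewrite /f' off_out// (_ : (fun k => _) = fun k => F k x).
    by apply: (HN0 x _).2 => // h; apply: Bx; apply: NB; left.
  by apply/funext => k; rewrite /F' off_out.
have F'f' k x : F' k x <= f' x.
  have cv := cF' x; rewrite -(cvg_lim _ cv)//; apply: nondecreasing_cvgn_le => //.
  by apply/cvg_ex; eexists; exact: cv.
have mf' : bmeas f' by apply: (measurable_fun_cvg mF) => x _; exact: cF'.
have [c [l [l0 gcover gfin]]] := @grid_exists R n.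
pose A := 3 `^ (\sum_i (p i)^-1 - n.+1%:R / p0) * 2.
have ne k : fam p0 p c l A F' f' k !=set0.
  have [[hb _ _] hs] := Plb k.
  have [|G [G1 G2 G3 G4 G5]] := @grid_decomposition R n p0 p p_gt1 p0p c l l0 gcover (F' k)
    (lb k).1 (lb k).2 (mF k) (F'0 k) hb hs.
    move=> x; have [Bx|Bx] := pselect (B x).
      by rewrite /F' off_in//; apply: nneseries_ge0 => i _ _; rewrite lee_fin.
    rewrite /F' off_out// -(ger0_norm (F0 k x)).
    have cx := (PN k).2 x (fun h => Bx (NB _ (or_intror (ex_intro2 _ _ k I h)))).
    (* The tail estimate at [N = 0] bounds the limit by the sum of the absolute values of all
       terms. *)
    have := series_tail_le (u := fun i => (lb k).1 i * (lb k).2 i x) 0 cx.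
    rewrite big_ord0 sub0r normrN => /le_trans; apply.
    by under eq_eseriesr do rewrite addn0.
  by exists G; split => // x; rewrite G5 !lee_fin lexx F'f'.
have [lam [b [h1 h2 h3]]] := limit_wdecomp p0_gt1 p_gt1 p0p l0 gfin mf' F'0 nF' cF' ne.
have mf : lmeasurable_fun f.
  by apply: (off_lmeasurable mf' hB) => x Bx; rewrite /f' off_out.
split => //; exists lam, b; apply: wdecomp_block_decomp => //; split => //.
apply: ae_sub (ae_and h3 (ae_off (P := fun x => ~ B x) hB (fun x h => h))) => x [cx Bx].
by move: cx; rewrite /f' off_out.
Qed.

End FatouProperty.

Theorem theorem4p1 (R : realType) (n : nat) (p0 : R) (p : 'I_n -> R)
    (F : nat -> ('I_n -> R) -> R) (f : ('I_n -> R) -> R) :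
  1 < p0 -> (forall i, 1 < p i) -> n%:R / p0 < \sum_i (p i)^-1 ->
  (forall k, in_block p0 p (F k)) ->
  (forall k x, 0 <= F k x) ->
  (forall k, (block_norm p0 p (F k) <= 1)%E) ->
  ae (fun x => nondecreasing_seq (fun k => F k x) /\
               (fun k : nat => F k x) @ \oo --> f x) ->
  in_block p0 p f /\
  (fun k : nat => block_norm p0 p (F k)) @ \oo --> block_norm p0 p f.
Proof.
case: n p F f => [|n] p F f p0_gt1 p_gt1 p0p hF F0 F1 Ff.
  (* In dimension zero the condition on the exponents reads [0 < 0]. *)
  by move: p0p; rewrite mul0r big_ord0 ltxx.
have hf := in_block_limit p0_gt1 p_gt1 p0p hF F0 F1 Ff.
by split => //; exact: block_norm_cvg.
Qed.
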